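(* Let $D\in\{2\cos\frac{\pi}{n}+1\mid n\ge 3\}\cup[3,\infty)$. Then the trace $\mathrm{tr}$ on $M_\infty(D)=\bigcup_{k\ge1}M_k(D)$ is a factor trace; in particular, the von Neumann algebra $M=\pi(A_\infty)''$ generated in the GNS representation of $\mathrm{tr}$ is a $\mathrm{II}_1$ factor.
   Context: A Motzkin $n$-diagram is a noncrossing partial matching (up to isotopy) of $n$ top points and $n$ bottom points of a rectangle by strings inside the rectangle: each point is joined to at most one other point. $M_n(D)$ is the $\mathbb{C}$-vector space with basis the Motzkin $n$-diagrams and product $xy=D^{\kappa(x,y)}z$, where $x$ is stacked above $y$, the bottom points of $x$ are identified with the top points of $y$, $z$ is the resulting diagram on the outer points, and $\kappa(x,y)$ is the number of closed loops formed (non-closed strings not reaching the outer points are discarded with factor $1$). $M_n(D)\subset M_{n+1}(D)$ by adding a vertical string on the right. The conjugate-linear map $*$ reflects diagrams top to bottom. The trace is $\mathrm{tr}(x)=D^{c(x)-n}$ for an $n$-diagram $x$, where $c(x)$ is the number of closed loops obtained by joining the $i$-th top point to the $i$-th bottom point outside, for all $i$. For the given $D$, $\mathrm{tr}$ is positive semidefinite on every $M_n(D)$. $R_k=\{x\in M_k(D):\mathrm{tr}(xy)=0\ \forall y\in M_k(D)\}$, $A_k=M_k(D)/R_k$ (a finite-dimensional $C^*$-algebra with faithful trace induced by $\mathrm{tr}$), $A_\infty=\bigcup_k A_k$; $\pi$ is the representation of $A_\infty$ by left multiplication on the completion of $A_\infty$ for $\langle x,y\rangle=\mathrm{tr}(y^*x)$.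 A factor trace is a tracial state whose GNS representation generates a factor. *)

(* Defs.v *)
From HB Require Import structures.
From mathcomp Require Import all_boot all_order all_algebra.
From mathcomp Require Import generic_quotient complex.
From mathcomp Require Import all_classical all_reals all_analysis.
From mathcomp Require Import zify.

Set Implicit Arguments.
Unset Strict Implicit.
Unset Printing Implicit Defensive.

Import Order.TTheory GRing.Theory Num.Theory.
Import numFieldNormedType.Exports.
Local Open Scope classical_set_scope.
Local Open Scope ring_scope.
Local Open Scope complex_scope.
Local Open Scope quotient_scope.

(* (true, i) is the i-th top point, (false, i) the i-th bottom point. *)
Definition point (n : nat) : finType := (bool * 'I_n)%type.

Definition flip n (p : point n) : point n := (~~ p.1, p.2).

(* Rank of a point on the boundary of the rectangle: along the top from left
   to right, then along the bottom from right to left. *)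
Definition bpos n (p : point n) : nat :=
  if p.1 then nat_of_ord p.2 else (n + n - (p.2).+1)%N.

(* A partial matching is an involution: the fixed points are the unmatched
   points. *)
Definition motzkin n (d : {ffun point n -> point n}) : bool :=
  [forall p, d (d p) == p] &&
  [forall p, forall q,
     ~~ [&& bpos p < bpos q, bpos q < bpos (d p) & bpos (d p) < bpos (d q)]%N].

Record mdiag (n : nat) := Mdiag
  { matching :> {ffun point n -> point n} ; matchingP : motzkin matching }.

HB.instance Definition _ n := [isSub for @matching n].
HB.instance Definition _ n := [Finite of mdiag n by <:].

(* A system of strings on a finite set of points is given by two involutions
   f and g; a fixed point of f or g is a loose end.  A closed loop is a
   connected component without loose ends.  (Reading off the multigraph from
   f and g, rather than from its adjacency relation, makes two points joined
   both by f and by g a closed loop.) *)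
Section Strings.
Variables (T : finType) (f g : T -> T).

Definition joined : rel T := [rel u v | (v == f u) || (v == g u)].

Definition on_loop : pred T := fun u =>
  [forall v, connect joined u v ==> (f v != v) && (g v != v)].

Definition loops : nat := n_comp joined on_loop.

End Strings.

Section Stacking.
Variables (n : nat) (x y : {ffun point n -> point n}).

(* [inl]: the points of the upper diagram x; [inr]: those of the lower one y. *)
Definition stack_strings (v : point n + point n) : point n + point n :=
  match v with inl p => inl (x p) | inr p => inr (y p) end.

Definition stack_glue (v : point n + point n) : point n + point n :=
  match v with
  | inl (false, i) => inr (true, i)
  | inr (true, i) => inl (false, i)
  | _ => v
  end.

Definition stack_outer (p : point n) : point n + point n :=
  if p.1 then inl p else inr p.

Definition stack : {ffun point n -> point n} :=
  [ffun p => odflt p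
    [pick q | (q != p) && connect (joined stack_strings stack_glue)
                                  (stack_outer p) (stack_outer q)]].

Definition kappa : nat := loops stack_strings stack_glue.

End Stacking.

Definition closure_loops n (x : {ffun point n -> point n}) : nat :=
  loops x (@flip n).

Definition vertical n : {ffun point n -> point n} := [ffun p => flip p].

Definition mreflect n (x : {ffun point n -> point n}) :
    {ffun point n -> point n} := [ffun p => flip (x (flip p))].

(* For n <= m: the n-diagram x with m - n vertical strings added on the right. *)
Definition pad n m (x : {ffun point n -> point n}) :
    {ffun point m -> point m} :=
  [ffun p : point m =>
    if insub (val p.2) is Some i
    then let q := x (p.1, i) in (q.1, insubd p.2 (val q.2))
    else flip p].

Section PadTheory.

Lemma pad_lt n m (x : {ffun point n -> point n}) s (i : 'I_m) (lt_i_n : (i < n)%N) :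
  pad m x (s, i) = ((x (s, Ordinal lt_i_n)).1, insubd i (val (x (s, Ordinal lt_i_n)).2)).
Proof. by rewrite ffunE /= insubT. Qed.

Lemma pad_ge n m (x : {ffun point n -> point n}) s (i : 'I_m) :
  (n <= i)%N -> pad m x (s, i) = (~~ s, i).
Proof. by move=> le_n_i; rewrite ffunE /= insubF // ltnNge le_n_i. Qed.

Definition widen_point n m (le_nm : (n <= m)%N) (p : point n) : point m :=
  (p.1, widen_ord le_nm p.2).

Lemma pad_widen n m (le_nm : (n <= m)%N) (x : {ffun point n -> point n}) p :
  pad m x (widen_point le_nm p) = widen_point le_nm (x p).
Proof.
case: p => s i; rewrite /widen_point /= pad_lt //= => lt_i_n.
have ->: Ordinal lt_i_n = i by apply: val_inj.
congr (_, _); apply: val_inj; rewrite val_insubd /=.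
by rewrite (leq_trans (ltn_ord _) le_nm).
Qed.

Variant point_spec n m (le_nm : (n <= m)%N) (p : point m) : Type :=
  | PointOld (q : point n) of p = widen_point le_nm q
  | PointNew of (n <= p.2)%N.

Lemma pointP n m (le_nm : (n <= m)%N) (p : point m) : point_spec le_nm p.
Proof.
case: p => s i; case: (ltnP i n) => [lt_i_n | ?]; last by right.
by left with (s, Ordinal lt_i_n); congr (_, _); apply: val_inj.
Qed.

Lemma pad_new n m (x : {ffun point n -> point n}) (p : point m) :
  (n <= p.2)%N -> pad m x p = flip p.
Proof. by case: p => s i; apply: pad_ge. Qed.

Lemma pad_motzkin n m (x : {ffun point n -> point n}) :
  (n <= m)%N -> motzkin x -> motzkin (pad m x).
Proof.
move=> le_nm /andP[/forallP xK /forallP xN]; apply/andP; split.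
  apply/forallP=> p; case: (pointP le_nm p) => [q ->|ge_p].
    by rewrite !pad_widen (eqP (xK q)).
  by rewrite !pad_new //= /flip /= negbK; case: (p).
apply/forallP=> p; apply/forallP=> q.
have bW (r : point n) : bpos (widen_point le_nm r) =
    (if r.1 then r.2 : nat else m + m - r.2.+1)%N by [].
have bN (r : point m) : bpos (flip r) =
    (if r.1 then m + m - r.2.+1 else r.2)%N.
  by rewrite /bpos /=; case: r.1.
have bE (r : point m) : bpos r =
    (if r.1 then r.2 : nat else m + m - r.2.+1)%N by [].
case: (pointP le_nm p) => [p' ->|ge_p]; case: (pointP le_nm q) => [q' ->|ge_q].
- rewrite !pad_widen; apply: contra (forallP (xN p') q').
  rewrite !bW /bpos.
  have := ltn_ord p'.2; have := ltn_ord q'.2.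
  have := ltn_ord (x p').2; have := ltn_ord (x q').2.
  by case: p'.1; case: q'.1; case: (x p').1; case: (x q').1 => *; lia.
- rewrite pad_widen pad_new // !bW bN bE.
  have := ltn_ord p'.2; have := ltn_ord (x p').2; have := ltn_ord q.2.
  by case: p'.1; case: (x p').1; case: q.1 => *; lia.
- rewrite pad_widen pad_new // !bW bN bE.
  have := ltn_ord q'.2; have := ltn_ord (x q').2; have := ltn_ord p.2.
  by case: q'.1; case: (x q').1; case: p.1 => *; lia.
- rewrite !pad_new // !bN !bE.
  have := ltn_ord q.2; have := ltn_ord p.2.
  by case: p.1; case: q.1 => *; lia.
Qed.

Lemma pad_pad n m k (x : {ffun point n -> point n}) :
  (n <= m)%N -> (m <= k)%N -> pad k (pad m x) = pad k x.
Proof.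
move=> le_nm le_mk; have le_nk := leq_trans le_nm le_mk.
apply/ffunP=> p; case: (pointP le_mk p) => [q ->|ge_p]; last first.
  by rewrite !pad_new // (leq_trans le_nm).
rewrite pad_widen; case: (pointP le_nm q) => [r ->|ge_q].
  have wE (s : point n) :
      widen_point le_mk (widen_point le_nm s) = widen_point le_nk s.
    by congr (_, _); apply: val_inj.
  by rewrite pad_widen !wE pad_widen.
by rewrite !pad_new.
Qed.

End PadTheory.

Definition motz (R : realType) (n : nat) := {ffun mdiag n -> R[i]^o}.

(* The basis vector of the diagram d; it is 0 if d is not a Motzkin diagram,
   which does not happen in the uses below. *)
Definition mbasis (R : realType) n (d : {ffun point n -> point n}) : motz R n :=
  [ffun c : mdiag n => ((matching c == d)%:R : R[i]^o)].

Definition mone (R : realType) n : motz R n := mbasis R (vertical n).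

Definition mmul (R : realType) (D : R) n (x y : motz R n) : motz R n :=
  \sum_(a : mdiag n) \sum_(b : mdiag n)
    (x a * y b * D%:C ^+ kappa a b) *: mbasis R (stack a b).

Definition mstar (R : realType) n (x : motz R n) : motz R n :=
  \sum_(a : mdiag n) (x a)^* *: mbasis R (mreflect a).

Definition mtr (R : realType) (D : R) n (x : motz R n) : R[i] :=
  \sum_(a : mdiag n) x a * D%:C ^ ((closure_loops a)%:Z - n%:Z).

(* The inclusion of M_n(D) into M_m(D) when n <= m; junk otherwise. *)
Definition mwiden (R : realType) n m (x : motz R n) : motz R m :=
  \sum_(a : mdiag n) x a *: mbasis R (pad m a).

Definition mrad (R : realType) (D : R) n : {pred motz R n} :=
  fun x => `[< forall y : motz R n, mtr D (mmul D x y) = 0 >].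

Definition mzero (R : realType) n : {pred motz R n} := pred1 0.

Section MotzTheory.
Variables (R : realType).

Lemma mwiden_linear n m : linear (@mwiden R n m).
Proof.
move=> c x y; rewrite /mwiden scaler_sumr -big_split; apply: eq_bigr => a _ /=.
by rewrite !ffunE scalerDl scalerA.
Qed.

HB.instance Definition _ n m :=
  GRing.isLinear.Build R[i] (motz R n) (motz R m) _ (@mwiden R n m)
    (@mwiden_linear n m).

Lemma sum_mbasis n (V : lmodType R[i]) (d : mdiag n) (F : mdiag n -> V) :
  \sum_(a : mdiag n) (mbasis R d a : R[i]) *: F a = F d.
Proof.
rewrite (bigD1 d) //= big1 ?addr0; first by rewrite ffunE eqxx scale1r.
move=> a ne_ad; rewrite ffunE (_ : (matching a == matching d) = false) ?scale0r //.
by apply/negbTE.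
Qed.

Lemma mwiden_mwiden n m k (x : motz R n) :
  (n <= m)%N -> (m <= k)%N -> mwiden k (mwiden m x) = mwiden k x.
Proof.
move=> le_nm le_mk; rewrite [mwiden m x]/mwiden linear_sum /=.
apply: eq_bigr => a _; rewrite linearZ /=; congr (_ *: _).
pose b := Mdiag (pad_motzkin le_nm (matchingP a)).
by rewrite /mwiden (sum_mbasis b) /= pad_pad.
Qed.

Lemma mtr_linear (D : R) n : scalar (@mtr R D n).
Proof.
move=> c x y; rewrite /mtr mulr_sumr -big_split; apply: eq_bigr => a _ /=.
by rewrite !ffunE mulrDl mulrA.
Qed.

Lemma mmul_linearl (D : R) n (y : motz R n) : linear ((@mmul R D n)^~ y).
Proof.
move=> c x x'; rewrite /mmul scaler_sumr -big_split; apply: eq_bigr => a _ /=.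
rewrite scaler_sumr -big_split; apply: eq_bigr => b _ /=.
by rewrite !ffunE !mulrDl scalerDl scalerA !mulrA.
Qed.

Lemma mrad_submod (D : R) n : submod_closed (@mrad R D n).
Proof.
have mtr0 : mtr D (0 : motz R n) = 0.
  by rewrite /mtr big1 // => a _; rewrite ffunE mul0r.
have mmul0 (y : motz R n) : mmul D 0 y = 0.
  by rewrite /mmul big1 // => a _; rewrite big1 // => b _;
     rewrite ffunE !mul0r scale0r.
split; first by apply/asboolP=> y; rewrite mmul0 mtr0.
move=> c x x' /asboolP x0 /asboolP x'0; apply/asboolP=> y.
by rewrite (mmul_linearl D y) mtr_linear x0 x'0 mulr0 addr0.
Qed.

HB.instance Definition _ (D : R) n :=
  GRing.isSubmodClosed.Build R[i] (motz R n) (@mrad R D n) (mrad_submod D n).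

Lemma mzero_submod n : submod_closed (@mzero R n).
Proof.
split; first exact: eqxx.
by move=> c x y /eqP-> /eqP->; apply/eqP; rewrite scaler0 addr0.
Qed.

HB.instance Definition _ n :=
  GRing.isSubmodClosed.Build R[i] (motz R n) (@mzero R n) (mzero_submod n).

End MotzTheory.

(* For a family of subspaces K_n of M_n(D), the union over n of the quotients
   M_n(D)/K_n: an element is represented by an element of some M_n(D), and two
   representatives are identified when their images in M_m(D) agree modulo K_m
   for all large m.  K = 0 gives M_oo(D); K_n = R_n gives A_oo, in which A_n is
   the image of M_n(D), since R_n is the intersection of R_(n+1) and M_n(D). *)
Section Union.
Variables (R : realType) (K : forall n, submodClosed (motz R n)).

Definition tower := {n : nat & motz R n}.

Definition at_level m (x : tower) : motz R m := mwiden m (tagged x).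

Definition tower_eq : rel tower := fun x y =>
  `[< \forall m \near \oo, at_level m x - at_level m y \in K m >].

Lemma tower_eq_equiv : equiv_class_of tower_eq.
Proof.
split.
- by move=> x; apply/asboolP; near=> m; rewrite subrr rpred0.
- by move=> x y; apply/asboolP/asboolP; apply: filterS => m Kxy;
    rewrite -opprB -scaleN1r rpredZ.
- move=> y x z /asboolP xy /asboolP yz; apply/asboolP; near=> m.
  rewrite -(subrK (at_level m y) (at_level m x)) -addrA rpredD //; near: m;
    [exact: xy | exact: yz].
Unshelve. all: end_near. Qed.

Canonical tower_eq_equiv_rel := EquivRelPack tower_eq_equiv.

Definition tower_union := {eq_quot tower_eq}%qT.

HB.instance Definition _ := Choice.on tower_union.
HB.instance Definition _ := EqQuotient.on tower_union.

Definition union_class n (x : motz R n) : tower_union :=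
  \pi_(tower_union) (Tagged (motz R) x).

Definition union_op2 (op : forall n, motz R n -> motz R n -> motz R n)
    (x y : tower_union) : tower_union :=
  let n := maxn (tag (repr x)) (tag (repr y)) in
  union_class (op n (at_level n (repr x)) (at_level n (repr y))).

Definition union_op1 (op : forall n, motz R n -> motz R n)
    (x : tower_union) : tower_union :=
  union_class (op (tag (repr x)) (tagged (repr x))).

Definition union_add := union_op2 (fun n x y => x + y).
Definition union_opp := union_op1 (fun n x => - x).
Definition union_scale (c : R[i]) := union_op1 (fun n x => c *: x).
Definition union_zero := union_class (0 : motz R 0).

Lemma union_eqP (x y : tower) :
  (\forall m \near \oo, at_level m x - at_level m y \in K m) <->
  \pi_(tower_union) x = \pi_(tower_union) y.
Proof.
by split=> [xy | /eqmodP/asboolP//]; apply/eqmodP/asboolP.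
Qed.

Lemma repr_class n (x : motz R n) :
  \forall m \near \oo,
    at_level m (repr (union_class x)) - mwiden m x \in K m.
Proof.
apply/(union_eqP (repr (union_class x)) (Tagged (motz R) x)).
by rewrite reprK.
Qed.

Lemma union_op2_level op (x y : tower_union) :
    (forall n m u v, (n <= m)%N -> mwiden m (op n u v) = op m (mwiden m u) (mwiden m v)) ->
  \forall m \near \oo,
    at_level m (repr (union_op2 op x y))
    - op m (at_level m (repr x)) (at_level m (repr y)) \in K m.
Proof.
move=> opE; near=> m.
have le_m : (maxn (tag (repr x)) (tag (repr y)) <= m)%N.
  by near: m; apply: nbhs_infty_ge.
move: (le_m); rewrite geq_max => /andP[le_x le_y].
have -> : op m (at_level m (repr x)) (at_level m (repr y)) =
    mwiden m (op _ (at_level (maxn (tag (repr x)) (tag (repr y))) (repr x))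
                 (at_level _ (repr y))).
  by rewrite opE // /at_level !mwiden_mwiden // ?leq_maxl ?leq_maxr.
by near: m; apply: repr_class.
Unshelve. all: end_near. Qed.

Lemma union_op1_level op (x : tower_union) :
    (forall n m u, (n <= m)%N -> mwiden m (op n u) = op m (mwiden m u)) ->
  \forall m \near \oo,
    at_level m (repr (union_op1 op x)) - op m (at_level m (repr x)) \in K m.
Proof.
move=> opE; near=> m.
have le_m : (tag (repr x) <= m)%N by near: m; apply: nbhs_infty_ge.
by rewrite /at_level -opE //; near: m; apply: repr_class.
Unshelve. all: end_near. Qed.

Definition eqmod (u v : forall m, motz R m) : Prop :=
  \forall m \near \oo, u m - v m \in K m.

Lemma eqmod_eq u v : (forall m, u m = v m) -> eqmod u v.
Proof. by move=> uv; apply: nearW => m; rewrite uv subrr rpred0. Qed.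

Lemma eqmod_refl u : eqmod u u.
Proof. exact: eqmod_eq. Qed.

Lemma eqmod_sym u v : eqmod u v -> eqmod v u.
Proof. by apply: filterS => m Kuv; rewrite -opprB -scaleN1r rpredZ. Qed.

Lemma eqmod_trans v u w : eqmod u v -> eqmod v w -> eqmod u w.
Proof.
by apply: filterS2 => m uv vw; rewrite -(subrK (v m) (u m)) -addrA rpredD.
Qed.

Lemma eqmodD u u' v v' : eqmod u u' -> eqmod v v' ->
  eqmod (fun m => u m + v m) (fun m => u' m + v' m).
Proof. by apply: filterS2 => m hu hv; rewrite opprD addrACA rpredD. Qed.

Lemma eqmodZ c u u' : eqmod u u' ->
  eqmod (fun m => c *: u m) (fun m => c *: u' m).
Proof. by apply: filterS => m hu; rewrite -scalerBr rpredZ. Qed.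

Local Notation level x := (fun m => at_level m (repr x)).

Lemma eqmodP (x y : tower_union) : eqmod (level x) (level y) -> x = y.
Proof. by move=> /union_eqP; rewrite !reprK. Qed.

Lemma union_addE (x y : tower_union) : eqmod (level (union_add x y))
  (fun m => at_level m (repr x) + at_level m (repr y)).
Proof. by apply: union_op2_level => n m u v _; rewrite linearD. Qed.

Lemma union_oppE (x : tower_union) :
  eqmod (level (union_opp x)) (fun m => - at_level m (repr x)).
Proof. by apply: union_op1_level => n m u _; rewrite linearN. Qed.

Lemma union_scaleE c (x : tower_union) :
  eqmod (level (union_scale c x)) (fun m => c *: at_level m (repr x)).
Proof. by apply: union_op1_level => n m u _; rewrite linearZ. Qed.

Lemma union_zeroE : eqmod (level union_zero) (fun m => 0).
Proof.
have := repr_class (0 : motz R 0); apply: filterS => m.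
by rewrite linear0.
Qed.

Lemma union_addA : associative union_add.
Proof.
move=> x y z; apply: eqmodP.
apply: (eqmod_trans (union_addE _ _)).
apply: (eqmod_trans (eqmodD (eqmod_refl _) (union_addE _ _))).
apply: eqmod_sym; apply: (eqmod_trans (union_addE _ _)).
apply: (eqmod_trans (eqmodD (union_addE _ _) (eqmod_refl _))).
by apply: eqmod_eq => m; rewrite addrA.
Qed.

Lemma union_addC : commutative union_add.
Proof.
move=> x y; apply: eqmodP; apply: (eqmod_trans (union_addE _ _)).
apply: eqmod_sym; apply: (eqmod_trans (union_addE _ _)).
by apply: eqmod_eq => m; rewrite addrC.
Qed.

Lemma union_add0 : left_id union_zero union_add.
Proof.
move=> x; apply: eqmodP; apply: (eqmod_trans (union_addE _ _)).
apply: (eqmod_trans (eqmodD union_zeroE (eqmod_refl _))).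
by apply: eqmod_eq => m; rewrite add0r.
Qed.

Lemma union_addN : left_inverse union_zero union_opp union_add.
Proof.
move=> x; apply: eqmodP; apply: (eqmod_trans (union_addE _ _)).
apply: (eqmod_trans (eqmodD (union_oppE _) (eqmod_refl _))).
apply: eqmod_sym; apply: (eqmod_trans union_zeroE).
by apply: eqmod_eq => m; rewrite addNr.
Qed.

HB.instance Definition _ := GRing.isZmodule.Build tower_union
  union_addA union_addC union_add0 union_addN.

Lemma union_scaleA a b (v : tower_union) :
  union_scale a (union_scale b v) = union_scale (a * b) v.
Proof.
apply: eqmodP; apply: (eqmod_trans (union_scaleE _ _)).
apply: (eqmod_trans (eqmodZ _ (union_scaleE _ _))).
apply: eqmod_sym; apply: (eqmod_trans (union_scaleE _ _)).
by apply: eqmod_eq => m; rewrite scalerA.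
Qed.

Lemma union_scale1 : left_id 1 union_scale.
Proof.
move=> v; apply: eqmodP; apply: (eqmod_trans (union_scaleE _ _)).
by apply: eqmod_eq => m; rewrite scale1r.
Qed.

Lemma union_scaleDr : right_distributive union_scale +%R.
Proof.
move=> c u v; apply: eqmodP; apply: (eqmod_trans (union_scaleE _ _)).
apply: (eqmod_trans (eqmodZ _ (union_addE _ _))).
apply: eqmod_sym; apply: (eqmod_trans (union_addE _ _)).
apply: (eqmod_trans (eqmodD (union_scaleE _ _) (union_scaleE _ _))).
by apply: eqmod_eq => m; rewrite scalerDr.
Qed.

Lemma union_scaleDl v : {morph union_scale^~ v : a b / a + b}.
Proof.
move=> a b; apply: eqmodP; apply: (eqmod_trans (union_scaleE _ _)).
apply: eqmod_sym; apply: (eqmod_trans (union_addE _ _)).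
apply: (eqmod_trans (eqmodD (union_scaleE _ _) (union_scaleE _ _))).
by apply: eqmod_eq => m; rewrite scalerDl.
Qed.

HB.instance Definition _ := GRing.Zmodule_isLmodule.Build R[i] tower_union
  union_scaleA union_scale1 union_scaleDr union_scaleDl.

End Union.

(* Operations only: the laws of a unital *-algebra are not part of the record. *)
Record star_algebra (C : pzRingType) := StarAlgebra {
  sa_space :> lmodType C ;
  sa_mul : sa_space -> sa_space -> sa_space ;
  sa_one : sa_space ;
  sa_star : sa_space -> sa_space }.

Section UnionAlgebra.
Variables (R : realType) (D : R) (K : forall n, submodClosed (motz R n)).

Definition union_algebra : star_algebra R[i] :=
  @StarAlgebra R[i] (tower_union K)
    (union_op2 (@mmul R D)) (union_class K (mone R 0)) (union_op1 (@mstar R)).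

Definition union_tr (x : union_algebra) : R[i] := mtr D (tagged (repr x)).

End UnionAlgebra.

Definition M_oo (R : realType) (D : R) : star_algebra R[i] :=
  union_algebra D (fun n => @mzero R n : submodClosed (motz R n)).

Definition A_oo (R : realType) (D : R) : star_algebra R[i] :=
  union_algebra D (fun n => @mrad R D n : submodClosed (motz R n)).

Definition tr_M (R : realType) (D : R) : M_oo D -> R[i] := @union_tr R D _.

Definition tr_A (R : realType) (D : R) : A_oo D -> R[i] := @union_tr R D _.

(* [hdot] is linear in its first argument. *)
Record hilbert (R : realType) := Hilbert {
  hspace :> completeNormedModType R[i] ;
  hdot : {dot hspace for Num.conj} ;
  hdotE : forall v : hspace, hdot v v = `|v| ^+ 2 }.

Section VonNeumann.
Variables (R : realType) (H : hilbert R).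
Implicit Types (S M : set (H -> H)) (T p q v w : H -> H).

Definition bounded_operators : set (H -> H) :=
  [set T | linear T /\ continuous T].

Definition commutant S : set (H -> H) :=
  [set T | bounded_operators T /\ forall T', S T' -> T \o T' = T' \o T].

Definition adjoint T T' : Prop :=
  forall v w : H, hdot H (T v) w = hdot H v (T' w).

Definition von_neumann_algebra M : Prop :=
  [/\ M `<=` bounded_operators,
      forall T T', M T -> adjoint T T' -> M T' &
      commutant (commutant M) = M].

Definition vn_factor M : Prop :=
  [/\ exists v : H, v <> 0, von_neumann_algebra M &
      M `&` commutant M = range (fun (c : R[i]) (v : H) => c *: v)].

Definition projection p : Prop :=
  [/\ bounded_operators p, p \o p = p & adjoint p p].

Definition minimal_projection M p : Prop :=
  [/\ M p, projection p, p <> (fun=> 0) &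
      forall q, M q -> projection q -> p \o q = q -> q = (fun=> 0) \/ q = p].

(* The identity is a finite projection: every isometry of M is unitary. *)
Definition finite_algebra M : Prop :=
  forall v w, M v -> adjoint v w -> w \o v = idfun -> v \o w = idfun.

Definition II1_factor M : Prop :=
  [/\ vn_factor M, finite_algebra M & ~ (exists p, minimal_projection M p)].

End VonNeumann.

Section GNS.
Variables (R : realType) (A : star_algebra R[i]) (phi : A -> R[i]).

Definition tracial_state : Prop :=
  [/\ scalar phi, phi (sa_one A) = 1,
      forall x : A, 0 <= phi (sa_mul (sa_star x) x) &
      forall x y : A, phi (sa_mul x y) = phi (sa_mul y x)].

(* H is a completion of A (modulo the null vectors) for <x, y> = phi (y* x),
   eta is the canonical map, and pi is the representation by left
   multiplication. *)
Definition is_GNS (H : hilbert R) (eta : A -> H) (pi : A -> H -> H) : Prop :=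
  [/\ linear eta,
      forall x y : A, hdot H (eta x) (eta y) = phi (sa_mul (sa_star y) x),
      closure (range eta) = setT,
      forall a : A, bounded_operators (pi a) &
      forall a x : A, pi a (eta x) = eta (sa_mul a x)].

(* The GNS representation is unique up to unitary equivalence; we ask that it
   exist and that P hold for the von Neumann algebra generated by any model. *)
Definition GNS_algebra (P : forall H : hilbert R, set (H -> H) -> Prop) : Prop :=
  (exists (H : hilbert R) (eta : A -> H) (pi : A -> H -> H), is_GNS eta pi) /\
  forall (H : hilbert R) (eta : A -> H) (pi : A -> H -> H),
    is_GNS eta pi -> P H (commutant (commutant (range pi))).

Definition factor_trace : Prop :=
  tracial_state /\ GNS_algebra (fun H M => vn_factor M).

End GNS.

(* Main.v *)
Require Import Defs.
From HB Require Import structures.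
From mathcomp Require Import all_boot all_order all_algebra.
From mathcomp Require Import complex zify ring lra.
From mathcomp Require Import all_classical all_reals all_analysis.
Import Defs.

(* Fix [sq >= 0] on the integers with [sq 1 = 1] and, where [sq z <> 0],
   [sq (z-1)^2 + sq z^2 + sq (z+1)^2 = D * sq z^2]; for the given D there is such a weight.
   A Motzkin diagram acts on functions of step sequences whose heights stay where [sq <> 0]: its
   (a, b) entry is 0 unless the steps agree along every string (and are 0 at the unmatched points),
   and otherwise the product over the top and bottom arcs of the ratio of [sq] after and before the
   left end.  Contracting glued points one nested pair at a time shows that stacking becomes the
   matrix product, each loop contributing D.  So tr is a weighted matrix trace, and its radical is
   the kernel of the action.

   Factor: let p_j be the identity with strand j cut.  If tau is a bounded trace and x has level n,
   moving strands shows that tau (x p_j) does not depend on j >= n; as the D p_j - 1 are orthogonal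
   of constant norm, tau (x p_j) = tau x / D.  Every diagram but the identity factors through some
   p_i, which can be moved to the last strand, so induction on the level gives tau = tau(1) tr.  For z
   in the centre of M, applying this to tau x = <z x Omega, Omega> shows that z is a scalar.

   No minimal projection e: let p = p_j ... p_(j+m-1), with D^-m < tau e.  The powers of e(1-p)e have
   trace at least tau e - tau p, so they decrease to a nonzero projection of M below e, that is, to e;
   then p e = 0, whereas <e Omega, p Omega> tends to D^-m tau e as j grows. *)

Set Implicit Arguments.
Unset Strict Implicit.
Unset Printing Implicit Defensive.

Import Order.TTheory GRing.Theory Num.Theory.
Import numFieldNormedType.Exports.
Local Open Scope ring_scope.

(** The squares [sq z ^+ 2] form a Perron-Frobenius vector, with eigenvalue D, of a path with a loop
    at every vertex. For D = 1 + 2 cos(pi/n) it lives on the vertices 1, ..., n - 1, for D >= 3 on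
    all positive integers. Confining the heights to its support makes the mass of every admissible
    walk positive; this is why tr is positive and why its radical is exactly the kernel of the
    action.

    States are infinite sequences, so that adding a vertical string does not change the operator and
    one space carries all levels. A [star_algebra] comes without laws: identities are checked for
    the operators [rep x] and are passed on through [gns_form], that is, up to null vectors. This
    treats M_oo and A_oo together, as unions modulo a family [K] contained in the radicals.

    On the Hilbert space, adjoints and traciality in M are obtained from the extension J of the
    involution and from right multiplications, which lie in the commutant and make the vector Omega
    of the unit separating. *)

Lemma connect_invariant (T : finType) (A : Type) (e : rel T) (P : T -> A) :
  (forall x y, e x y -> P x = P y) -> forall x y, connect e x y -> P x = P y.
Proof.
move=> eP x y /connectP[p + ->]; elim: p x => //= z p IH x /andP[/eP-> /IH].
by [].
Qed.

(** * Contraction of one glued pair in a graph of strings *)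

Section ContractGraph.
Variables (T : finType) (u v : T).

(* The strings ending at u and v are joined into one; u and v themselves become fixed points. *)
Definition contract (f : T -> T) (z : T) : T :=
  if (z == u) || (z == v) then z
  else if f z == u then (if (f v == u) || (f v == v) then z else f v)
  else if f z == v then (if (f u == u) || (f u == v) then z else f u)
  else f z.

(** The glue between [u] and [v] is used up by the contraction. *)
Definition unglue (g : T -> T) (z : T) : T :=
  if (z == u) || (z == v) then z else g z.

Definition dead (z : T) := (z == u) || (z == v).

Variables (f g : T -> T).
Hypotheses (neq_uv : u != v) (fK : involutive f) (gK : involutive g) (guv : g u = v).

Let f' := contract f.
Let g' := unglue g.

Let gvu : g v = u. Proof. by rewrite -guv gK. Qed.

(** In the cases [ContractU] and [ContractV] the string of [z], continued across the glue, runs into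
    a loose end, so [z] itself becomes one. *)
Variant contract_spec (z : T) : T -> Type :=
  | ContractDead of dead z : contract_spec z z
  | ContractU of ~~ dead z & f z = u & dead (f v) : contract_spec z z
  | ContractUV of ~~ dead z & f z = u & ~~ dead (f v) : contract_spec z (f v)
  | ContractV of ~~ dead z & f z = v & dead (f u) : contract_spec z z
  | ContractVU of ~~ dead z & f z = v & ~~ dead (f u) : contract_spec z (f u)
  | ContractF of ~~ dead z & ~~ dead (f z) : contract_spec z (f z).

Lemma contractP z : contract_spec z (contract f z).
Proof.
rewrite /contract -/(dead z) -/(dead (f v)) -/(dead (f u)).
case: ifPn => dz; first exact: ContractDead.
case: eqP => [fzu|/eqP fzu]; first by case: ifPn; [apply: ContractU|apply: ContractUV].
case: eqP => [fzv|/eqP fzv]; first by case: ifPn; [apply: ContractV|apply: ContractVU].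
by apply: ContractF => //; rewrite /dead negb_or fzu.
Qed.

Lemma dead_u : dead u. Proof. by rewrite /dead eqxx. Qed.
Lemma dead_v : dead v. Proof. by rewrite /dead eqxx orbT. Qed.

Lemma contract_dead z : dead z -> contract f z = z.
Proof. by rewrite /contract -/(dead z) => ->. Qed.

Lemma contract_fix z : f z = z -> contract f z = z.
Proof.
move=> fz; case: contractP => // dz; rewrite fz => Ez //.
  by rewrite Ez dead_u in dz.
by rewrite Ez dead_v in dz.
Qed.

Lemma contract_alive z : ~~ dead z -> ~~ dead (contract f z).
Proof. by move=> dz; case: contractP. Qed.

Lemma contractK : involutive (contract f).
Proof.
move=> z; case: (contractP z) => [dz|dz fz dv|dz fz dv|dz fz du|dz fz du|dz dfz].
- by rewrite contract_dead.
- by rewrite /contract -/(dead z) (negbTE dz) fz eqxx -/(dead (f v)) dv.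
- rewrite /contract -/(dead (f v)) (negbTE dv) fK eqxx (eq_sym v u) (negbTE neq_uv).
  have -> : f u = z by rewrite -fz fK.
  by rewrite -/(dead z) (negbTE dz).
- rewrite /contract -/(dead z) (negbTE dz) fz eqxx -/(dead (f u)) du.
  by rewrite (eq_sym v u) (negbTE neq_uv).
- rewrite /contract -/(dead (f u)) (negbTE du) fK eqxx.
  have -> : f v = z by rewrite -fz fK.
  by rewrite -/(dead z) (negbTE dz).
- rewrite /contract -/(dead (f z)) (negbTE dfz) fK.
  by move: dz; rewrite /dead negb_or => /andP[/negbTE-> /negbTE->].
Qed.

Lemma unglue_alive z : ~~ dead z -> g' z = g z /\ ~~ dead (g z).
Proof.
move=> dz; rewrite /g' /unglue -/(dead z) (negbTE dz); split=> //.
apply: contra dz; rewrite /dead => /orP[]/eqP E; apply/orP.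
  by right; rewrite -(gK z) E guv.
by left; rewrite -(gK z) E gvu.
Qed.

Lemma unglueK : involutive g'.
Proof.
move=> z; have [dz|dz] := boolP (dead z).
  by rewrite /g' /unglue -/(dead z) dz -/(dead z) dz.
have [E dg] := unglue_alive dz.
by rewrite E /g' /unglue -/(dead (g z)) (negbTE dg) gK.
Qed.

Let J := joined f g.
Let J' := joined f' g'.

Lemma joined_sym (a b : T -> T) : involutive a -> involutive b ->
  connect_sym (joined a b).
Proof.
move=> aK bK; apply: sym_connect_sym => x y; rewrite /joined /=.
by congr (_ || _); apply/eqP/eqP => [->|->]; rewrite ?aK ?bK.
Qed.

Let Jsym : connect_sym J. Proof. exact: joined_sym fK gK. Qed.
Let J'sym : connect_sym J'. Proof. exact: joined_sym contractK unglueK. Qed.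

Lemma J'_alive z w : connect J' z w -> dead z = dead w.
Proof.
apply: connect_invariant => x y.
have a1 t : dead (f' t) = dead t.
  by have [dt|dt] := boolP (dead t); [rewrite /f' contract_dead|rewrite (negbTE (contract_alive dt))].
have a2 t : dead (g' t) = dead t.
  have [dt|dt] := boolP (dead t); first by rewrite /g' /unglue -/(dead t) dt.
  by have [-> /negbTE] := unglue_alive dt.
by move=> /orP[]/eqP->; rewrite ?a1 ?a2.
Qed.

Lemma connect_f z : connect J z (f z).
Proof. by apply: connect1; rewrite /J /joined /= eqxx. Qed.
Lemma connect_g z : connect J z (g z).
Proof. by apply: connect1; rewrite /J /joined /= eqxx orbT. Qed.
Lemma connect_f' z : connect J' z (f' z).
Proof. by apply: connect1; rewrite /J' /joined /= eqxx. Qed.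
Lemma connect_g' z : connect J' z (g' z).
Proof. by apply: connect1; rewrite /J' /joined /= eqxx orbT. Qed.

Lemma connect_uv : connect J u v.
Proof. by rewrite -guv connect_g. Qed.

Lemma J'_sub z w : connect J' z w -> connect J z w.
Proof.
apply: connect_sub => x y /orP[]/eqP->.
  rewrite /f'; case: (contractP x) => // [dx fx _|dx fx _|_ _]; last exact: connect_f.
    apply: (connect_trans (connect_f x)); rewrite fx.
    by apply: (connect_trans connect_uv); apply: connect_f.
  apply: (connect_trans (connect_f x)); rewrite fx.
  by apply: (@connect_trans _ _ u); [rewrite Jsym connect_uv|apply: connect_f].
by rewrite /g' /unglue; case: ifP => // _; apply: connect_g.
Qed.

Lemma J_sub z w : ~~ dead z -> ~~ dead w -> connect J z w -> connect J' z w.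
Proof.
move=> dz dw.
(* A path may run through [u] or [v], which the contracted graph does not connect to [z]. While it
   is there, [P] remembers that [z] reaches one of the living neighbours [f u], [f v]. *)
pose P w := if dead w then (~~ dead (f u) && connect J' z (f u)) || (~~ dead (f v) && connect J' z (f v))
  else connect J' z w.
suff Pcl x y : J x y -> P x -> P y.
  move=> /connectP[p pth Ew]; suff: P w by rewrite /P (negbTE dw).
  have Pz : P z by rewrite /P (negbTE dz).
  elim: p (z) Pz pth Ew => [|y p IH] x Px /=; first by move=> _ ->.
  by move=> /andP[xy pth]; apply: IH => //; apply: Pcl Px.
rewrite /P; case: ifPn => dx.
  move=> /orP[]/eqP-> Px; last first.
    case/orP: dx => /eqP E; rewrite E ?guv ?gvu; first by rewrite dead_v.
    by rewrite dead_u.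
  case: ifPn => // dy.
  case/orP: dx dy => /eqP-> dy.
    case/orP: Px => /andP[] // dv zv.
    apply: (connect_trans zv); have := connect_f' (f v); rewrite /f'.
    rewrite /contract -/(dead (f v)) (negbTE dv) fK eqxx (eq_sym v u) (negbTE neq_uv).
    by rewrite -/(dead (f u)) (negbTE dy).
  case/orP: Px => /andP[] // du zu.
  apply: (connect_trans zu); have := connect_f' (f u); rewrite /f'.
  by rewrite /contract -/(dead (f u)) (negbTE du) fK eqxx -/(dead (f v)) (negbTE dy).
move=> /orP[]/eqP-> Px; last first.
  have [E dg] := unglue_alive dx; rewrite (negbTE dg) -E.
  by apply: connect_trans Px _; apply: connect_g'.
case: ifPn => dy.
  by case/orP: dy => /eqP E; move: (fK x); rewrite E => ->; rewrite dx Px ?orbT.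
apply: connect_trans Px _; have := connect_f' x; rewrite /f' /contract -/(dead x) (negbTE dx).
by move: dy; rewrite /dead negb_or => /andP[/negbTE-> /negbTE->].
Qed.

Lemma connect_contract z w : ~~ dead z -> ~~ dead w ->
  connect J' z w = connect J z w.
Proof. by move=> dz dw; apply/idP/idP; [apply: J'_sub|apply: J_sub]. Qed.

Lemma on_loop_closed (a b : T -> T) : fingraph.closed (joined a b) (on_loop a b) ->
  forall z w, connect (joined a b) z w -> on_loop a b z = on_loop a b w.
Proof. by move=> cl z w /(closed_connect cl). Qed.

Lemma closed_on_loop (a b : T -> T) : connect_sym (joined a b) ->
  fingraph.closed (joined a b) (on_loop a b).
Proof.
move=> sym x y xy; have cxy := connect1 xy; rewrite !unfold_in.
by apply: eq_forallb => z; rewrite (same_connect sym cxy).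
Qed.

Let dead_g x : dead (g x) = dead x.
Proof.
rewrite /dead orbC; congr (_ || _); apply/eqP/eqP=> [E|->] //.
  by rewrite -(gK x) E gvu.
by rewrite -(gK x) E guv.
Qed.

Let uv_comp : f u = v -> forall z, connect J u z -> dead z.
Proof.
move=> fuv z /(connect_invariant (P := dead)) <-; first exact: dead_u.
have fvu : f v = u by rewrite -fuv fK.
have dead_f t : dead (f t) = dead t.
  rewrite /dead orbC; congr (_ || _); apply/eqP/eqP => [E|->] //.
    by rewrite -(fK t) E.
  by rewrite -(fK t) E.
by move=> x y /orP[]/eqP->; rewrite ?dead_f ?dead_g.
Qed.

Let fix_comp : f u = u -> f v = v -> forall z w, connect J z w -> dead z = dead w.
Proof.
move=> fu fv; apply: connect_invariant => x y /orP[]/eqP->; last by rewrite dead_g.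
rewrite /dead; congr (_ || _); apply/eqP/eqP=> [->|E] //.
  by rewrite -(fK x) E.
by rewrite -(fK x) E.
Qed.

(** A loose end at [u] is handed over to [f v], one at [v] to [f u]. If the receiving point is dead
    as well, both [u] and [v] are loose, and they form a component that does not contain [z]. *)
Lemma on_loop_contract z : ~~ dead z -> on_loop f' g' z = on_loop f g z.
Proof.
move=> dz; apply/forallP/forallP => H w; apply/implyP => zw.
  have [dw|dw] := boolP (dead w); last first.
    have := H w; rewrite connect_contract // zw /= => /andP[f'w g'w].
    have [E _] := unglue_alive dw; rewrite -E g'w andbT.
    by apply: contra f'w => /eqP fw; rewrite /f' contract_fix.
  have Hf t : connect J z t -> ~~ dead t -> f' t != t.
    by move=> zt dt; have := H t; rewrite connect_contract // zt => /andP[].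
  case/orP: dw => /eqP E; rewrite {w}E in zw *; rewrite ?guv ?gvu ?(eq_sym v u) neq_uv ?andbT.
    apply/eqP => fu; have zv := connect_trans zw connect_uv.
    have zfv := connect_trans zv (connect_f v).
    have [dfv|dfv] := boolP (dead (f v)); last first.
      move: (Hf _ zfv dfv); rewrite /f' /contract -/(dead (f v)) (negbTE dfv) fK.
      by rewrite (eq_sym v u) (negbTE neq_uv) fu !eqxx.
    have fv : f v = v.
      case/orP: dfv => /eqP // E; move: (fK v) neq_uv; rewrite E fu => <-.
      by rewrite eqxx.
    by move: dz; rewrite (fix_comp fu fv zw) dead_u.
  apply/eqP => fv; have zu : connect J z u by rewrite (connect_trans zw) // Jsym connect_uv.
  have zfu := connect_trans zu (connect_f u).
  have [dfu|dfu] := boolP (dead (f u)); last first.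
    move: (Hf _ zfu dfu); rewrite /f' /contract -/(dead (f u)) (negbTE dfu) fK eqxx.
    by rewrite fv eqxx orbT eqxx.
  have fu : f u = u.
    case/orP: dfu => /eqP // E; move: (fK u) neq_uv; rewrite E fv => <-.
    by rewrite eqxx.
  by move: dz; rewrite (fix_comp fu fv zw) dead_v.
have dw : ~~ dead w by rewrite -(J'_alive zw).
rewrite connect_contract // in zw.
have := H w; rewrite zw /= => /andP[fw gw].
have [-> _] := unglue_alive dw; rewrite gw andbT.
rewrite /f'; case: contractP => // [D|_ fwu dfv|_ fwu _|_ fwv dfu|_ fwv _].
- by rewrite D in dw.
- have fvv : f v = v.
    case/orP: dfv => /eqP // E; have vw : v = w by rewrite -(fK v) E -fwu fK.
    by move: dw; rewrite -vw dead_v.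
  have zv : connect J z v.
    apply: connect_trans zw _; apply: connect_trans (connect_f w) _.
    by rewrite fwu connect_uv.
  by have := H v; rewrite zv /= fvv eqxx.
- by apply: contra neq_uv => /eqP fv; rewrite -fwu -fv fK.
- have fuu : f u = u.
    case/orP: dfu => /eqP // E; have vw : u = w by rewrite -(fK u) E -fwv fK.
    by move: dw; rewrite -vw dead_u.
  have zu : connect J z u.
    apply: connect_trans zw _; apply: connect_trans (connect_f w) _.
    by rewrite fwv Jsym connect_uv.
  by have := H u; rewrite zu /= fuu eqxx.
- by apply: contra neq_uv => /eqP fu; rewrite -fwv -{1}fu fK.
Qed.

Let S := {z : T | ~~ dead z}.
Let e'' : rel S := [rel x y | connect J' (val x) (val y)].

Let connect_e'' x y : connect e'' x y = connect J' (val x) (val y).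
Proof.
apply/idP/idP => [/connectP[p pth ->]|xy]; last exact: connect1.
elim: p x pth => //= z p IH x /andP[xz pth].
exact: connect_trans xz (IH _ pth).
Qed.

Let aliveS (x : S) : ~~ dead (val x). Proof. exact: valP x. Qed.

(** If [f u = v], then [u] and [v] form a loop that disappears. Every other loop has a living point,
    and the relation [e''] on living points is adjoint to both graphs, so [adjunction_n_comp]
    equates the numbers of components. *)
Lemma loops_contract : loops f g = ((f u == v) + loops f' g')%N.
Proof.
(* The loops other than the one that disappears. *)
pose a := [pred z | on_loop f g z & ~~ ((f u == v) && connect J u z)].
have cl_l := closed_on_loop Jsym; have cl_l' := closed_on_loop J'sym.
have cl_a : fingraph.closed J a.
  move=> x y xy; rewrite !inE; congr (_ && ~~ (_ && _)); first exact: (cl_l x y xy).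
  by rewrite !(Jsym u) (same_connect Jsym (connect1 xy)).
have sym_e'' : connect_sym e''.
  by move=> x y; rewrite !connect_e'' J'sym.
have alive_l' z : on_loop f' g' z -> ~~ dead z.
  move=> /forallP/(_ z); rewrite connect0 /= => /andP[+ _]; apply: contra => dz.
  by rewrite /f' contract_dead.
have adj' : rel_adjunction (val : S -> T) J' e'' (on_loop f' g').
  split=> [x /alive_l' dx | x y _]; last exact: connect_e''.
  by exists (Sub x dx); rewrite /= connect0.
have adj : rel_adjunction (val : S -> T) J e'' a.
  split=> [x | x y _]; last by rewrite connect_e'' connect_contract.
  rewrite inE /= => /andP[lx nx].
  have [dx|dx] := boolP (dead x); last by exists (Sub x dx); rewrite /= connect0.
  have xu : connect J x u.
    by case/orP: dx => /eqP->; rewrite ?connect0 // Jsym connect_uv.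
  have lu : on_loop f g u by rewrite -(on_loop_closed cl_l xu).
  have fuv : f u != v.
    by move: nx; rewrite Jsym xu andbT.
  have fuu : f u != u.
    by move/forallP: lu => /(_ u); rewrite connect0 /= => /andP[].
  have dfu : ~~ dead (f u) by rewrite /dead negb_or fuu.
  by exists (Sub (f u) dfu); apply: connect_trans xu (connect_f u).
rewrite /loops -/J -/J' (adjunction_n_comp val J'sym sym_e'' cl_l' adj').
have -> : n_comp e'' [preim val of on_loop f' g'] = n_comp J a.
  rewrite (adjunction_n_comp val Jsym sym_e'' cl_a adj).
  apply: eq_n_comp_r => z; rewrite -[LHS]/(on_loop f' g' (val z)) -[RHS]/(a (val z)) /=.
  rewrite on_loop_contract; last exact: (aliveS z).
  have [fuv|fuv] := eqVneq (f u) v; last by rewrite andbT.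
  suff -> : connect J u (val z) = false by rewrite andbT.
  by apply/negbTE; apply: contra (aliveS z) => /(uv_comp fuv).
have [fuv|fuv] := eqVneq (f u) v; last first.
  rewrite -[nat_of_bool false]/0%N add0n; apply: eq_n_comp_r => z; rewrite !inE (negbTE fuv) /= andbT.
  by rewrite unfold_in.
rewrite -[nat_of_bool true]/1%N -(n_comp_connect Jsym u).
rewrite /n_comp_mem -(cardID (connect J u)) addnC [RHS]addnC; congr (_ + _)%N.
  apply: eq_card => z; rewrite !inE /= fuv eqxx /= !unfold_in.
  by rewrite andbC -!andbA; congr (_ && _).
apply: eq_card => z; rewrite !inE /= !unfold_in.
case uz: (connect J u z); rewrite ?andbF ?andbT //.
have dz := uv_comp fuv uz.
rewrite -[[forall _, _]]/(on_loop f g z).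
suff lu : on_loop f g u by rewrite -(on_loop_closed cl_l uz) lu andbT.
have fvu : f v = u by rewrite -fuv fK.
apply/forallP => w; apply/implyP => /(uv_comp fuv) /orP[]/eqP->.
  by rewrite fuv guv eq_sym neq_uv.
by rewrite fvu gvu neq_uv.
Qed.

End ContractGraph.

(** * Weights of states and contraction of an arc *)

Definition step (s : 'I_3) : int := s%:Z - 1.

Lemma sum_step (A : nmodType) (G : int -> A) :
  \sum_(s < 3) G (step s) = G (-1) + G 0 + G 1.
Proof. by rewrite !big_ord_recr big_ord0 /= add0r. Qed.

Section Weights.
Variables (K : numFieldType) (sq : int -> K).
Variables (T : finType) (pos : T -> nat).

(* Reading the points in the order [pos], [sigma] is a walk that starts at 1. *)
Definition height (sigma : T -> int) (k : nat) : int :=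
  1 + \sum_(r | (pos r < k)%N) sigma r.

(** The sign appears because the two ends of a string are met in opposite directions along the
    boundary. At an unmatched point, a fixed point of [f], it forces the step 0. *)
Definition antisym (f : T -> T) (sigma : T -> int) : bool :=
  [forall p, sigma (f p) == - sigma p].

Definition small (z : int) : bool := (-1 <= z <= 1).

Definition valid (sigma : T -> int) : bool :=
  [forall p, small (sigma p) && (sq (height sigma (pos p)) != 0)].

Definition arc_weight (f : T -> T) (sigma : T -> int) (p : T) : K :=
  if (pos p < pos (f p))%N
  then sq (height sigma (pos p).+1) / sq (height sigma (pos p)) else 1.

Definition state_weight (f : T -> T) (sigma : T -> int) : K :=
  (antisym f sigma && valid sigma)%:R * \prod_p arc_weight f sigma p.

Definition noncrossing (f : T -> T) : Prop := forall p q,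
  ~~ [&& pos p < pos q, pos q < pos (f p) & pos (f p) < pos (f q)]%N.

Hypothesis pos_inj : injective pos.

Lemma height_next sigma p :
  height sigma (pos p).+1 = height sigma (pos p) + sigma p.
Proof.
rewrite /height -addrA; congr (1 + _).
rewrite (bigD1 p) //= addrC; congr (_ + _); apply: eq_bigl => r.
by rewrite ltnS ltn_neqAle andbC (inj_eq pos_inj).
Qed.

Lemma height_diff sigma k l : (k <= l)%N ->
  height sigma l = height sigma k + \sum_(r | (k <= pos r < l)%N) sigma r.
Proof.
move=> kl; rewrite /height -addrA; congr (1 + _).
rewrite (bigID (fun r => pos r < k)%N) /=; congr (_ + _); apply: eq_bigl => r; lia.
Qed.

Lemma sum_antisym (f : T -> T) (sigma : T -> int) (B : pred T) : involutive f ->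
  (forall r, B r -> B (f r) /\ sigma (f r) = - sigma r) -> \sum_(r | B r) sigma r = 0.
Proof.
move=> fK BP; suff: \sum_(r | B r) sigma r = - \sum_(r | B r) sigma r by lia.
rewrite [LHS](reindex_inj (inv_inj fK)) /= -sumrN.
rewrite (eq_bigl B) => [|r]; last first.
  by apply/idP/idP => [/BP[]|/BP[]//]; rewrite fK.
by apply: eq_bigr => r /BP[].
Qed.

(** By noncrossing the points under the arc are matched among themselves, so their steps cancel. *)
Lemma height_arc (f : T -> T) (sigma : T -> int) p : involutive f -> noncrossing f ->
  (forall r, (pos p < pos r < pos (f p))%N -> sigma (f r) = - sigma r) ->
  (pos p < pos (f p))%N -> height sigma (pos (f p)) = height sigma (pos p) + sigma p.
Proof.
move=> fK fN fS lt_p; rewrite (height_diff _ lt_p) -height_next.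
rewrite (@sum_antisym f) ?addr0 // => r r_in.
have {}fS := fS r r_in; split=> //.
have := fN p r; have := fN r p; have := fN (f r) p; have := fN p (f r); rewrite !fK.
have : pos (f r) != pos p by rewrite (inj_eq pos_inj) -(inj_eq (inv_inj fK)) fK -(inj_eq pos_inj); lia.
have : pos (f r) != pos (f p) by rewrite !(inj_eq pos_inj, inj_eq (inv_inj fK)) -(inj_eq pos_inj); lia.
move: r_in; lia.
Qed.

Section Contraction.
Variables (f : T -> T) (u v : T) (sigma : T -> int) (D : K).
Hypotheses (fK : involutive f) (fN : noncrossing f) (lt_uv : (pos u < pos v)%N).
Hypothesis f_mid : forall r, (pos u < pos r < pos v)%N -> f r = r.
Hypotheses (sigma_u : sigma u = 0) (sigma_v : sigma v = 0).
Hypothesis sq_eigen : forall z, sq z != 0 ->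
  sq (z - 1) ^+ 2 + sq z ^+ 2 + sq (z + 1) ^+ 2 = D * sq z ^+ 2.

Let neq_uv : u != v. Proof. by rewrite -(inj_eq pos_inj); lia. Qed.

Definition bump (s : int) (p : T) : int :=
  if p == u then s else if p == v then - s else sigma p.

Let h := height sigma.
Let hu := h (pos u).
Let f' := contract u v f.

Let f'K : involutive f' := contractK neq_uv fK.

Lemma bump_alive s p : ~~ dead u v p -> bump s p = sigma p.
Proof. by rewrite /bump /dead negb_or => /andP[/negbTE-> /negbTE->]. Qed.

Lemma bump_u s : bump s u = s. Proof. by rewrite /bump eqxx. Qed.

Lemma bump_v s : bump s v = - s.
Proof. by rewrite /bump eq_sym (negbTE neq_uv) eqxx. Qed.

Lemma bump0 : bump 0 =1 sigma.
Proof. by move=> p; rewrite /bump; do 2?[case: eqP => [->|_]] => //; rewrite sigma_v. Qed.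

Lemma height_bump s k :
  height (bump s) k = h k + (if (pos u < k <= pos v)%N then s else 0).
Proof.
rewrite /h /height -addrA; congr (1 + _).
have E r : bump s r = sigma r + ((if r == u then s else 0) - (if r == v then s else 0)).
  rewrite /bump; case: eqP => [->|_].
    by rewrite (negbTE neq_uv) sigma_u subr0 add0r.
  by case: eqP => [->|_]; rewrite ?sigma_v ?add0r ?subr0 ?addr0.
rewrite (eq_bigr _ (fun r _ => E r)) big_split /=; congr (_ + _).
rewrite sumrB -!big_mkcondr /=.
have D1 w : \sum_(i | (pos i < k)%N && (i == w)) s = if (pos w < k)%N then s else 0.
  rewrite (eq_bigl (fun i => (i == w) && (pos w < k)%N)) => [|i].
    by rewrite big_mkcondr big_pred1_eq.
  by rewrite andbC; case: eqP => [->|].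
rewrite !D1; have := lt_uv; case: (ltnP (pos v) k) => vk; case: (ltnP (pos u) k) => uk => *;
  rewrite ?subrr ?subr0 //; lia.
Qed.

Lemma height_mid k : (pos u <= k <= pos v)%N -> antisym f' sigma -> h k = hu.
Proof.
move=> /andP[uk kv] /forallP anti; rewrite /hu /h (height_diff _ uk) big1 ?addr0 // => r.
move=> /andP[ur rk].
have [/eqP->//|ru] := boolP (r == u).
have fr : f r = r by apply: f_mid; move: ru; rewrite -(inj_eq pos_inj); lia.
have := anti r; rewrite /f' contract_fix // => /eqP; lia.
Qed.

Lemma valid_bump s : small s -> antisym f' sigma ->
  valid (bump s) = valid sigma && (sq (hu + s) != 0).
Proof.
move=> small_s anti; apply/forallP/andP => [H|[/forallP H Hs] p].
  have Hs : sq (hu + s) != 0.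
    have /andP[_] := H v; rewrite height_bump lt_uv leqnn /=.
    by rewrite height_mid // (ltnW lt_uv) leqnn.
  split=> //; apply/forallP => p; have /andP[small_p] := H p.
  rewrite height_bump; case: ifP => [puv _|_]; last rewrite addr0 => Hp.
    have -> : height sigma (pos p) = hu by apply: height_mid => //; lia.
    have /andP[_] := H u; rewrite height_bump ltnn addr0 => ->.
    rewrite andbT; have [|dp] := boolP (dead u v p); last by rewrite -(bump_alive s).
    by case/orP=> /eqP->; rewrite ?sigma_u ?sigma_v.
  rewrite Hp andbT; have [|dp] := boolP (dead u v p); last by rewrite -(bump_alive s).
  by case/orP=> /eqP->; rewrite ?sigma_u ?sigma_v.
have /andP[small_p sq_p] := H p; apply/andP; split.
  rewrite /bump; case: eqP => // _; case: eqP => // _.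
  by move: small_s; rewrite /small; lia.
rewrite height_bump; case: ifP => puv; last by rewrite addr0.
by rewrite (@height_mid (pos p)) //; lia.
Qed.

Lemma antisym_bump_loop s : f u = v -> antisym f (bump s) = antisym f' sigma.
Proof.
move=> fu; have fv : f v = u by rewrite -fu fK.
apply/forallP/forallP => H p.
  have [dp|dp] := boolP (dead u v p).
    by rewrite /f' contract_dead //; case/orP: dp => /eqP->; rewrite ?sigma_u ?sigma_v.
  rewrite -!(bump_alive s) //; last exact: contract_alive.
  rewrite /f'; case: contractP => // [D1|_ E _|_ E _|_ E _|_ E _]; first by rewrite D1 in dp.
  - by move: dp; rewrite -(fK p) E fu dead_v.
  - by move: dp; rewrite -(fK p) E fu dead_v.
  - by move: dp; rewrite -(fK p) E fv dead_u.
  - by move: dp; rewrite -(fK p) E fv dead_u.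
have [/orP[]/eqP->|dp] := boolP (dead u v p).
- by rewrite fu bump_u bump_v.
- by rewrite fv bump_u bump_v opprK.
have dfp : ~~ dead u v (f p).
  by apply: contra dp => /orP[]/eqP E; rewrite -(fK p) E ?fu ?fv ?dead_u ?dead_v.
have := H p; rewrite /f' /contract -/(dead u v p) (negbTE dp) !bump_alive //.
by move: dfp; rewrite /dead negb_or => /andP[/negbTE-> /negbTE->].
Qed.

(** The string that passes through the glue carries one step along its whole length, so its value at
    the far end [f u] leaves a single choice of [s]; for a loose end [f u = u] this is 0. *)
Lemma antisym_bump s : f u != v ->
  antisym f (bump s) = (s == - sigma (f u)) && antisym f' sigma.
Proof.
move=> fuv; have fvu : f v != u by apply: contra fuv => /eqP <-; rewrite fK.
have bu := bump_u s; have bv := bump_v s.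
have s_fu : antisym f (bump s) -> s = - sigma (f u).
  move=> /forallP/(_ u)/eqP; rewrite bu.
  have [->|fu] := eqVneq (f u) u; first by rewrite bu sigma_u; lia.
  by rewrite bump_alive /dead ?negb_or ?fu ?fuv //; lia.
apply/idP/andP => [H|[/eqP Es /forallP H]].
  split; first by rewrite (s_fu H).
  move/forallP: (H) => A; apply/forallP => p; rewrite /f'.
  case: contractP => [dp|dp E dv|dp E dv|dp E du|dp E du|dp dfp].
  - by case/orP: dp => /eqP->; rewrite ?sigma_u ?sigma_v.
  - have fv : f v = v by case/orP: dv => /eqP // E'; rewrite E' eqxx in fvu.
    have := A p; have := A v; rewrite fv bv E bu (bump_alive _ dp); lia.
  - have := A p; have := A v; rewrite bv E bu !bump_alive //; lia.
  - have fu : f u = u by case/orP: du => /eqP // E'; rewrite E' eqxx in fuv.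
    have := A p; have := A u; rewrite fu bu E bv (bump_alive _ dp); lia.
  - have := A p; have := A u; rewrite bu E bv !bump_alive //; lia.
  - by have := A p; rewrite !bump_alive.
have dead_f p : dead u v (f p) -> p = f u \/ p = f v.
  by case/orP => /eqP E; rewrite -E fK; [left|right].
have a_fu : ~~ dead u v (f u) \/ f u = u.
  by rewrite /dead (negbTE fuv) orbF; case: eqP => [|_]; [right|left].
have a_fv : ~~ dead u v (f v) \/ f v = v.
  by rewrite /dead (negbTE fvu); case: eqP => [|_]; [right|left].
have E_fv : sigma (f v) = s.
  case: a_fu => [du|fu]; case: a_fv => [dv|fv].
  - have := H (f v); rewrite /f' /contract -/(dead u v (f v)) (negbTE dv) fK.
    by rewrite (eq_sym v u) (negbTE neq_uv) eqxx -/(dead u v (f u)) (negbTE du) Es => /eqP ->; lia.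
  - have := H (f u); rewrite /f' /contract -/(dead u v (f u)) (negbTE du) fK.
    by rewrite fv !eqxx orbT Es sigma_v => /eqP; lia.
  - have := H (f v); rewrite /f' /contract -/(dead u v (f v)) (negbTE dv) fK.
    by rewrite (eq_sym v u) (negbTE neq_uv) fu !eqxx /= Es fu sigma_u => /eqP; lia.
  - by rewrite fv Es fu sigma_u sigma_v.
have s_u : f u = u -> s = 0 by rewrite Es => ->; rewrite sigma_u.
have s_v : f v = v -> s = 0 by rewrite -E_fv => ->; rewrite sigma_v.
apply/forallP => p; have [/orP[]/eqP->|dp] := boolP (dead u v p).
- case: a_fu => [du|fu]; first by rewrite bu bump_alive // Es opprK.
  by rewrite fu bu s_u.
- case: a_fv => [dv|fv]; first by rewrite bv bump_alive // E_fv opprK.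
  by rewrite fv bv s_v.
rewrite (bump_alive _ dp).
have [/dead_f[]|dfp] := boolP (dead u v (f p)).
- by move=> ->; rewrite fK bu Es.
- by move=> ->; rewrite fK bv E_fv.
rewrite bump_alive //; have := H p; rewrite /f' /contract -/(dead u v p) (negbTE dp).
by move: dfp; rewrite /dead negb_or => /andP[/negbTE-> /negbTE->].
Qed.

Lemma arc_weight0 (a : T -> T) (tau : T -> int) p : tau p = 0 ->
  sq (height tau (pos p)) != 0 -> arc_weight a tau p = 1.
Proof.
by move=> tp sp; rewrite /arc_weight; case: ifP => // _; rewrite height_next tp addr0 divff.
Qed.

Lemma arc_weight_bump s p : ~~ dead u v p -> f p = f' p ->
  arc_weight f (bump s) p = arc_weight f' sigma p.
Proof.
move=> dp Ep; rewrite /arc_weight -Ep; case: ifP => // lt_p.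
have : ~~ (pos u < pos p < pos v)%N.
  by apply/negP => /f_mid E; rewrite E ltnn in lt_p.
have : pos p != pos u by apply: contra dp => /eqP/pos_inj->; rewrite dead_u.
have : pos p != pos v by apply: contra dp => /eqP/pos_inj->; rewrite dead_v.
move=> n1 n2 n3; rewrite !height_bump.
by do 2![case: ifP => [?|_]; first lia]; rewrite !addr0.
Qed.

Lemma prod_dead (F : T -> K) :
  \prod_p F p = F u * F v * \prod_(p | ~~ dead u v p) F p.
Proof.
rewrite (bigD1 u) // (bigD1 v) 1?eq_sym //= mulrA; congr (_ * _); apply: eq_bigl => p.
by rewrite /dead negb_or.
Qed.

Lemma arc_weight_dead p : dead u v p -> arc_weight f' sigma p = 1.
Proof. by move=> dp; rewrite /arc_weight /f' contract_dead // ltnn. Qed.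

Lemma contract_other p : ~~ dead u v p -> ~~ dead u v (f p) -> f p = f' p.
Proof.
rewrite /f' /contract -/(dead u v p) => /negbTE->.
by rewrite /dead negb_or => /andP[/negbTE-> /negbTE->].
Qed.

Lemma small_step s : small (step s).
Proof. by case: s => [[|[|[|]]]]. Qed.

Lemma sum_step1 (A : pzSemiRingType) (G : int -> A) s0 : small s0 ->
  \sum_(s < 3) (step s == s0)%:R * G (step s) = G s0.
Proof.
rewrite (sum_step (fun z => (z == s0)%:R * G z)) /small => s0_small.
have : [|| s0 == -1, s0 == 0 | s0 == 1] by lia.
by case/or3P => /eqP->; rewrite /= !mul0r !mul1r ?addr0 ?add0r.
Qed.

(** If [f] joins [u] and [v], the step [s] is free; arc weight times glue factor is the square of
    [sq (hu + s) / sq hu], and [sq_eigen] sums these squares to [D]. Otherwise a single [s]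
    survives, and the strings ending at [u] and [v] have, with the glue factor, the weight of the
    joined string. *)
Lemma state_weight_contract :
  \sum_(s < 3) state_weight f (bump (step s)) * (sq (hu + step s) / sq hu) =
  D ^+ (f u == v) * state_weight f' sigma.
Proof.
have [/andP[anti val]|nOK] := boolP (antisym f' sigma && valid sigma); last first.
  rewrite [in RHS]/state_weight (negbTE nOK) mul0r mulr0 big1 // => s _.
  rewrite /state_weight; suff -> : antisym f (bump (step s)) && valid (bump (step s)) = false.
    by rewrite !mul0r.
  apply: contraNF nOK => /andP[a_f v_b].
  have a_f' : antisym f' sigma.
    have [fuv|fuv] := eqVneq (f u) v; first by rewrite -(antisym_bump_loop (step s) fuv).
    by move: a_f; rewrite antisym_bump // => /andP[].
  by move: v_b; rewrite a_f' valid_bump // ?small_step // => /andP[].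
have sq_hu : sq hu != 0 by have /forallP/(_ u)/andP[] := val.
rewrite [in RHS]/state_weight anti val mul1r prod_dead !arc_weight_dead ?dead_u ?dead_v //.
rewrite !mul1r.
have [fuv|fuv] := eqVneq (f u) v.
  have fvu : f v = u by rewrite -fuv fK.
  have E s : small s -> state_weight f (bump s) * (sq (hu + s) / sq hu) =
      sq (hu + s) ^+ 2 * (sq hu ^- 2 * \prod_(p | ~~ dead u v p) arc_weight f' sigma p).
    move=> sm; rewrite /state_weight antisym_bump_loop // valid_bump // anti val /=.
    have [->|nz] := eqVneq (sq (hu + s)) 0; first by rewrite !mul0r expr2 !mul0r.
    rewrite mul1r prod_dead {1 2}/arc_weight fuv fvu lt_uv.
    rewrite ltnNge (ltnW lt_uv) /= mulr1 height_next bump_u height_bump ltnn addr0.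
    rewrite (eq_bigr (arc_weight f' sigma)); first by rewrite /hu; field.
    move=> p dp; apply: arc_weight_bump => //; apply: contract_other => //.
    by apply: contra dp => /orP[]/eqP E; rewrite -(fK p) E ?fuv ?fvu ?dead_u ?dead_v.
  rewrite (eq_bigr _ (fun s _ => E _ (small_step s))) -mulr_suml expr1.
  rewrite (sum_step (fun z => sq (hu + z) ^+ 2)) addr0 sq_eigen //.
  by rewrite mulrA mulfK // expf_neq0.
rewrite expr0 mul1r.
set s0 := - sigma (f u).
have small_s0 : small s0.
  by have /forallP/(_ (f u))/andP[+ _] := val; rewrite /small /s0; lia.
rewrite (eq_bigr (fun s : 'I_3 => (step s == s0)%:R * ((sq (hu + step s) != 0)%:R *
   (\prod_p arc_weight f (bump (step s)) p * (sq (hu + step s) / sq hu))))); last first.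
  move=> s _; rewrite /state_weight antisym_bump // valid_bump ?small_step // anti val !andbT /=.
  by rewrite -mulnb natrM !mulrA.
rewrite (sum_step1 (fun z => (sq (hu + z) != 0)%:R *
  (\prod_p arc_weight f (bump z) p * (sq (hu + z) / sq hu)))) //.
have a_f : antisym f (bump s0) by rewrite antisym_bump // eqxx anti.
have hE p : height sigma (pos p) = h (pos p) by [].
(* A string with step 0 has weight 1 wherever its ends lie. *)
have [z_s0|nz_s0] := eqVneq s0 0.
  rewrite z_s0 addr0 sq_hu mul1r divff // mulr1 prod_dead.
  have b0 p : height (bump 0) p = height sigma p by rewrite height_bump if_same addr0.
  have val_b p : sq (height (bump 0) (pos p)) != 0.
    by rewrite b0; have /forallP/(_ p)/andP[] := val.
  rewrite !arc_weight0 ?bump0 // !mul1r; apply: eq_bigr => p dp.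
  have [dfp|dfp] := boolP (dead u v (f p)); last by apply: arc_weight_bump => //; apply: contract_other.
  have sp : sigma p = 0.
    have := forallP a_f p; rewrite z_s0 !bump0.
    by case/orP: dfp => /eqP->; rewrite ?sigma_u ?sigma_v eq_sym oppr_eq0 => /eqP.
  by rewrite !arc_weight0 ?bump0 // -b0.
have fuu : f u != u by apply: contra nz_s0 => /eqP fu; rewrite /s0 fu sigma_u.
have s_fv : sigma (f v) = s0.
  have := forallP a_f v; rewrite bump_v.
  have [fv|fv] := eqVneq (f v) v; first by rewrite fv bump_v; move: nz_s0; clear; lia.
  rewrite bump_alive; first by rewrite opprK => /eqP.
  by rewrite /dead negb_or fv andbT; apply: contra fuv => /eqP <-; rewrite fK.
have fvv : f v != v by apply: contra nz_s0 => /eqP fv; rewrite -s_fv fv sigma_v.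
have fvu : f v != u by apply: contra fuv => /eqP <-; rewrite fK.
set x := f u; set y := f v.
have sx : sigma x = - s0 by rewrite /s0 opprK.
have dx : ~~ dead u v x by rewrite /dead negb_or fuu fuv.
have dy : ~~ dead u v y by rewrite /dead negb_or fvu fvv.
have fx : f x = u by rewrite fK.
have fy : f y = v by rewrite fK.
have xy : x != y by rewrite (inj_eq (inv_inj fK)).
have f'x : f' x = y.
  by rewrite /f' /contract -/(dead u v x) (negbTE dx) fx eqxx -/(dead u v y) (negbTE dy).
have f'y : f' y = x by rewrite -f'x f'K.
have midF p : p != f p -> ~~ (pos u < pos p < pos v)%N.
  by move=> pfp; apply/negP => /f_mid E; rewrite E eqxx in pfp.
have xNmid : ~~ (pos u < pos x < pos v)%N by apply: midF; rewrite fx.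
have yNmid : ~~ (pos u < pos y < pos v)%N by apply: midF; rewrite fy.
have pE (a b : T) : a != b -> pos a != pos b by rewrite (inj_eq pos_inj).
have pos_xu : pos x != pos u by apply: pE.
have pos_xv : pos x != pos v by apply: pE.
have pos_yu : pos y != pos u by apply: pE.
have pos_yv : pos y != pos v by apply: pE.
have pos_xy : pos x != pos y by apply: pE.
have split4 F : \prod_(p | ~~ dead u v p) F p = F x * F y *
    \prod_(p | [&& ~~ dead u v p, p != x & p != y]) F p :> K.
  rewrite (bigD1 x) // (bigD1 y) /=; last by rewrite dy eq_sym.
  by rewrite mulrA; congr (_ * _); apply: eq_bigl => p; rewrite andbA.
rewrite prod_dead !split4.
rewrite [\prod_(p | _) arc_weight f _ p](eq_bigr (arc_weight f' sigma)); last first.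
  move=> p /and3P[dp px py]; apply: arc_weight_bump => //; apply: contract_other => //.
  apply/negP => /orP[]/eqP E; [move: px|move: py]; rewrite /x /y -E fK eqxx //.
have assoc (i a b r c : K) : i * (a * (b * r) * c) = i * (a * b * c) * r by ring.
rewrite assoc; congr (_ * _).
have hb p : ~~ (pos u < pos p <= pos v)%N -> height (bump s0) (pos p) = h (pos p).
  by move=> /negbTE E; rewrite height_bump E addr0.
have bx : bump s0 x = sigma x by rewrite bump_alive.
have by_ : bump s0 y = sigma y by rewrite bump_alive.
have hbu : height (bump s0) (pos u) = hu by rewrite hb // ltnn.
have hbv : height (bump s0) (pos v) = hu + s0.
  by rewrite height_bump lt_uv leqnn /= (height_mid _ anti) // leqnn ltnW.
have hbx : height (bump s0) (pos x) = h (pos x).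
  by apply: hb; move: xNmid pos_xv; clear; lia.
have hby : height (bump s0) (pos y) = h (pos y).
  by apply: hb; move: yNmid pos_yv; clear; lia.
(* No matched point lies between [u] and [v], so noncrossing leaves three orders: the two strings
   nested to the right of the glue, one on each side of it, or nested to its left. *)
have order : [|| [&& pos u < pos v, pos v < pos y & pos y < pos x],
    [&& pos x < pos u, pos u < pos v & pos v < pos y] |
    [&& pos y < pos x, pos x < pos u & pos u < pos v]]%N.
  have := fN x y; have := fN y x; have := fN u v; have := fN v u.
  have := fN x v; have := fN v x; have := fN u y; have := fN y u.
  have := fN x u; have := fN u x; have := fN y v; have := fN v y.
  rewrite fx fy -/x -/y.
  move: (lt_uv) xNmid yNmid pos_xu pos_xv pos_yu pos_yv pos_xy.
  by move: (pos x) (pos y) (pos u) (pos v) => a b c d; clear; lia.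
have sqx : sq (h (pos x)) != 0 by have /forallP/(_ x)/andP[] := val.
have sqy : sq (h (pos y)) != 0 by have /forallP/(_ y)/andP[] := val.
have anti_b r : sigma (f' r) = - sigma r by apply/eqP; apply: (forallP anti).
have anti_f r : bump s0 (f r) = - bump s0 r by apply/eqP; apply: (forallP a_f).
rewrite /arc_weight fx fy f'x f'y -/x -/y.
rewrite !(height_next (bump s0)) !(height_next sigma).
rewrite bump_u bump_v.
rewrite bx by_.
rewrite hbu hbv hbx hby.
rewrite -!/(h _).
rewrite sx.
rewrite s_fv.
case/or3P: order => /and3P[].
- move=> _ lt_vy lt_yx; have ux := ltn_trans lt_uv (ltn_trans lt_vy lt_yx).
  have E1 : h (pos y) = hu.
    have := @height_arc f (bump s0) v fK fN (fun r _ => anti_f r) lt_vy.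
    by rewrite -/y hby hbv bump_v => ->; rewrite addrK.
  have E2 : h (pos x) = hu + s0.
    have := @height_arc f (bump s0) u fK fN (fun r _ => anti_f r) ux.
    by rewrite -/x hbx hbu bump_u.
  rewrite !(ltnNge (pos x)) (ltnW ux) /= (ltnW lt_yx) /= lt_vy (ltnNge (pos y)) (ltnW lt_vy) /= lt_yx.
  rewrite ux E1 addrK -E2 sqx.
  by rewrite !mul1r ?mulr1; field; rewrite sq_hu sqx.
- move=> lt_xu _ lt_vy; have lt_xy := ltn_trans lt_xu (ltn_trans lt_uv lt_vy).
  have E1 : h (pos x) = hu + s0.
    have := @height_arc f (bump s0) x fK fN (fun r _ => anti_f r).
    by rewrite fx hbx hbu bx sx => /(_ lt_xu) ->; rewrite subrK.
  rewrite lt_xu (ltnNge (pos u)) (ltnW lt_xu) /=.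
  rewrite lt_xy lt_vy (ltnNge (pos y)) (ltnW lt_vy) (ltnNge (pos y)) (ltnW lt_xy) /=.
  rewrite E1 in sqx *; rewrite sqx addrK.
  by rewrite !mul1r ?mulr1 ?mul1r; field; rewrite sq_hu sqx.
move=> lt_yx lt_xu _; have lt_yv := ltn_trans lt_yx (ltn_trans lt_xu lt_uv).
have E1 : h (pos x) = hu + s0.
  have := @height_arc f (bump s0) x fK fN (fun r _ => anti_f r).
  by rewrite fx hbx hbu bx sx => /(_ lt_xu) ->; rewrite subrK.
rewrite lt_xu (ltnNge (pos u)) (ltnW lt_xu) /=.
rewrite lt_yx lt_yv (ltnNge (pos v)) (ltnW lt_yv) (ltnNge (pos x)) (ltnW lt_yx) /=.
rewrite E1 in sqx *; rewrite sqx addrK.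
by rewrite !mul1r; field; rewrite sq_hu sqx sqy.
Qed.

(** Whether [t] lies between [a] and [b]: this gives noncrossing a form that is symmetric in the
    ends of a string. *)
Let side (a b t : T) := (pos a < pos t)%N (+) (pos b < pos t)%N.

Lemma noncrossing_side a b : f a != a -> b != a -> b != f a ->
  side a (f a) b = side a (f a) (f b).
Proof.
move=> fa ba bfa.
have n1 : pos b != pos a by rewrite (inj_eq pos_inj).
have n2 : pos b != pos (f a) by rewrite (inj_eq pos_inj).
have n3 : pos (f b) != pos a by rewrite (inj_eq pos_inj) -(inj_eq (inv_inj fK)) fK.
have n4 : pos (f b) != pos (f a) by rewrite (inj_eq pos_inj) (inj_eq (inv_inj fK)).
have := fN a b; have := fN (f a) b; have := fN a (f b); have := fN (f a) (f b); rewrite !fK.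
have := fN b a; have := fN (f b) a; have := fN b (f a); have := fN (f b) (f a); rewrite !fK.
rewrite /side; lia.
Qed.

(** Relative to any other string, [f u] is on the side of [u] and [f v] on the side of [v]. These
    sides agree, as only unmatched points lie between [u] and [v]; hence the string joining [f u] to
    [f v] crosses nothing. *)
Lemma noncrossing_contract : noncrossing f'.
Proof.
have midF p : p != f p -> ~~ (pos u < pos p < pos v)%N.
  by move=> pfp; apply/negP => /f_mid E; rewrite E eqxx in pfp.
have neD p : ~~ dead u v p -> (pos p != pos u) && (pos p != pos v).
  by rewrite !(inj_eq pos_inj) /dead negb_or.
have key x y c : f x = u -> f y = v -> ~~ dead u v x -> ~~ dead u v y ->
    ~~ dead u v c -> ~~ dead u v (f c) -> c != f c -> side c (f c) x = side c (f c) y.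
  move=> fx fy dx dy dc dfc cfc.
  have fcc : f c != c by rewrite eq_sym.
  rewrite (noncrossing_side fcc (b := x)) ?fx; last 2 first.
  - by apply: contra dfc => /eqP <-; rewrite fx dead_u.
  - by apply: contra dc => /eqP E; rewrite -(fK c) -E fx dead_u.
  rewrite (noncrossing_side fcc (b := y)) ?fy; last 2 first.
  - by apply: contra dfc => /eqP <-; rewrite fy dead_v.
  - by apply: contra dc => /eqP E; rewrite -(fK c) -E fy dead_v.
  have := midF c cfc; have := neD c dc; have := neD _ dfc.
  have : ~~ (pos u < pos (f c) < pos v)%N by apply: midF; rewrite fK eq_sym.
  rewrite /side; have := lt_uv; lia.
move=> p q.
have ffv : f (f v) = v by rewrite fK.
have ffu : f (f u) = u by rewrite fK.
rewrite /f'; case: contractP => [_|_ _ _|dp fp dv|_ _ _|dp fp du|dp dfp]; try lia;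
  case: contractP => [_|_ _ _|dq fq dv'|_ _ _|dq fq du'|dq dfq]; try lia.
- have qE : q = f v by rewrite -(fK q) fq.
  by rewrite qE ltnn andbF.
- have [fq'|fq'] := eqVneq (f q) q; first by rewrite fq'; lia.
  have := key p (f v) q fp ffv dp dv dq dfq; rewrite eq_sym => /(_ fq').
  by rewrite /side; lia.
- have qE : q = f u by rewrite -(fK q) fq.
  by rewrite qE ltnn andbF.
- have [fq'|fq'] := eqVneq (f q) q; first by rewrite fq'; lia.
  have := key (f u) p q ffu fp du dp dq dfq; rewrite eq_sym => /(_ fq').
  by rewrite /side; lia.
- have [fp'|fp'] := eqVneq (f p) p; first by rewrite fp'; lia.
  have := key q (f v) p fq ffv dq dv' dp dfp; rewrite eq_sym => /(_ fp').
  by rewrite /side; lia.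
- have [fp'|fp'] := eqVneq (f p) p; first by rewrite fp'; lia.
  have := key (f u) q p ffu fq du' dq dp dfp; rewrite eq_sym => /(_ fp').
  by rewrite /side; lia.
- exact: fN.
Qed.

End Contraction.
End Weights.

(** * Weights of Motzkin diagrams *)

Notation walk n := {ffun 'I_n -> 'I_3}.

Definition stepn n (b : walk n) (i : nat) : int :=
  if insub i is Some j then step (b j) else 0.

Lemma stepn_ord n (b : walk n) (i : 'I_n) : stepn b i = step (b i).
Proof. by rewrite /stepn insubT //= => lt_i; congr (step (b _)); apply: val_inj. Qed.

Lemma stepn_ge n (b : walk n) i : (n <= i)%N -> stepn b i = 0.
Proof. by move=> ni; rewrite /stepn insubF // ltnNge ni. Qed.

Definition rcons_walk n (bs : walk n * 'I_3) : walk n.+1 :=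
  [ffun i => if unlift ord_max i is Some j then bs.1 j else bs.2].

Lemma rcons_walk_bij n : bijective (@rcons_walk n).
Proof.
exists (fun b : walk n.+1 => ([ffun j => b (lift ord_max j)] : walk n, b ord_max)).
  move=> [b s]; congr (_, _); last by rewrite ffunE unlift_none.
  by apply/ffunP => j; rewrite !ffunE liftK.
move=> b; apply/ffunP => i; rewrite ffunE.
by case: unliftP => [j ->|->] //=; rewrite ffunE.
Qed.

Lemma sum_walk_recr (A : nmodType) n (F : walk n.+1 -> A) :
  \sum_b F b = \sum_(b : walk n) \sum_s F (rcons_walk (b, s)).
Proof.
rewrite (reindex _ (onW_bij _ (rcons_walk_bij n))) /= pair_big /=.
by apply: eq_bigr => -[].
Qed.

Lemma stepn_rcons n (b : walk n) s i : stepn (rcons_walk (b, s)) i =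
  if i == n then step s else stepn b i.
Proof.
have [lt_in|] := ltnP i n.
  have lt_in1 : (i < n.+1)%N by apply: ltnW.
  rewrite -[i in LHS]/(nat_of_ord (Ordinal lt_in1)) stepn_ord ffunE.
  have -> : Ordinal lt_in1 = lift ord_max (Ordinal lt_in) by apply: ord_inj; rewrite lift_max.
  rewrite liftK ltn_eqF // -[i in RHS]/(nat_of_ord (Ordinal lt_in)) stepn_ord //.
rewrite leq_eqVlt => /orP[/eqP <-|lt_ni].
  by rewrite eqxx -[n in stepn _ n]/(nat_of_ord (@ord_max n)) stepn_ord ffunE unlift_none.
by rewrite gtn_eqF // !stepn_ge // ltnW.
Qed.

Section Ext.
Variables (K : numFieldType) (sq : int -> K) (T : finType) (pos : T -> nat).

Lemma eq_height (s t : T -> int) : s =1 t -> height pos s =1 height pos t.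
Proof. by move=> st k; rewrite /height; congr (1 + _); apply: eq_bigr. Qed.

Lemma eq_state_weight (f : T -> T) (s t : T -> int) : s =1 t ->
  state_weight sq pos f s = state_weight sq pos f t.
Proof.
move=> st; have hst := eq_height st; rewrite /state_weight; congr (_%:R * _).
  by congr andb; apply: eq_forallb => p; rewrite ?st ?hst.
by apply: eq_bigr => p _; rewrite /arc_weight !hst.
Qed.

End Ext.

(** * Contraction of a nested family of glued pairs *)

Section ContractAll.
Variables (K : numFieldType) (sq : int -> K) (D : K).
Hypothesis sq_eigen : forall z, sq z != 0 ->
  sq (z - 1) ^+ 2 + sq z ^+ 2 + sq (z + 1) ^+ 2 = D * sq z ^+ 2.
Variables (T : finType) (pos : T -> nat) (pos_inj : injective pos).
Variables (u v : nat -> T).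

(** The last pair is bumped last: in a nested family it is the innermost one, which is contracted
    first. *)
Fixpoint fill k (b : nat -> int) (sigma : T -> int) : T -> int :=
  if k is k'.+1 then bump (u k') (v k') (fill k' b sigma) (b k') else sigma.

Lemma eq_fill k b b' sigma : (forall i, (i < k)%N -> b i = b' i) ->
  fill k b sigma =1 fill k b' sigma.
Proof.
elim: k => //= k IH E p; rewrite /bump IH => [|i ik]; last by apply: E; apply: ltnW.
by rewrite E.
Qed.

Definition off k (r : T) := forall i, (i < k)%N -> r != u i /\ r != v i.

Lemma fill_off k b sigma r : off k r -> fill k b sigma r = sigma r.
Proof.
elim: k => //= k IH r_off; rewrite /bump.
have [/negbTE-> /negbTE->] := r_off k (ltnSn k).
by apply: IH => i ik; apply: r_off; apply: ltnW.
Qed.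

Definition nested k := [/\ forall i j, (i < j < k)%N -> (pos (u i) < pos (u j))%N,
  forall i j, (i < j < k)%N -> (pos (v j) < pos (v i))%N
  & forall i, (i < k)%N -> (pos (u i) < pos (v i))%N].

Lemma nested_off k : nested k.+1 -> off k (u k) /\ off k (v k).
Proof.
case=> nu nv nuv; have npos (a b : T) : pos a != pos b -> a != b by rewrite (inj_eq pos_inj).
split=> i ik; have := nuv k (ltnSn k); have := nuv i (ltnW ik).
  have := nu i k; have := nv i k; rewrite ik ltnSn => /(_ isT) ? /(_ isT) ? ? ?.
  by split; apply: npos; lia.
have := nu i k; have := nv i k; rewrite ik ltnSn => /(_ isT) ? /(_ isT) ? ? ?.
by split; apply: npos; lia.
Qed.

Lemma nestedS k : nested k.+1 -> nested k.
Proof. by case=> nu nv nuv; split=> [i j ?|i j ?|i ?]; [apply: nu|apply: nv|apply: nuv]; lia. Qed.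

Arguments fill : simpl never.

Lemma fill_on k b sigma i : nested k -> (i < k)%N ->
  fill k b sigma (u i) = b i /\ fill k b sigma (v i) = - b i.
Proof.
elim: k => // k IH nest; rewrite ltnS leq_eqVlt /fill -/fill.
have [_ _ /(_ k (ltnSn k)) uv] := nest.
have neq_uv : u k != v k by rewrite -(inj_eq pos_inj) ltn_eqF.
case/orP => [/eqP->|ik]; first by rewrite /bump !eqxx eq_sym (negbTE neq_uv).
have [ou ov] := nested_off nest.
have [/negbTE n1 /negbTE n2] := ou i ik; have [/negbTE n3 /negbTE n4] := ov i ik.
rewrite /bump ![_ == u k]eq_sym ![_ == v k]eq_sym n1 n2 n3 n4.
exact: IH (nestedS nest) ik.
Qed.

(** One more ratio per glued pair: together with the arc weight of a loop it yields the squares of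
    [sq_eigen]. The product telescopes in both applications. *)
Definition glue_weight k b sigma : K := \prod_(i < k)
  (sq (height pos (fill k b sigma) (pos (u i)) + b i) /
   sq (height pos (fill k b sigma) (pos (u i)))).

Lemma joined_id (f g : T -> T) p q : involutive f -> g =1 id ->
  connect (joined f g) p q = (q == p) || (q == f p).
Proof.
move=> fK gid; apply/idP/idP => [|/orP[]/eqP->]; last first.
- by apply: connect1; rewrite /joined /= eqxx.
- exact: connect0.
case/connectP=> w; elim/last_ind: w q => [|w x IH] q /=; first by move=> _ ->; rewrite eqxx.
rewrite rcons_path last_rcons => /andP[/IH/(_ erefl) + + ->].
rewrite /joined /= gid; set y := last p w => /orP[]/eqP-> /orP[]/eqP->; rewrite ?eqxx ?orbT //.
by rewrite fK eqxx.
Qed.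

(** Only the innermost pair is sure to have nothing but unmatched points between its ends, so it
    goes first; its ends then count as unmatched for the next pair. The weight identity is
    [state_weight_contract] applied to one step of the walk [b] at a time. *)
Lemma contract_all k (f g : T -> T) :
  involutive f -> noncrossing pos f -> nested k ->
  (forall i r, (i < k)%N -> (pos (u i) < pos r < pos (v i))%N ->
     f r = r \/ exists2 j, (i < j < k)%N & r = u j \/ r = v j) ->
  (forall i, (i < k)%N -> g (u i) = v i /\ g (v i) = u i) ->
  (forall r, off k r -> g r = r) ->
  exists f' : T -> T, [/\ involutive f', noncrossing pos f',
    (forall r, f r = r \/ ~ off k r -> f' r = r),
    (forall p q, off k p -> off k q ->
       connect (joined f g) p q = (q == p) || (q == f' p)) &
    forall sigma, (forall i, (i < k)%N -> sigma (u i) = 0 /\ sigma (v i) = 0) ->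
    \sum_(b : walk k) state_weight sq pos f (fill k (stepn b) sigma) *
       glue_weight k (stepn b) sigma
    = D ^+ loops f g * state_weight sq pos f' sigma].
Proof.
elim: k f g => [|k IH] f g fK fN nest mid guv gid.
  have {}gid : g =1 id by move=> r; apply: gid.
  exists f; split=> // [r [//|[]//]|p q _ _|sigma _]; first exact: joined_id.
  have -> : loops f g = 0%N.
    apply: eq_card0 => z; rewrite !inE; apply/negP => /andP[_ /forallP/(_ z)].
    by rewrite connect0 gid eqxx andbF.
  rewrite (big_pred1 [ffun i => 0]) => [|b]; last by apply/esym/eqP/ffunP => -[].
  by rewrite /glue_weight big_ord0 mulr1 mul1r.
have [ou ov] := nested_off nest.
have [nu nv /(_ k (ltnSn k)) uv] := nest.
have [gu gv] := guv k (ltnSn k).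
have midk r : (pos (u k) < pos r < pos (v k))%N -> f r = r.
  by case/(mid k r (ltnSn k)) => // -[j]; lia.
have neq_uv : u k != v k by rewrite -(inj_eq pos_inj) ltn_eqF.
have gK : involutive g.
  have offP r : off k.+1 r \/ exists2 i, (i < k.+1)%N & r = u i \/ r = v i.
    have [/existsP[i /orP[]/eqP->]|/existsPn H] := boolP [exists i : 'I_k.+1, (r == u i) || (r == v i)].
    - by right; exists i => //; left.
    - by right; exists i => //; right.
    by left=> i ik; have := H (Ordinal ik); rewrite negb_or => /andP.
  by move=> r; have [/gid E|[i /guv[E1 E2] [->|->]]] := offP r; rewrite ?E ?E ?E1 ?E2 ?E1.
pose f1 := contract (u k) (v k) f; pose g1 := unglue (u k) (v k) g.
have f1K : involutive f1 by apply: contractK.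
have f1N : noncrossing pos f1.
  exact: (noncrossing_contract pos_inj (sigma := fun=> 0) fK fN uv midk).
have g1uv i : (i < k)%N -> g1 (u i) = v i /\ g1 (v i) = u i.
  move=> ik; have [E1 E2] := guv i (ltnW ik); have [n1 n2] := ou i ik; have [n3 n4] := ov i ik.
  by rewrite /g1 /unglue E1 E2 ![_ == u k]eq_sym ![_ == v k]eq_sym !(negbTE n1, negbTE n2, negbTE n3, negbTE n4).
have offS r : off k r -> ~~ dead (u k) (v k) r -> off k.+1 r.
  move=> orr; rewrite /dead negb_or => /andP[r1 r2] i; rewrite ltnS leq_eqVlt.
  by case/orP => [/eqP->|/orr].
have g1id r : off k r -> g1 r = r.
  move=> orr; rewrite /g1 /unglue -/(dead (u k) (v k) r); case: ifPn => // dr.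
  by apply: gid; apply: offS.
have mid1 i r : (i < k)%N -> (pos (u i) < pos r < pos (v i))%N ->
     f1 r = r \/ exists2 j, (i < j < k)%N & r = u j \/ r = v j.
  move=> ik /(mid i r (ltnW ik)) [fr|[j /andP[ij]]]; first by left; apply: contract_fix.
  rewrite ltnS leq_eqVlt => /orP[/eqP->|jk] rE; last by right; exists j; rewrite ?ij.
  by left; rewrite /f1 contract_dead //; case: rE => ->; [apply: dead_u|apply: dead_v].
have [f' [f'K f'N f'fix f'conn f'sum]] := IH f1 g1 f1K f1N (nestedS nest) mid1 g1uv g1id.
exists f'; split=> //.
- move=> r [fr|nr]; first by apply: f'fix; left; apply: contract_fix.
  have [dr|dr] := boolP (dead (u k) (v k) r).
    by apply: f'fix; left; rewrite /f1 contract_dead.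
  by apply: f'fix; right=> orr; apply: nr; apply: offS.
- move=> p q op oq.
  have dp r : off k.+1 r -> off k r /\ ~~ dead (u k) (v k) r.
    move=> orr; split; first by move=> i ik; apply: orr; apply: ltnW.
    by have [r1 r2] := orr k (ltnSn k); rewrite /dead negb_or r1.
  have [[op' dp'] [oq' dq']] := (dp p op, dp q oq).
  by rewrite -f'conn // /f1 /g1 connect_contract.
move=> sigma s0.
have s0' i : (i < k)%N -> sigma (u i) = 0 /\ sigma (v i) = 0.
  by move=> ik; apply: s0; apply: ltnW.
have [su sv] := s0 k (ltnSn k).
rewrite sum_walk_recr (loops_contract neq_uv fK gK gu) exprD -mulrA -f'sum // mulr_sumr.
apply: eq_bigr => b _.
set tau := fill k (stepn b) sigma.
have tau_u : tau (u k) = 0 by rewrite /tau fill_off.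
have tau_v : tau (v k) = 0 by rewrite /tau fill_off.
rewrite mulrA -(@state_weight_contract _ _ _ _ pos_inj f (u k) (v k) tau) //.
rewrite mulr_suml; apply: eq_bigr => s _.
set b1 := stepn (rcons_walk (b, s)).
have fE : fill k b1 sigma =1 tau.
  by apply: eq_fill => i ik; rewrite /b1 stepn_rcons ltn_eqF.
have b1k : b1 k = step s by rewrite /b1 stepn_rcons eqxx.
have sE : fill k.+1 b1 sigma =1 bump (u k) (v k) tau (step s).
  by move=> p; rewrite /fill -/fill /bump fE b1k.
rewrite (eq_state_weight _ _ _ sE) -mulrA; congr (_ * _).
rewrite /glue_weight big_ord_recr /= mulrC b1k; congr (_ * _).
  rewrite !(eq_height _ sE) height_bump // ltnn addr0 //.
apply: eq_bigr => i _.
have hE : height pos (fill k.+1 b1 sigma) (pos (u i)) = height pos tau (pos (u i)).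
  rewrite (eq_height _ sE) height_bump // ltnNge ltnW ?addr0 //.
  by apply: nu; rewrite ltn_ord ltnSn.
by rewrite -/(fill k.+1 b1 sigma) hE /b1 stepn_rcons ltn_eqF.
Qed.

End ContractAll.

Lemma big_point (R : Type) (idx : R) (op : Monoid.com_law idx) n (P : pred (point n)) F :
  \big[op/idx]_(p : point n | P p) F p =
  op (\big[op/idx]_(i < n | P (true, i)) F (true, i))
     (\big[op/idx]_(i < n | P (false, i)) F (false, i)).
Proof.
rewrite big_mkcond (eq_bigr (fun p => if P (p.1, p.2) then F (p.1, p.2) else idx)); last by case.
rewrite -(pair_bigA _ (fun s i => if P (s, i) then F (s, i) else idx)) big_bool /=.
by rewrite -!big_mkcond.
Qed.

Lemma bpos_inj n : injective (@bpos n).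
Proof.
move=> [[] i] [[] j]; rewrite /bpos /=; have := ltn_ord i; have := ltn_ord j.
- by move=> _ _ /val_inj->.
- by lia.
- by lia.
by move=> *; congr (_, _); apply: val_inj => /=; lia.
Qed.

Lemma bpos_lt n (p : point n) : (bpos p < n + n)%N.
Proof. by case: p => [[] i]; rewrite /bpos /=; have := ltn_ord i; lia. Qed.

Lemma flipK n : involutive (@flip n).
Proof. by case=> s i; rewrite /flip /= negbK. Qed.

Lemma motzkinP n (d : {ffun point n -> point n}) :
  reflect (involutive d /\ noncrossing (@bpos n) d) (motzkin d).
Proof.
apply: (iffP andP) => [[/forallP dK /forallP dN]|[dK dN]].
  by split=> [p|p q]; [apply/eqP|apply: (forallP (dN p))].
by split; apply/forallP => p; [rewrite dK|apply/forallP => q; apply: dN].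
Qed.

Lemma mdiagK n (d : mdiag n) : involutive d.
Proof. by have /motzkinP[] := matchingP d. Qed.

Lemma mdiagN n (d : mdiag n) : noncrossing (@bpos n) d.
Proof. by have /motzkinP[] := matchingP d. Qed.

(* The minus sign: going around the rectangle, the bottom walk is run backwards. *)
Definition bdry n (a b : nat -> int) (p : point n) : int :=
  if p.1 then a p.2 else - b p.2.

Definition hgt (a : nat -> int) (k : nat) : int := 1 + \sum_(j < k) a j.

Lemma hgtS a k : hgt a k.+1 = hgt a k + a k.
Proof. by rewrite /hgt big_ord_recr /= addrA. Qed.

(** The two ends of each string cancel, so the walk around the rectangle closes up. *)
Lemma sum_bdry_antisym n (d : point n -> point n) a b : involutive d ->
  antisym d (@bdry n a b) -> hgt a n = hgt b n.
Proof.
move=> dK /forallP anti.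
have := @sum_antisym _ d (@bdry n a b) predT dK (fun r _ => conj isT (eqP (anti r))).
rewrite big_point /= sumrN => /eqP; rewrite subr_eq0 => /eqP E.
by rewrite /hgt; congr (1 + _).
Qed.

Lemma height_top n a b (i : 'I_n) : height (@bpos n) (bdry a b) i = hgt a i.
Proof.
rewrite /height /hgt; congr (1 + _); rewrite big_point /= [X in _ + X]big_pred0 ?addr0.
  by rewrite (big_ord_widen n (fun j => a j)) // ltnW.
by move=> j; rewrite /bpos /=; have := ltn_ord i; have := ltn_ord j; lia.
Qed.

(** The bottom is read backwards: when its point [i] is about to be read, the height is the one that
    the bottom walk has after its step [i], whence [i.+1]. *)
Lemma height_bottom n a b (i : 'I_n) : hgt a n = hgt b n ->
  height (@bpos n) (bdry a b) (bpos (false, i)) = hgt b i.+1.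
Proof.
move=> ab; rewrite /height big_point /= addrA.
rewrite (eq_bigl predT) => [|j]; last first.
  by rewrite /bpos /=; have := ltn_ord i; have := ltn_ord j; lia.
rewrite -/(hgt a n) ab sumrN /hgt -addrA; congr (1 + _).
rewrite (bigID (fun j : 'I_n => j <= i)%N) /= -addrA [X in _ + X](_ : _ = 0) ?addr0.
  by rewrite (big_ord_widen n (fun j => b j)).
apply/eqP; rewrite subr_eq0; apply/eqP; apply: eq_bigl => j.
by rewrite /bpos /=; have := ltn_ord i; have := ltn_ord j; lia.
Qed.

Section DiagramWeight.
Variables (K : numFieldType) (sq : int -> K).

Definition gap n (a b : nat -> int) (p : point n) : K :=
  let c := if p.1 then a else b in sq (hgt c p.2.+1) / sq (hgt c p.2).

Definition valid_walk n (a : nat -> int) : bool :=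
  [forall i : 'I_n, small (a i)] && [forall i : 'I_n.+1, sq (hgt a i) != 0].

Definition same_side n (d : point n -> point n) (p : point n) : bool :=
  ((d p).1 == p.1) && (p.2 < (d p).2)%N.

(** Only the arcs within a side enter. The through strings give [state_weight] a common factor that
    depends on the end height alone, see [state_weight_bdry]; without it the weights multiply like
    matrices. *)
Definition weight n (d : point n -> point n) (a b : nat -> int) : K :=
  [&& antisym d (@bdry n a b), valid_walk n a & valid_walk n b]%:R *
  \prod_(p : point n | same_side d p) gap a b p.

Hypotheses (sq1 : sq 1 = 1) (sq_ge0 : forall z, 0 <= sq z).

Lemma valid_bdry n (d : point n -> point n) a b : involutive d ->
  antisym d (@bdry n a b) ->
  valid sq (@bpos n) (bdry a b) = valid_walk n a && valid_walk n b.
Proof.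
move=> dK anti; have ab := sum_bdry_antisym dK anti.
have hT (i : 'I_n) : height (@bpos n) (bdry a b) (bpos (true, i)) = hgt a i.
  exact: height_top.
have hB := fun i : 'I_n => height_bottom i ab.
apply/forallP/andP => [H|[/andP[/forallP sa /forallP va] /andP[/forallP sb /forallP vb]] [[] i]].
- have sa (i : 'I_n) : small (a i) by have /andP[] := H (true, i).
  have sb (i : 'I_n) : small (b i).
    by have /andP[+ _] := H (false, i); rewrite /bdry /small /=; lia.
  have va (i : 'I_n) : sq (hgt a i) != 0 by have /andP[_] := H (true, i); rewrite hT.
  have vb (i : 'I_n) : sq (hgt b i.+1) != 0 by have /andP[_] := H (false, i); rewrite hB.
  have h0 c : hgt c 0 = 1 by rewrite /hgt big_ord0 addr0.
  have vbn (i : 'I_n.+1) : sq (hgt b i) != 0.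
    case: i => [[|i] lt_i] /=; first by rewrite h0 sq1 oner_eq0.
    by rewrite (_ : i = Ordinal (lt_i : i < n)%N :> nat).
  split; apply/andP; split; apply/forallP => //.
  move=> i; have [lt_in|] := ltnP i n; first by have := va (Ordinal lt_in).
  move=> ni; have -> : nat_of_ord i = n by have := ltn_ord i; lia.
  by rewrite ab; have := vbn ord_max.
- rewrite /bdry /= sa hT.
  by have := va (widen_ord (leqnSn n) i).
- rewrite hB /bdry /=; apply/andP; split; first by have := sb i; rewrite /small; lia.
  by have := vb (lift ord0 i).
Qed.

Lemma valid_walk_neq0 n a k : valid_walk n a -> (k <= n)%N -> sq (hgt a k) != 0.
Proof. by move=> /andP[_ /forallP H] kn; have := H (Ordinal (kn : k < n.+1)%N). Qed.

Definition bgap n a b (p : point n) : K :=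
  sq (height (@bpos n) (bdry a b) (bpos p).+1) / sq (height (@bpos n) (bdry a b) (bpos p)).

Lemma bgap_top n a b (i : 'I_n) : bgap a b (true, i) = gap a b (true, i).
Proof.
rewrite /bgap /gap (height_next (@bpos_inj n)) /=.
by rewrite [bpos _]/(nat_of_ord i) height_top hgtS.
Qed.

Lemma bgap_bottom n a b (i : 'I_n) : hgt a n = hgt b n ->
  bgap a b (false, i) = (gap a b (false, i))^-1.
Proof.
move=> ab; rewrite /bgap /gap (height_next (@bpos_inj n)) height_bottom //=.
by rewrite hgtS /bdry /= addrK invf_div.
Qed.

Lemma bgap_pair n (d : point n -> point n) a b p : involutive d ->
  noncrossing (@bpos n) d -> antisym d (@bdry n a b) -> valid sq (@bpos n) (bdry a b) ->
  bgap a b (d p) = (bgap a b p)^-1.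
Proof.
move=> dK dN /forallP anti /forallP val.
have key q : (bpos q < bpos (d q))%N -> bgap a b (d q) = (bgap a b q)^-1.
  move=> lt_q; rewrite /bgap !(height_next (@bpos_inj n)).
  rewrite (height_arc (@bpos_inj n) dK dN) // => [|r _]; last exact/eqP.
  by rewrite (eqP (anti q)) addrK invf_div.
case: (ltngtP (bpos p) (bpos (d p))) => [/key//|lt|/bpos_inj E].
  by have := key (d p); rewrite dK => /(_ lt) ->; rewrite invrK.
have := anti p; rewrite -E => /eqP sp; rewrite /bgap (height_next (@bpos_inj n)).
have -> : bdry a b p = 0 by lia.
by rewrite addr0 divff ?invr1 //; have /andP[] := val p.
Qed.

Lemma prod_ratio a k : (forall j, (j <= k)%N -> sq (hgt a j) != 0) ->
  \prod_(i < k) (sq (hgt a i.+1) / sq (hgt a i)) = sq (hgt a k).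
Proof.
elim: k => [|k IH] ak; first by rewrite /hgt !big_ord0 addr0 sq1.
rewrite big_ord_recr /= IH => [|j jk]; last by apply: ak; apply: ltnW.
by rewrite mulrC divfK // ak.
Qed.

Lemma prod_ratioV a k : (forall j, (j <= k)%N -> sq (hgt a j) != 0) ->
  \prod_(i < k) (sq (hgt a i) / sq (hgt a i.+1)) = (sq (hgt a k))^-1.
Proof.
by move=> /prod_ratio <-; rewrite -prodfV; apply: eq_bigr => i _; rewrite invf_div.
Qed.

Lemma bpos_same_side n (d : point n -> point n) p : involutive d -> (d p).1 = p.1 ->
  (bpos p < bpos (d p))%N = (if p.1 then p.2 < (d p).2 else (d p).2 < p.2)%N.
Proof.
move=> dK; case: (d p) => s j /= ->; rewrite /bpos /=; case: p.1 => //.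
by have := ltn_ord j; have := ltn_ord p.2; lia.
Qed.

Lemma bpos_through n (d : point n -> point n) p : (d p).1 != p.1 ->
  (bpos p < bpos (d p))%N = p.1.
Proof.
case: (d p) => s j; case: p => t i /=; rewrite /bpos /=.
by case: s; case: t => //= _; have := ltn_ord j; have := ltn_ord i; lia.
Qed.

(** The ratios at all top points telescope to [sq (hgt a n)]. Those at the ends of arcs within the
    top cancel in pairs, so the through strings alone account for this factor. *)
Lemma state_weight_bdry n (d : point n -> point n) a b : involutive d ->
  noncrossing (@bpos n) d ->
  state_weight sq (@bpos n) d (bdry a b) = weight d a b * sq (hgt a n).
Proof.
move=> dK dN; rewrite /state_weight /weight.
have [anti|] := boolP (antisym d _); last by rewrite /= !mul0r.
rewrite /= (valid_bdry dK anti); case: andP => [[va vb]|_]; last by rewrite !mul0r.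
rewrite !mul1r; have ab := sum_bdry_antisym dK anti.
have val : valid sq (@bpos n) (bdry a b) by rewrite (valid_bdry dK anti) va.
have b_ge0 p : 0 <= bgap a b p by rewrite /bgap divr_ge0.
(* Exchanging [p] and [d p] shows that the product is its own inverse; being nonnegative, it is
   1. *)
have closed_prod (P : pred (point n)) : (forall p, P (d p) = P p) ->
    \prod_(p | P p) bgap a b p = 1.
  move=> Pd; set X := \prod_(p | P p) _.
  have XX : X = X^-1.
    rewrite {1}/X (reindex_inj (inv_inj dK)) /= /X -prodfV.
    by apply: eq_big => [p|p _]; [rewrite Pd|apply: bgap_pair].
  have X0 : X != 0.
    apply/prodf_neq0 => p _; have /forallP/(_ (d p))/andP[_ H1] := val.
    case: p => [[] i] in H1 *; rewrite ?bgap_top ?bgap_bottom // ?invr_eq0 /gap /=;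
      by rewrite mulf_neq0 ?invr_eq0 // (@valid_walk_neq0 n) // ltnW.
  have := mulfV X0; rewrite -XX -expr2 => /eqP; rewrite sqrf_eq1 => /orP[/eqP//|/eqP XN].
  have : 0 <= X by apply: prodr_ge0 => p _; apply: b_ge0.
  by rewrite XN oppr_ge0 ler10.
have E p : arc_weight sq (@bpos n) d (bdry a b) p =
    if (bpos p < bpos (d p))%N then bgap a b p else 1 by [].
rewrite (eq_bigr _ (fun p _ => E p)) -big_mkcond.
rewrite (bigID (fun p => (d p).1 == p.1)) /=.
have through : \prod_(p | (bpos p < bpos (d p))%N && ((d p).1 != p.1)) bgap a b p = sq (hgt a n).
  have := prod_ratio (fun j => valid_walk_neq0 va (k := j)).
  rewrite (eq_bigr (fun i => bgap a b (true, i))) => [<-|i _]; last by rewrite bgap_top.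
  transitivity (\prod_(p : point n | p.1) bgap a b p); last first.
    by rewrite big_point /= [X in _ * X]big_pred0 ?mulr1.
  rewrite [RHS](bigID (fun p : point n => (d p).1)) /=.
  rewrite (closed_prod (fun p => p.1 && (d p).1)) ?mul1r; last by move=> p; rewrite dK andbC.
  apply: eq_bigl => p; have [E1|E1] := eqVneq (d p).1 p.1; first by rewrite andbF E1 andbN.
  by rewrite bpos_through // andbT; case: (d p).1 E1; case: p.1.
rewrite through; congr (_ * _).
rewrite (bigID (fun p : point n => p.1)) [RHS](bigID (fun p : point n => p.1)) /=; congr (_ * _).
  apply: eq_big => [p|[s i]]; last by case: s => [_|/andP[]//]; rewrite bgap_top.
  rewrite /same_side; have [E1|_] := eqVneq (d p).1 p.1; last by rewrite !andbF.
  by rewrite andbT (bpos_same_side dK E1); case: p.1; rewrite ?andbF.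
(* Along the boundary the right end of a bottom arc comes first. Passing to the other end inverts
   the ratio, and reading the bottom walk backwards inverts it once more. *)
rewrite (reindex_inj (inv_inj dK)) /=; apply: eq_big => [p|p].
  rewrite dK /same_side eq_sym; have [E1|_] := eqVneq (d p).1 p.1; last by rewrite !andbF.
  have := @bpos_same_side _ d (d p) dK; rewrite dK E1 => /(_ erefl) ->.
  by rewrite andbT; case: p.1; rewrite ?andbF.
case: p => [s i] /andP[/andP[_ /eqP]]; rewrite dK /= => <-; case: s => // _.
by rewrite bgap_pair // bgap_bottom // invrK.
Qed.

Lemma weight_valid n (d : point n -> point n) a b : weight d a b != 0 ->
  [/\ antisym d (@bdry n a b), valid_walk n a & valid_walk n b].
Proof. by rewrite /weight; case: and3P => //; rewrite mul0r eqxx. Qed.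

Lemma bdry_flip n a b (p : point n) : bdry a b (flip p) = - bdry b a p.
Proof. by case: p => [[] i]; rewrite /bdry /= ?opprK. Qed.

Lemma mreflect_motzkin n (d : {ffun point n -> point n}) :
  motzkin d -> motzkin (mreflect d).
Proof.
move=> /motzkinP[dK dN]; apply/motzkinP; split=> [p|p q].
  by rewrite !ffunE flipK dK flipK.
rewrite !ffunE; have bF (r : point n) : bpos (flip r) = (n + n - (bpos r).+1)%N.
  by case: r => [[] i]; rewrite /bpos /=; have := ltn_ord i; lia.
have := dN (d (flip q)) (d (flip p)); rewrite !dK !bF.
have := bpos_lt p; have := bpos_lt q; have := bpos_lt (d (flip p)); have := bpos_lt (d (flip q)).
by move: (bpos p) (bpos q) (bpos _) (bpos _) => x y z t; lia.
Qed.

Lemma weight_mreflect n (d : {ffun point n -> point n}) a b :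
  weight (mreflect d) b a = weight d a b.
Proof.
rewrite /weight; congr (_%:R * _).
  congr nat_of_bool; rewrite [valid_walk n b && _]andbC; congr andb.
  apply/forallP/forallP => H p; have := H (flip p).
    by rewrite ffunE !bdry_flip flipK eqr_opp.
  by rewrite ffunE !bdry_flip => /eqP ->; rewrite opprK.
rewrite (reindex_inj (inv_inj (@flipK n))) /=; apply: eq_big => [p|[[] i] _] //.
by rewrite /same_side ffunE flipK; case: p (d p) => [[] i] [[] j].
Qed.

Lemma valid_walk_le n m a : (n <= m)%N -> valid_walk m a -> valid_walk n a.
Proof.
move=> nm /andP[/forallP sa /forallP va]; apply/andP; split; apply/forallP => i.
  exact: (sa (widen_ord nm i)).
by have := va (@widen_ord n.+1 m.+1 nm i).
Qed.

Lemma weight_pad n m (d : {ffun point n -> point n}) a b : (n <= m)%N -> involutive d ->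
  weight (pad m d) a b =
  ([forall i : 'I_m, (n <= i)%N ==> (a i == b i)] && valid_walk m a)%:R * weight d a b.
Proof.
move=> nm dK; rewrite /weight mulrA -natrM mulnb; congr (_%:R * _).
  have aE : antisym (pad m d) (@bdry m a b) =
      antisym d (@bdry n a b) && [forall i : 'I_m, (n <= i)%N ==> (a i == b i)].
    apply/forallP/andP => [H|[/forallP H /forallP tl] p].
      split; apply/forallP => p; first by have := H (widen_point nm p); rewrite pad_widen.
      apply/implyP => np; have := H (true, p); rewrite pad_new // bdry_flip /bdry /=; lia.
    case: (pointP nm p) => [q ->|np]; first by rewrite pad_widen; apply: H.
    have := tl p.2; rewrite np /= pad_new // bdry_flip /bdry => /eqP ->.
    by case: p.1; rewrite ?opprK.
  congr nat_of_bool; rewrite aE.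
  have [anti|_] := boolP (antisym d _); last by rewrite /= !andbF.
  have ab := sum_bdry_antisym dK anti.
  case: forallP => //= tl; have [va|_] := boolP (valid_walk m a); last by [].
  rewrite (valid_walk_le nm va) /=.
  apply/idP/idP => [|vb]; first exact: valid_walk_le.
  have tl' i : (n <= i < m)%N -> a i = b i.
    by move=> /andP[ni im]; have := tl (Ordinal im); rewrite ni => /eqP.
  have hE k : (n <= k <= m)%N -> hgt b k = hgt a k.
    case/andP; elim: k => [|k IH]; first by rewrite leqn0 => /eqP n0 _; rewrite -[0%N]n0.
    rewrite leq_eqVlt => /orP[/eqP<- //|]; rewrite ltnS => nk km.
    by rewrite !hgtS IH ?tl' ?nk // ltnW.
  move/andP: va => [/forallP sa /forallP va]; move/andP: vb => [/forallP sb /forallP vb].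
  apply/andP; split; apply/forallP => i.
    have [ni|ltin] := leqP n i; last by have := sb (Ordinal ltin).
    by rewrite -tl' ?ni ?ltn_ord //; apply: sa.
  have [ni|ltin] := leqP n i; last by have := vb (Ordinal (ltnW ltin : i < n.+1)%N).
  by rewrite hE ?ni /= -1?ltnS //; apply: va.
rewrite [LHS]big_mkcond [RHS]big_mkcond !big_point /=.
have side s : \prod_(i < m) (if same_side (pad m d) (s, i) then gap a b (s, i) else 1) =
    \prod_(i < n) (if same_side d (s, i) then gap a b (s, i) else 1).
  rewrite (bigID (fun i : 'I_m => (i < n)%N)) /= [X in _ * X]big1 ?mulr1; last first.
    move=> i; rewrite -leqNgt => ni.
    by rewrite /same_side pad_ge //=; case: s.
  rewrite (big_ord_narrow nm) //=; apply: eq_bigr => i _.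
  have -> : (s, widen_ord nm i) = widen_point nm (s, i) by [].
  by rewrite /same_side pad_widen.
by rewrite !side.
Qed.

Variable D : K.
Hypothesis sq_eigen : forall z, sq z != 0 ->
  sq (z - 1) ^+ 2 + sq z ^+ 2 + sq (z + 1) ^+ 2 = D * sq z ^+ 2.

Lemma hgt0 a : hgt a 0 = 1. Proof. by rewrite /hgt big_ord0 addr0. Qed.

(** Gluing each top point to the bottom point below it gives nested pairs, and the contraction
    leaves no string. Of the two factors [sq (hgt _ n)] one is that of [state_weight_bdry], the
    other the telescoped glue weight. *)
Lemma closure_weight n (d : mdiag n) :
  \sum_(b : walk n) weight d (stepn b) (stepn b) * sq (hgt (stepn b) n) ^+ 2 =
  D ^+ closure_loops d.
Proof.
case: n d => [|n] d.
  rewrite /closure_loops /loops (_ : n_comp _ _ = 0%N); last by apply: eq_card0 => -[s []].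
  rewrite (big_pred1 [ffun i => 0]) => [|b]; last by apply/esym/eqP/ffunP => -[].
  rewrite hgt0 sq1 expr1n mulr1 /weight big_pred0 ?mulr1 => [|[s []] //].
  have v0 : valid_walk 0 (stepn [ffun i : 'I_0 => 0]).
    apply/andP; split; apply/forallP => -[[]] // k.
    by rewrite hgt0 sq1 oner_eq0.
  by rewrite v0 andbT (_ : antisym _ _ = true) //; apply/forallP => -[s []].
pose u j : point n.+1 := (true, inord j); pose v j : point n.+1 := (false, inord j).
have bu j : (j < n.+1)%N -> bpos (u j) = j by move=> jn; rewrite /bpos /= inordK.
have bv j : (j < n.+1)%N -> bpos (v j) = (n.+1 + n.+1 - j.+1)%N.
  by move=> jn; rewrite /bpos /= inordK.
have nest : nested (@bpos n.+1) u v n.+1.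
  by split=> [i j ij|i j ij|i i_n]; rewrite ?bu ?bv; lia.
have uvE (r : point n.+1) : r = if r.1 then u r.2 else v r.2.
  by case: r => [[] i]; rewrite /u /v inord_val.
have offN r : ~ off u v n.+1 r.
  by have := uvE r; case: ifP => _ E /(_ r.2 (ltn_ord _)) [/eqP + /eqP].
have [|||f' [f'K f'N f'fix _ f'sum]] := @contract_all _ _ _ sq_eigen _ _ (@bpos_inj n.+1) u v
    n.+1 d (@flip n.+1) (mdiagK d) (mdiagN d) nest.
- move=> i r i_n; rewrite bu // bv // => ir; right; exists (r.2 : nat).
    by move: ir (ltn_ord r.2); rewrite /bpos; case: r.1; lia.
  by have := uvE r; case: ifP => _; [left|right].
- by move=> i i_n; split.
- by move=> r /offN.
have f'id r : f' r = r by apply: f'fix; right; apply: offN.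
have := f'sum (fun=> 0) (fun i _ => conj erefl erefl).
have -> : state_weight sq (@bpos n.+1) f' (fun=> 0) = 1.
  rewrite /state_weight big1 ?mulr1; last by move=> p _; rewrite /arc_weight f'id ltnn.
  have -> : antisym f' (fun=> 0) by apply/forallP => p; rewrite oppr0.
  have -> // : valid sq (@bpos n.+1) (fun=> 0).
  by apply/forallP => p; rewrite /small /height big1 // addr0 sq1 oner_eq0.
rewrite mulr1 -/(closure_loops d) => <-; apply: eq_bigr => b _.
have fE : fill u v n.+1 (stepn b) (fun=> 0) =1 bdry (stepn b) (stepn b).
  move=> r; have [E1 E2] := fill_on (@bpos_inj n.+1) (stepn b) (fun=> 0) nest (ltn_ord r.2).
  by have := uvE r; rewrite /bdry; case: ifP => _ E; rewrite {1}E.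
rewrite (eq_state_weight _ _ _ fE) state_weight_bdry; [|exact: mdiagK|exact: mdiagN].
have [->|/weight_valid[_ va _]] := eqVneq (weight d (stepn b) (stepn b)) 0; first by rewrite !mul0r.
rewrite expr2 !mulrA; congr (_ * _).
rewrite /glue_weight -(prod_ratio (fun j => valid_walk_neq0 va (k := j))).
apply: eq_bigr => i _; rewrite (eq_height _ fE) [bpos _]bu //.
by rewrite -[X in height _ _ X]/(nat_of_ord i) height_top hgtS.
Qed.

End DiagramWeight.

(** * Stacking of diagrams as matrix multiplication *)

Section StackWeight.
Variables (K : numFieldType) (sq : int -> K) (D : K).
Hypotheses (sq1 : sq 1 = 1) (sq_ge0 : forall z, 0 <= sq z).
Hypothesis sq_eigen : forall z, sq z != 0 ->
  sq (z - 1) ^+ 2 + sq z ^+ 2 + sq (z + 1) ^+ 2 = D * sq z ^+ 2.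
Variables (n : nat) (x y : mdiag n).

Let T := (point n + point n)%type.
Let f : T -> T := stack_strings x y.

(** One walk around [x] and then around [y]. It reads the bottom of [x] from right to left and
    directly afterwards the top of [y] from left to right, so the glued pairs are nested. *)
Definition stack_pos (v : T) : nat :=
  match v with inl p => bpos p | inr p => (n + n + bpos p)%N end.

Lemma stack_pos_inj : injective stack_pos.
Proof.
move=> [p|p] [q|q] /= E.
- by rewrite (bpos_inj E).
- by have := bpos_lt p; rewrite E; lia.
- by have := bpos_lt q; rewrite -E; lia.
- by congr inr; apply: bpos_inj; lia.
Qed.

Lemma stack_stringsK : involutive f.
Proof. by case=> p /=; rewrite mdiagK. Qed.

Lemma stack_strings_noncrossing : noncrossing stack_pos f.
Proof.
move=> [p|p] [q|q] /=.
- exact: mdiagN.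
- by have := bpos_lt (x p); move: (bpos _) (bpos _) (bpos _) (bpos _) => *; lia.
- by have := bpos_lt q; move: (bpos _) (bpos _) (bpos _) (bpos _) => *; lia.
- by rewrite !ltn_add2l; apply: mdiagN.
Qed.

Lemma stack_height_inl sigma p :
  height stack_pos sigma (stack_pos (inl p)) = height (@bpos n) (sigma \o inl) (bpos p).
Proof.
rewrite /height; congr (1 + _); rewrite big_sumType /= [X in _ + X]big_pred0 ?addr0 // => q.
by have := bpos_lt p; lia.
Qed.

(** The walk around [x] closes up, so the walk around [y] starts at height 1 again. *)
Lemma stack_height_inr sigma p : \sum_q sigma (inl q) = 0 ->
  height stack_pos sigma (stack_pos (inr p)) = height (@bpos n) (sigma \o inr) (bpos p).
Proof.
move=> s0; rewrite /height; congr (1 + _); rewrite big_sumType /=.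
rewrite (eq_bigl predT) => [|q]; last by rewrite /=; have := bpos_lt q; lia.
by rewrite s0 add0r; apply: eq_bigl => q; rewrite ltn_add2l.
Qed.

Lemma state_weight_stack sigma :
  state_weight sq stack_pos f sigma =
  state_weight sq (@bpos n) x (sigma \o inl) * state_weight sq (@bpos n) y (sigma \o inr).
Proof.
rewrite /state_weight.
have aE : antisym f sigma = antisym x (sigma \o inl) && antisym y (sigma \o inr).
  apply/forallP/andP => [H|[/forallP Hx /forallP Hy] [p|p]]; [split| |].
  - by apply/forallP => p; apply: (H (inl p)).
  - by apply/forallP => p; apply: (H (inr p)).
  - exact: (Hx p).
  - exact: (Hy p).
rewrite aE; have [anti|_] := boolP (antisym x _); last by rewrite /= !mul0r.
have s0 : \sum_q sigma (inl q) = 0.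
  apply: (@sum_antisym _ x (sigma \o inl) predT (mdiagK x)) => r _.
  by split=> //; have /forallP/(_ r)/eqP := anti.
have vE : valid sq stack_pos sigma =
    valid sq (@bpos n) (sigma \o inl) && valid sq (@bpos n) (sigma \o inr).
  apply/forallP/andP => [H|[/forallP Hx /forallP Hy] [p|p]]; [split| |].
  - by apply/forallP => p; have := H (inl p); rewrite stack_height_inl.
  - by apply/forallP => p; have := H (inr p); rewrite stack_height_inr.
  - by rewrite stack_height_inl; apply: Hx.
  - by rewrite stack_height_inr //; apply: Hy.
rewrite vE big_sumType /= mulrACA -natrM mulnb andbCA; congr (_%:R * (_ * _)).
  apply: eq_bigr => p _; rewrite /arc_weight !(height_next stack_pos_inj).
  by rewrite !(height_next (@bpos_inj n)) stack_height_inl.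
apply: eq_bigr => p _; rewrite /arc_weight !(height_next stack_pos_inj).
by rewrite !(height_next (@bpos_inj n)) stack_height_inr //= ltn_add2l.
Qed.

(** The glued points keep the step 0 until [fill] assigns theirs. *)
Definition outer_steps (a c : nat -> int) (v : T) : int :=
  match v with
  | inl p => if p.1 then a p.2 else 0
  | inr p => if p.1 then 0 else - c p.2
  end.

Lemma outer_height_inl a c p : height stack_pos (outer_steps a c) (stack_pos (inl p)) =
  if p.1 then hgt a p.2 else hgt a n.
Proof.
rewrite /height /hgt; case: ifP => p1; congr (1 + _).
all: rewrite big_sumType /= [X in _ + X]big_pred0 ?addr0; last by move=> q; have := bpos_lt p; lia.
all: rewrite big_point /= [X in _ + X]big1 ?addr0 //.
  rewrite (big_ord_widen n (fun j => a j)) 1?ltnW //; apply: eq_bigl => j.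
  by rewrite /bpos p1.
apply: eq_bigl => j; rewrite /bpos p1 /=; case: p {p1} => s i /=.
by have := ltn_ord j; have := ltn_ord i; lia.
Qed.

Lemma outer_height_inr a c p : hgt a n = hgt c n ->
  height stack_pos (outer_steps a c) (stack_pos (inr p)) =
  if p.1 then hgt a n else hgt c p.2.+1.
Proof.
move=> ac; rewrite /height big_sumType /= (eq_bigl predT) => [|q]; last first.
  by rewrite /=; have := bpos_lt q; lia.
rewrite !big_point /= !big1_eq addr0 add0r addrA -/(hgt a n).
case p1: p.1.
  rewrite big_pred0 ?addr0 // => j; rewrite /bpos p1 /=; case: p {p1} => s i /=.
  by have := ltn_ord j; have := ltn_ord i; lia.
have -> : p = (false, p.2) by rewrite -p1; case: (p).
rewrite -(height_bottom p.2 ac) /height big_point /= addrA; congr (_ + _).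
  rewrite /hgt; congr (1 + _); apply: eq_bigl => j; rewrite /bpos /=; case: p {p1} => s i /=.
  by have := ltn_ord j; have := ltn_ord i; lia.
by apply: eq_bigl => j; rewrite ltn_add2l.
Qed.

Variables (f' : T -> T).
Hypotheses (f'K : involutive f') (f'N : noncrossing stack_pos f').
Hypothesis f'inner : forall i, f' (inl (false, i)) = inl (false, i) /\
  f' (inr (true, i)) = inr (true, i).
Hypothesis f'conn : forall p q, connect (joined f (@stack_glue n)) (stack_outer p) (stack_outer q)
  = (stack_outer q == stack_outer p) || (stack_outer q == f' (stack_outer p)).

Lemma stack_outer_inj : injective (@stack_outer n).
Proof. by move=> [[] i] [[] j] //= [->]. Qed.

Lemma stack_outerE p : f' (stack_outer p) = stack_outer (stack x y p).
Proof.
have [q qE] : exists q, f' (stack_outer p) = stack_outer q.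
  case E: (f' (stack_outer p)) => [[s i]|[s i]].
    case: s E => E; first by exists (true, i).
    have [H _] := f'inner i; move: (f'K (stack_outer p)); rewrite E H.
    by case: p {E} => [[] j].
  case: s E => E; last by exists (false, i).
  have [_ H] := f'inner i; move: (f'K (stack_outer p)); rewrite E H.
  by case: p {E} => [[] j].
rewrite qE /stack ffunE; case: pickP => [r /andP[rp]|none] /=.
  by rewrite f'conn qE !(inj_eq stack_outer_inj) (negbTE rp) => /eqP ->.
have := none q; rewrite f'conn qE eqxx orbT andbT => /negbFE/eqP -> //.
Qed.

Lemma stack_outer_lt p q :
  (stack_pos (stack_outer p) < stack_pos (stack_outer q))%N = (bpos p < bpos q)%N.
Proof.
case: p => [[] i]; case: q => [[] j] //=; rewrite /bpos /=;
by have := ltn_ord i; have := ltn_ord j; lia.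
Qed.

(** Planarity of the product is inherited from the contracted matching [f'], whose order on the
    outer points is that of [bpos]. *)
Lemma stack_motzkin : motzkin (stack x y).
Proof.
apply/motzkinP; split=> [p|p q].
  by apply: stack_outer_inj; rewrite -!stack_outerE f'K.
by have := f'N (stack_outer p) (stack_outer q); rewrite !stack_outerE !stack_outer_lt.
Qed.

Lemma state_weight_outer a c :
  state_weight sq stack_pos f' (outer_steps a c) =
  state_weight sq (@bpos n) (stack x y) (bdry a c).
Proof.
rewrite /state_weight.
have /motzkinP[zK zN] := stack_motzkin; set z := stack x y in zK zN *.
have oE p : outer_steps a c (stack_outer p) = bdry a c p by case: p => [[] i].
have aE : antisym f' (outer_steps a c) = antisym z (@bdry n a c).
  apply/forallP/forallP => [H p|H].
    by have := H (stack_outer p); rewrite stack_outerE !oE.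
  case=> [[[] i]|[[] i]].
  - by have := H (true, i); rewrite -!oE -stack_outerE.
  - by have [-> _] := f'inner i; rewrite /= oppr0.
  - by have [_ ->] := f'inner i; rewrite /= oppr0.
  - by have := H (false, i); rewrite -!oE -stack_outerE.
rewrite aE; have [anti|_] := boolP (antisym z _); last by rewrite /= !mul0r.
have ac := sum_bdry_antisym zK anti.
have hE p : height stack_pos (outer_steps a c) (stack_pos (stack_outer p)) =
    height (@bpos n) (bdry a c) (bpos p).
  case: p => [[] i]; first by rewrite outer_height_inl [bpos _]/(nat_of_ord i) height_top.
  by rewrite outer_height_inr // height_bottom.
have vE : valid sq stack_pos (outer_steps a c) = valid sq (@bpos n) (bdry a c).
  apply/forallP/idP => [H|val].
    by apply/forallP => p; have := H (stack_outer p); rewrite hE oE.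
  have := val; rewrite (valid_bdry sq1 zK anti) => /andP[va _].
  have hn : sq (hgt a n) != 0 by apply: (valid_walk_neq0 va).
  have out p : small (outer_steps a c (stack_outer p)) &&
      (sq (height stack_pos (outer_steps a c) (stack_pos (stack_outer p))) != 0).
    by rewrite hE oE; apply: (forallP val).
  case=> [[[] i]|[[] i]]; [exact: (out (true, i))| | |exact: (out (false, i))].
    by rewrite outer_height_inl /= hn.
  by rewrite outer_height_inr //= hn.
rewrite vE; congr (_ * _).
rewrite big_sumType !big_point /= [X in _ * X * _]big1 ?mulr1 => [|i _]; last first.
  by rewrite /arc_weight; have [-> _] := f'inner i; rewrite ltnn.
rewrite [X in _ * (X * _)]big1 ?mul1r => [|i _]; last first.
  by rewrite /arc_weight; have [_ ->] := f'inner i; rewrite ltnn.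
have wE p : arc_weight sq stack_pos f' (outer_steps a c) (stack_outer p) =
    arc_weight sq (@bpos n) z (bdry a c) p.
  rewrite /arc_weight stack_outerE stack_outer_lt !(height_next stack_pos_inj).
  by rewrite !(height_next (@bpos_inj n)) hE oE.
by congr (_ * _); apply: eq_bigr => i _; rewrite -wE.
Qed.

End StackWeight.

(** In the nested enumeration, pair [j] sits at the bottom point [n - j] of the upper diagram, where
    [bdry] has the opposite of the step; hence the reversal of positions and of signs. *)
Definition flip_walk n (b : walk n) : walk n := [ffun j => rev_ord (b (rev_ord j))].

Lemma flip_walkK n : involutive (@flip_walk n).
Proof. by move=> b; apply/ffunP => j; rewrite !ffunE !rev_ordK. Qed.

Lemma step_rev s : step (rev_ord s) = - step s.
Proof. by case: s => [[|[|[|]]]]. Qed.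

Section StackTheorem.
Variables (K : numFieldType) (sq : int -> K) (D : K).
Hypotheses (sq1 : sq 1 = 1) (sq_ge0 : forall z, 0 <= sq z).
Hypothesis sq_eigen : forall z, sq z != 0 ->
  sq (z - 1) ^+ 2 + sq z ^+ 2 + sq (z + 1) ^+ 2 = D * sq z ^+ 2.

(** All glued points of the stack are contracted. The state weights of [x] and [y] each bring a
    factor [sq] of the common end height; the glue weight telescopes to its inverse and removes one,
    and the other also occurs on the right. *)
Lemma stack_weight n (x y : mdiag n) a c :
  \sum_(b : walk n) weight sq x a (stepn b) * weight sq y (stepn b) c =
  D ^+ kappa x y * weight sq (stack x y) a c /\ motzkin (stack x y).
Proof.
case: n x y => [|n] x y.
  split; last by apply/motzkinP; split=> -[s []].
  have wE (d : point 0 -> point 0) b b' : weight sq d b b' = 1.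
    have v0 e : valid_walk sq 0 e.
      by apply/andP; split; apply/forallP => -[[]] // k; rewrite hgt0 sq1 oner_eq0.
    rewrite /weight !v0 !andbT (_ : antisym _ _ = true); last by apply/forallP => -[s []].
    by rewrite mul1r big_pred0 // => -[s []].
  rewrite (big_pred1 [ffun i => 0]) => [|b]; last by apply/esym/eqP/ffunP => -[].
  rewrite !wE !mulr1 /kappa /loops (_ : n_comp _ _ = 0%N) //.
  by apply: eq_card0 => -[[s []]|[s []]].
pose u j : point n.+1 + point n.+1 := inl (false, inord (n - j)).
pose v j : point n.+1 + point n.+1 := inr (true, inord (n - j)).
have pu j : (j < n.+1)%N -> stack_pos (u j) = (n.+1 + j)%N.
  by move=> jn; rewrite /= /bpos /= inordK; lia.
have pv j : (j < n.+1)%N -> stack_pos (v j) = (n.+1 + n.+1 + n - j)%N.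
  by move=> jn; rewrite /= /bpos /= inordK; lia.
have nest : nested (@stack_pos n.+1) u v n.+1.
  by split=> [i j ij|i j ij|i i_n]; rewrite ?pu ?pv; lia.
have uE (i : 'I_n.+1) : inl (false, i) = u (n - i)%N.
  by congr (inl (_, _)); apply: val_inj; rewrite /= subKn ?inordK // -ltnS.
have vE (i : 'I_n.+1) : inr (true, i) = v (n - i)%N.
  by congr (inr (_, _)); apply: val_inj; rewrite /= subKn ?inordK // -ltnS.
have lt_sub (i : nat) : (n - i < n.+1)%N by rewrite ltnS leq_subr.
have offN (i : 'I_n.+1) : ~ off u v n.+1 (inl (false, i)) /\ ~ off u v n.+1 (inr (true, i)).
  by split; [rewrite uE|rewrite vE] => /(_ (n - i)%N (lt_sub i)) []; rewrite eqxx.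
have offP p : off u v n.+1 (stack_outer p) by case: p => [[] i].
have [|||f' [f'K f'N f'fix f'conn f'sum]] := @contract_all _ _ _ sq_eigen _ _
    (@stack_pos_inj n.+1) u v n.+1 (stack_strings x y) (@stack_glue n.+1)
    (@stack_stringsK n.+1 x y) (@stack_strings_noncrossing n.+1 x y) nest.
- move=> i r i_n; rewrite pu // pv // => ir; right.
  case: r ir => [[[] j]|[[] j]] ir.
  + by move: ir (ltn_ord j); rewrite /= /bpos /=; lia.
  + exists (n - j)%N; last by left.
    by move: ir (ltn_ord j); rewrite /= /bpos /=; lia.
  + exists (n - j)%N; last by right.
    by move: ir (ltn_ord j); rewrite /= /bpos /=; lia.
  + by move: ir (ltn_ord j); rewrite /= /bpos /=; lia.
- by move=> i i_n; split.
- case=> [[[] j]|[[] j]] // orr; [by case: (offN j) => /(_ orr)|by case: (offN j) => _ /(_ orr)].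
have inner i : f' (inl (false, i)) = inl (false, i) /\ f' (inr (true, i)) = inr (true, i).
  by split; apply: f'fix; right; case: (offN i).
have conn p q := f'conn _ _ (offP p) (offP q).
have z_mot := stack_motzkin f'K f'N inner conn.
have /motzkinP[zK zN] := z_mot.
split=> //.
have := f'sum (outer_steps a c) (fun i _ => conj erefl erefl).
rewrite (state_weight_outer sq1 f'K f'N inner conn) state_weight_bdry //.
rewrite -/(kappa x y) (reindex_inj (inv_inj (@flip_walkK n.+1))) /=.
pose bs (b : walk n.+1) := stepn b.
have flipE (b : walk n.+1) j : (j < n.+1)%N -> stepn (flip_walk b) j = - stepn b (n - j)%N.
  move=> jn; rewrite -[j]/(nat_of_ord (Ordinal jn)) stepn_ord ffunE step_rev.
  by rewrite -stepn_ord /= subSS.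
have fE (b : walk n.+1) : fill u v n.+1 (stepn (flip_walk b)) (outer_steps a c) =1
    (fun r => match r with inl p => bdry a (stepn b) p | inr p => bdry (stepn b) c p end).
  have on i := fill_on (@stack_pos_inj n.+1) (stepn (flip_walk b)) (outer_steps a c) nest (lt_sub i).
  case=> [[[] i]|[[] i]].
  - by rewrite fill_off //; apply: (offP (true, i)).
  - by have [+ _] := on i; rewrite (flipE b _ (lt_sub i)) subKn -?uE // -ltnS.
  - by have [_ +] := on i; rewrite (flipE b _ (lt_sub i)) opprK subKn -?vE // -ltnS.
  - by rewrite fill_off //; apply: (offP (false, i)).
have termE (b : walk n.+1) : state_weight sq (@stack_pos n.+1) (stack_strings x y)
      (fill u v n.+1 (stepn (flip_walk b)) (outer_steps a c)) *
    glue_weight sq (@stack_pos n.+1) u v n.+1 (stepn (flip_walk b)) (outer_steps a c) =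
    weight sq x a (stepn b) * weight sq y (stepn b) c * sq (hgt a n.+1).
  rewrite (eq_state_weight _ _ _ (fE b)) state_weight_stack.
  rewrite (@eq_state_weight _ sq _ _ x _ (bdry a (stepn b))) //.
  rewrite (@eq_state_weight _ sq _ _ y _ (bdry (stepn b) c)) //.
  rewrite !state_weight_bdry //; try exact: mdiagK; try exact: mdiagN.
  have [->|/weight_valid[anti va vb]] := eqVneq (weight sq x a (stepn b)) 0.
    by rewrite !mul0r.
  have ab := sum_bdry_antisym (mdiagK x) anti.
  have -> : glue_weight sq (@stack_pos n.+1) u v n.+1 (stepn (flip_walk b)) (outer_steps a c) =
      (sq (hgt (stepn b) n.+1))^-1.
    rewrite -(prod_ratioV sq1 (fun j => valid_walk_neq0 vb (k := j))).
    rewrite (reindex_inj rev_ord_inj) /=; apply: eq_bigr => i _.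
    have ui : u i = inl (false, rev_ord i).
      by congr (inl (_, _)); apply: val_inj; rewrite /= inordK // lt_sub.
    rewrite (eq_height _ (fE b)) ui stack_height_inl.
    rewrite (_ : height _ _ _ = hgt (stepn b) (n - i).+1).
      by rewrite flipE // hgtS addrK.
    by rewrite -[(n - i)%N]/(nat_of_ord (rev_ord i)) -(height_bottom (rev_ord i) ab).
  have nz := valid_walk_neq0 vb (leqnn n.+1).
  by rewrite ab; field.
rewrite (eq_bigr _ (fun b _ => termE b)) -mulr_suml mulrA.
(* Where the common factor vanishes, [a] is not valid and both sides are 0. *)
have [z0|nz] := eqVneq (sq (hgt a n.+1)) 0; last by move/(mulIf nz).
move=> _; have w0 (d : point n.+1 -> point n.+1) b : weight sq d a b = 0.
  rewrite /weight; case: and3P => [[_ va _]|_]; last by rewrite mul0r.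
  by have := valid_walk_neq0 va (leqnn n.+1); rewrite z0 eqxx.
by rewrite w0 mulr0 big1 // => b _; rewrite w0 mul0r.
Qed.

End StackTheorem.

(** * Perron-Frobenius weights for the given D *)

Section PerronFrobenius.
Variable R : realType.

Lemma sqrt_weight (D : R) (m : nat -> R) : m 0 = 0 -> m 1 = 1 -> (forall k, 0 <= m k) ->
  (forall k, m k.+1 != 0 -> m k + m k.+1 + m k.+2 = D * m k.+1) ->
  exists sq : int -> R, [/\ sq 1 = 1, forall z, 0 <= sq z &
    forall z, sq z != 0 -> sq (z - 1) ^+ 2 + sq z ^+ 2 + sq (z + 1) ^+ 2 = D * sq z ^+ 2].
Proof.
move=> m0 m1 m_ge0 m_eig.
pose mu (z : int) := if z is Posz k then m k else 0.
have mu_ge0 z : 0 <= mu z by case: z => k //=.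
exists (fun z => Num.sqrt (mu z)); split=> [|z|z]; first by rewrite /= m1 sqrtr1.
  exact: sqrtr_ge0.
have mu1 k : mu (Posz k.+1 - 1) = m k by rewrite (_ : Posz k.+1 - 1 = Posz k) //; lia.
have mu2 k : mu (Posz k.+1 + 1) = m k.+2 by rewrite (_ : Posz k.+1 + 1 = Posz k.+2) //; lia.
rewrite !sqr_sqrtr //; case: z => [[|k]|k] nz.
- by move: nz; rewrite /mu m0 sqrtr0 eqxx.
- rewrite mu1 mu2 m_eig //; apply: contra nz => /eqP E.
  by rewrite /mu E sqrtr0.
- by move: nz; rewrite /mu sqrtr0 eqxx.
Qed.

(** Consecutive values of the Chebyshev recursion [m (k + 2) = d * m (k + 1) - m k], which for
    [d = D - 1] is the eigenvalue equation. For [d >= 2] the values do not decrease, hence stay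
    nonnegative. *)
Fixpoint cheb (d : R) (k : nat) : R * R :=
  if k is k'.+1 then let p := cheb d k' in (p.2, d * p.2 - p.1) else (0, 1).

Lemma perron_frobenius (D : R) :
  (exists n : nat, (3 <= n)%N /\ D = 2 * cos (pi / n%:R) + 1) \/ 3 <= D ->
  1 < D /\ exists sq : int -> R, [/\ sq 1 = 1, forall z, 0 <= sq z &
    forall z, sq z != 0 -> sq (z - 1) ^+ 2 + sq z ^+ 2 + sq (z + 1) ^+ 2 = D * sq z ^+ 2].
Proof.
case=> [[n [n3 DE]]|D3]; last first.
  split; first lra.
  apply: (@sqrt_weight D (fun k => (cheb (D - 1) k).1)) => //.
    move=> k; suff /andP[] : 0 <= (cheb (D - 1) k).1 <= (cheb (D - 1) k).2 by [].
    by elim: k => [|k /andP[H1 H2]] /=; [rewrite lexx ler01|apply/andP; split; nra].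
  by move=> k _ /=; ring.
have n_gt0 : 0 < n%:R :> R by rewrite ltr0n; lia.
have pi0 := pi_gt0 R.
set x := pi / n%:R in DE.
have x_gt0 : 0 < x by rewrite divr_gt0.
have nx : n%:R * x = pi by rewrite /x mulrC divfK // gt_eqF.
have n3R : 3 <= n%:R :> R by rewrite ler_nat.
have x_lt : x < pi / 2 by rewrite /x ltr_pM2l // ltf_pV2 ?posrE //; lra.
have cx : 0 < cos x by apply: cos_gt0_pihalf; rewrite x_lt andbT; lra.
have sx : 0 < sin x by apply: sin_gt0_pihalf; rewrite x_lt andbT; lra.
split; first by lra.
pose m k := if (k <= n)%N then sin (k%:R * x) / sin x else 0.
apply: (@sqrt_weight D m).
- by rewrite /m mul0r sin0 mul0r.
- by rewrite /m mul1r divff ?gt_eqF // ifT //; lia.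
- move=> k; rewrite /m; case: ifP => // kn; apply: divr_ge0; last exact: ltW.
  apply: sin_ge0_pi; apply/andP; split; first by rewrite mulr_ge0 ?ler0n // ltW.
  by rewrite -nx ler_pM2r // ler_nat.
move=> k; rewrite /m; have [lt_kn|] := ltnP k n; last by rewrite eqxx.
have [->|ne_kn] := eqVneq k.+1 n; first by rewrite nx sinpi mul0r eqxx.
have -> : (k.+2 <= n)%N by lia.
rewrite ltnW // => _.
have -> : k%:R * x = k.+1%:R * x - x by rewrite -addn1 natrD; ring.
have -> : k.+2%:R * x = k.+1%:R * x + x by rewrite -(addn1 k.+1) natrD; ring.
by rewrite sinB sinD DE; field; rewrite gt_eqF.
Qed.

End PerronFrobenius.

Local Open Scope complex_scope.

Section WeightExt.
Variables (R : realType) (sq : int -> R).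

Lemma eq_hgt (a b : nat -> int) n : (forall i, (i < n)%N -> a i = b i) ->
  forall k, (k <= n)%N -> hgt a k = hgt b k.
Proof.
by move=> ab k kn; congr (1 + _); apply: eq_bigr => i _; apply: ab; apply: leq_trans (ltn_ord i) kn.
Qed.

Lemma eq_valid_walk n a b : (forall i, (i < n)%N -> a i = b i) ->
  valid_walk sq n a = valid_walk sq n b.
Proof.
move=> ab; congr andb; apply: eq_forallb => i; first by rewrite ab.
by rewrite (eq_hgt ab) // -ltnS.
Qed.

Lemma eq_weight n (d : point n -> point n) a b a' b' :
  (forall i, (i < n)%N -> a i = a' i) -> (forall i, (i < n)%N -> b i = b' i) ->
  weight sq d a b = weight sq d a' b'.
Proof.
move=> aa bb; rewrite /weight (eq_valid_walk aa) (eq_valid_walk bb); congr (_%:R * _).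
  congr nat_of_bool; congr andb; apply: eq_forallb => p.
  by rewrite /bdry; case: (d p) => [[] i]; case: p => [[] j]; rewrite /= ?aa ?bb.
apply: eq_bigr => [[[] i] _]; rewrite /gap /=.
  by rewrite !(eq_hgt aa) // ltnW.
by rewrite !(eq_hgt bb) // ltnW.
Qed.

End WeightExt.

(** * The action of diagrams on functions of step sequences *)

Section Model.
Variables (R : realType) (D : R) (sq : int -> R).
Hypotheses (D_gt1 : 1 < D) (sq1 : sq 1 = 1) (sq_ge0 : forall z, 0 <= sq z).
Hypothesis sq_eigen : forall z, sq z != 0 ->
  sq (z - 1) ^+ 2 + sq z ^+ 2 + sq (z + 1) ^+ 2 = D * sq z ^+ 2.

Implicit Types a b : nat -> int.

Let realM (r s : R) : r%:C * s%:C = (r * s)%:C :> R[i].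
Proof. by rewrite (rmorphM (real_complex R)). Qed.

Let realJ (r : R) : ((r%:C)%C^*)%R = r%:C :> R[i].
Proof. by rewrite -[LHS]/(conjc r%:C) conjc_real. Qed.

Let realX (r : R) k : r%:C ^+ k = (r ^+ k)%:C :> R[i].
Proof. by rewrite (rmorphXn (real_complex R)). Qed.

Definition wv n (x : motz R n) a b : R[i] := \sum_(d : mdiag n) x d * (weight sq d a b)%:C.

Lemma wv_linear n (c : R[i]) (x y : motz R n) a b :
  wv (c *: x + y) a b = c * wv x a b + wv y a b.
Proof.
rewrite /wv mulr_sumr -big_split; apply: eq_bigr => d _ /=.
by rewrite !ffunE mulrDl mulrA.
Qed.

Lemma wv0 n a b : wv (0 : motz R n) a b = 0.
Proof. by rewrite /wv big1 // => d _; rewrite ffunE mul0r. Qed.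

Lemma wvD n (x y : motz R n) a b : wv (x + y) a b = wv x a b + wv y a b.
Proof. by rewrite -{1}[x]scale1r wv_linear mul1r. Qed.

Lemma wvZ n (c : R[i]) (x : motz R n) a b : wv (c *: x) a b = c * wv x a b.
Proof. by rewrite -[c *: x]addr0 wv_linear wv0 addr0. Qed.

Lemma wvB n (x y : motz R n) a b : wv (x - y) a b = wv x a b - wv y a b.
Proof. by rewrite -scaleN1r addrC wv_linear mulN1r addrC. Qed.

Lemma wv_sum n (I : finType) (F : I -> motz R n) a b :
  wv (\sum_i F i) a b = \sum_i wv (F i) a b.
Proof. exact: (big_morph (fun x => wv x a b) (fun x y => wvD x y a b) (wv0 n a b)). Qed.

Lemma wv_basis n (d : {ffun point n -> point n}) a b : motzkin d ->
  wv (mbasis R d) a b = (weight sq d a b)%:C.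
Proof.
move=> dm; exact: (@sum_mbasis R n R[i]^o (Mdiag dm) (fun c => (weight sq c a b)%:C)).
Qed.

Lemma eq_wv n (x : motz R n) a b a' b' :
  (forall i, (i < n)%N -> a i = a' i) -> (forall i, (i < n)%N -> b i = b' i) ->
  wv x a b = wv x a' b'.
Proof. by move=> aa bb; apply: eq_bigr => d _; rewrite (eq_weight _ _ aa bb). Qed.

Lemma wv_mmul n (x y : motz R n) a c :
  wv (mmul D x y) a c = \sum_(b : walk n) wv x a (stepn b) * wv y (stepn b) c.
Proof.
rewrite /mmul wv_sum.
under eq_bigr => d _ do rewrite wv_sum.
under [RHS]eq_bigr => b _ do rewrite /wv mulr_suml.
rewrite [RHS]exchange_big /=; apply: eq_bigr => d _.
under [RHS]eq_bigr => b _ do rewrite mulr_sumr.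
rewrite [RHS]exchange_big /=; apply: eq_bigr => e _.
have [E m] := stack_weight sq1 sq_ge0 sq_eigen d e a c.
rewrite wvZ wv_basis // realX -[LHS]mulrA realM -E rmorph_sum mulr_sumr.
by apply: eq_bigr => b _; rewrite /= -realM mulrACA.
Qed.

Lemma wv_mstar n (x : motz R n) a b : wv (mstar x) b a = ((wv x a b)^*)%R.
Proof.
rewrite /mstar wv_sum /wv rmorph_sum /=; apply: eq_bigr => d _.
rewrite -/(wv _ b a) wvZ wv_basis ?mreflect_motzkin ?matchingP // weight_mreflect.
by rewrite -[(_)%:C in LHS]realJ; apply/esym/(rmorphM Num.conj).
Qed.

Definition tails n m a b : bool :=
  [forall i : 'I_m, (n <= i)%N ==> (a i == b i)] && valid_walk sq m a.

Lemma wv_mwiden n m (x : motz R n) a b : (n <= m)%N ->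
  wv (mwiden m x) a b = (tails n m a b)%:R * wv x a b.
Proof.
move=> nm; rewrite /mwiden wv_sum [in RHS]/wv mulr_sumr; apply: eq_bigr => d _.
rewrite wvZ wv_basis ?pad_motzkin ?matchingP // weight_pad //; last exact: mdiagK.
by rewrite -realM rmorph_nat mulrCA.
Qed.

Lemma wv_valid n (x : motz R n) a b : wv x a b != 0 ->
  [/\ valid_walk sq n a, valid_walk sq n b & hgt a n = hgt b n].
Proof.
move=> nz; have [d nzd] : exists d : mdiag n, weight sq d a b != 0.
  apply/existsP; apply: contraNT nz; rewrite negb_exists => /forallP z.
  by rewrite /wv big1 // => d _; have := z d; rewrite negbK => /eqP ->; rewrite mulr0.
have [anti va vb] := weight_valid nzd; split=> //.
exact: sum_bdry_antisym (mdiagK d) anti.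
Qed.

Definition mass n (b : walk n) : R := sq (hgt (stepn b) n) ^+ 2.

Lemma mass_ge0 n (b : walk n) : 0 <= (mass b)%:C.
Proof. by rewrite lecR sqr_ge0. Qed.

Let D_neq0 : D%:C != 0 :> R[i].
Proof. by rewrite fmorph_eq0 gt_eqF // (lt_trans _ D_gt1). Qed.

Lemma mtr_wv n (x : motz R n) :
  mtr D x = D%:C ^- n * \sum_(b : walk n) wv x (stepn b) (stepn b) * (mass b)%:C.
Proof.
rewrite /mtr; under [in RHS]eq_bigr => b _ do rewrite /wv mulr_suml.
rewrite [in RHS]exchange_big mulr_sumr; apply: eq_bigr => d _ /=.
rewrite expfzDr // -exprnN -exprnP.
transitivity (x d * (D%:C ^+ closure_loops d) * D%:C ^- n); first by rewrite mulrA.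
rewrite [RHS]mulrC; congr (_ * _).
rewrite realX -(closure_weight sq1 sq_ge0 sq_eigen d) rmorph_sum mulr_sumr /=.
by apply: eq_bigr => b _; rewrite -realM mulrA.
Qed.

Lemma mtr_mmul n (x y : motz R n) : mtr D (mmul D x y) =
  D%:C ^- n * \sum_(b : walk n) \sum_(c : walk n)
    wv x (stepn b) (stepn c) * wv y (stepn c) (stepn b) * (mass b)%:C.
Proof.
by rewrite mtr_wv; congr (_ * _); apply: eq_bigr => b _; rewrite wv_mmul mulr_suml.
Qed.

(** A nonzero entry relates walks with the same end height, and [mass] depends on nothing else. *)
Lemma mtr_mmulC n (x y : motz R n) : mtr D (mmul D x y) = mtr D (mmul D y x).
Proof.
rewrite !mtr_mmul exchange_big; congr (_ * _); apply: eq_bigr => b _; apply: eq_bigr => c _.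
have [->|/wv_valid[_ _ E]] := eqVneq (wv x (stepn c) (stepn b)) 0; first by rewrite mulr0 !mul0r.
by rewrite /mass E; congr (_ * _); rewrite mulrC.
Qed.

Lemma mtr_star n (x : motz R n) : mtr D (mmul D (mstar x) x) =
  D%:C ^- n * \sum_(b : walk n) \sum_(c : walk n)
    `|wv x (stepn c) (stepn b)| ^+ 2 * (mass b)%:C.
Proof.
rewrite mtr_mmul; congr (_ * _); apply: eq_bigr => b _; apply: eq_bigr => c _.
by rewrite wv_mstar [((_)^*)%R * _]mulrC -normCK.
Qed.

Lemma DVn_gt0 n : 0 < D%:C ^- n :> R[i].
Proof. by rewrite invr_gt0 exprn_gt0 // ltcR (lt_trans _ D_gt1). Qed.

Lemma mtr_star_ge0 n (x : motz R n) : 0 <= mtr D (mmul D (mstar x) x).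
Proof.
rewrite mtr_star; apply: mulr_ge0; first exact: ltW (DVn_gt0 n).
by apply: sumr_ge0 => b _; apply: sumr_ge0 => c _; rewrite mulr_ge0 ?mass_ge0 ?exprn_ge0.
Qed.

Lemma mtr_star_eq0 n (x : motz R n) : mtr D (mmul D (mstar x) x) = 0 ->
  forall b c : walk n, wv x (stepn b) (stepn c) = 0.
Proof.
rewrite mtr_star => /eqP; rewrite mulf_eq0 (gt_eqF (DVn_gt0 n)) /=.
have ge0 (b c : walk n) : 0 <= `|wv x (stepn c) (stepn b)| ^+ 2 * (mass b)%:C.
  by rewrite mulr_ge0 ?mass_ge0 ?exprn_ge0.
rewrite psumr_eq0 => [/allP H b c|b _]; last exact: sumr_ge0.
have := H c (mem_index_enum _); rewrite psumr_eq0 => [/allP/(_ b (mem_index_enum _))|//].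
rewrite mulf_eq0 expf_eq0 normr_eq0 /= => /orP[/eqP//|].
have [->//|/wv_valid[_ vc _]] := eqVneq (wv x (stepn b) (stepn c)) 0.
rewrite fmorph_eq0 /mass expf_eq0 /=.
by rewrite (negbTE (valid_walk_neq0 vc _)).
Qed.

(** For [x] in the radical, [tr (x^* x)] is 0; it is a sum of squared absolute values of entries,
    with masses that are positive on valid walks. *)
Lemma mradP n (x : motz R n) :
  x \in @mrad R D n <-> forall b c : walk n, wv x (stepn b) (stepn c) = 0.
Proof.
split=> [/asboolP H|z].
  by apply: mtr_star_eq0; rewrite mtr_mmulC; apply: H.
apply/asboolP => y; rewrite mtr_mmul big1 ?mulr0 // => b _; rewrite big1 // => c _.
by rewrite z !mul0r.
Qed.

Notation state := (nat -> 'I_3).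
Notation wave := ((nat -> 'I_3) -> R[i]).

Definition steps (al : state) (i : nat) : int := step (al i).

Definition splice n (b : walk n) (al : state) : state :=
  fun i => if insub i is Some j then b j else al i.

Definition legal (al : state) : bool := `[< forall m, valid_walk sq m (steps al) >].

Definition prefix n (al : state) : walk n := [ffun i : 'I_n => al i].

Lemma splice_lt n (b : walk n) al i (lt_in : (i < n)%N) : splice b al i = b (Ordinal lt_in).
Proof. by rewrite /splice insubT. Qed.

Lemma splice_ge n (b : walk n) al i : (n <= i)%N -> splice b al i = al i.
Proof. by move=> ni; rewrite /splice insubF // ltnNge ni. Qed.

Lemma steps_splice n (b : walk n) al i : steps (splice b al) i =
  if (i < n)%N then stepn b i else steps al i.
Proof.
rewrite /steps; case: ltnP => [lt_in|ni]; last by rewrite splice_ge.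
by rewrite splice_lt -(stepn_ord b (Ordinal lt_in)).
Qed.

Lemma splice_splice n (b c : walk n) al : splice b (splice c al) = splice b al.
Proof.
apply/funext => i; have [lt_in|ni] := ltnP i n; first by rewrite !splice_lt.
by rewrite !splice_ge.
Qed.

Lemma prefix_steps n al i : (i < n)%N -> stepn (prefix n al) i = steps al i.
Proof.
by move=> lt_in; rewrite (stepn_ord _ (Ordinal lt_in)) ffunE.
Qed.

Lemma prefix_splice n (b : walk n) al : prefix n (splice b al) = b.
Proof.
apply/ffunP => i; rewrite ffunE (splice_lt _ _ (ltn_ord i)).
by congr (b _); apply: val_inj.
Qed.

Lemma step_inj : injective step.
Proof. by move=> s t /addIr [/val_inj]. Qed.

Lemma valid_walk_glue n m a b : (n <= m)%N -> hgt a n = hgt b n ->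
  (forall i, (n <= i < m)%N -> a i = b i) -> valid_walk sq n b ->
  valid_walk sq m a -> valid_walk sq m b.
Proof.
move=> nm ab tl /andP[/forallP sb /forallP vb] /andP[/forallP sa /forallP va].
have hE k : (n <= k <= m)%N -> hgt b k = hgt a k.
  case/andP; elim: k => [|k IH]; first by rewrite leqn0 => /eqP n0 _; rewrite -n0.
  rewrite leq_eqVlt => /orP[/eqP<- //|]; rewrite ltnS => nk km.
  by rewrite !hgtS IH ?tl ?nk // ltnW.
apply/andP; split; apply/forallP => i.
  have [ni|ltin] := leqP n i; last by have := sb (Ordinal ltin).
  by rewrite -tl ?ni ?ltn_ord //; apply: sa.
have [ni|ltin] := leqP n i; last by have := vb (Ordinal (ltnW ltin : i < n.+1)%N).
by rewrite hE ?ni /= -1?ltnS //; apply: va.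
Qed.

Lemma legal_splice n (x : motz R n) al (b : walk n) :
  legal al -> wv x (steps al) (stepn b) != 0 -> legal (splice b al).
Proof.
move=> /asboolP leg /wv_valid[va vb ab]; apply/asboolP => m.
have bE i : (i < n)%N -> stepn b i = steps (splice b al) i.
  by move=> lt_in; rewrite steps_splice lt_in.
have vb' : valid_walk sq n (steps (splice b al)) by rewrite -(eq_valid_walk sq bE).
have [nm|/ltnW mn] := leqP n m; last exact: valid_walk_le vb'.
apply: (valid_walk_glue nm _ _ vb' (leg m)); first by rewrite ab (eq_hgt bE).
by move=> i /andP[ni _]; rewrite steps_splice ltnNge ni.
Qed.

(** The factor [legal] cuts down to admissible states, so the unit acts as a projection and not as
    the identity. *)
Definition wave_op n (x : motz R n) (F : wave) : wave := fun al =>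
  (legal al)%:R * \sum_(b : walk n) wv x (steps al) (stepn b) * F (splice b al).

Local Notation Op := wave_op.

Lemma Op_linear n (c : R[i]) (x y : motz R n) F al :
  Op (c *: x + y) F al = c * Op x F al + Op y F al.
Proof.
rewrite /wave_op mulrCA -mulrDr; congr (_ * _); rewrite mulr_sumr -big_split; apply: eq_bigr => b _ /=.
by rewrite wv_linear mulrDl mulrA.
Qed.

Lemma Op_wave_linear n (c : R[i]) (x : motz R n) (F G : wave) al :
  Op x (fun be => c * F be + G be) al = c * Op x F al + Op x G al.
Proof.
rewrite /wave_op mulrCA -mulrDr; congr (_ * _); rewrite mulr_sumr -big_split; apply: eq_bigr => b _ /=.
by rewrite mulrDr mulrCA.
Qed.

Lemma Op_mmul n (x y : motz R n) : Op (mmul D x y) = Op x \o Op y.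
Proof.
apply/funext => F; apply/funext => al; rewrite /wave_op /=.
have [leg|_] := boolP (legal al); last by rewrite !mul0r.
rewrite !mul1r; under eq_bigr => c _ do rewrite wv_mmul mulr_suml.
rewrite exchange_big; apply: eq_bigr => b _ /=.
have [->|nz] := eqVneq (wv x (steps al) (stepn b)) 0.
  by rewrite mul0r big1 // => c _; rewrite !mul0r.
rewrite (legal_splice leg nz) mul1r mulr_sumr; apply: eq_bigr => c _.
rewrite splice_splice -mulrA (@eq_wv n y (stepn b) (stepn c) (steps (splice b al)) (stepn c)) //.
by move=> i lt_in; rewrite steps_splice lt_in.
Qed.

(** A walk of length [m] contributes only if it continues as [al] does from [n] on, so the sum runs
    over its first [n] steps. *)
Lemma Op_mwiden n m (x : motz R n) : (n <= m)%N -> Op (mwiden m x) = Op x.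
Proof.
move=> nm; apply/funext => F; apply/funext => al; rewrite /wave_op.
have [/asboolP leg|_] := boolP (legal al); last by rewrite !mul0r.
congr (_ * _).
pose P (b : walk m) := [forall i : 'I_m, (n <= i)%N ==> (steps al i == stepn b i)].
rewrite (bigID P) /= [X in _ + X]big1 ?addr0; last first.
  by move=> b /negbTE nP; rewrite wv_mwiden // /tails -/(P b) nP !mul0r.
pose h (c : walk n) : walk m := prefix m (splice c al).
have hE c i : (i < m)%N -> stepn (h c) i = steps (splice c al) i by exact: prefix_steps.
rewrite (reindex_onto h (fun b : walk m => prefix n (splice b al))) /=; last first.
  move=> b /forallP Pb; apply/ffunP => i; rewrite ffunE.
  have [lt_in|ni] := ltnP i n.
    rewrite splice_lt ffunE /= (splice_lt _ _ (ltn_ord i)).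
    by congr (b _); apply: val_inj.
  rewrite splice_ge //; have := Pb i; rewrite ni /= stepn_ord => /eqP.
  exact: step_inj.
apply: eq_big => [c|c /andP[Ph _]].
  have -> : P (h c).
    apply/forallP => i; apply/implyP => ni; rewrite hE //.
    by rewrite steps_splice ltnNge ni.
  rewrite (_ : prefix n _ = c) ?eqxx //; apply/ffunP => i; rewrite ffunE.
  have im : (i < m)%N by apply: leq_trans (ltn_ord i) nm.
  rewrite splice_lt ffunE /= (splice_lt _ _ (ltn_ord i)).
  by congr (c _); apply: val_inj.
rewrite wv_mwiden // /tails -/(P (h c)) Ph leg mul1r; congr (_ * F _).
  apply: eq_wv => // i lt_in; rewrite hE ?steps_splice ?lt_in //.
  exact: leq_trans lt_in nm.
apply/funext => i; have [lt_im|mi] := ltnP i m; first by rewrite splice_lt ffunE.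
by rewrite !splice_ge // (leq_trans nm).
Qed.

(** A flat continuation keeps the height and thus extends every valid walk to a legal state;
    [Op_eq0P] tests operators on such states. *)
Definition rest : state := fun=> inord 1.

Lemma steps_rest i : steps rest i = 0.
Proof. by rewrite /steps /rest /step inordK. Qed.

Lemma legal_splice_rest n (b : walk n) : valid_walk sq n (stepn b) -> legal (splice b rest).
Proof.
move=> vb; apply/asboolP => m.
have bE i : (i < n)%N -> stepn b i = steps (splice b rest) i.
  by move=> lt_in; rewrite steps_splice lt_in.
have vb' : valid_walk sq n (steps (splice b rest)) by rewrite -(eq_valid_walk sq bE).
have [nm|/ltnW mn] := leqP n m; last exact: valid_walk_le vb'.
have tl i : (n <= i)%N -> steps (splice b rest) i = 0.
  by move=> ni; rewrite steps_splice ltnNge ni steps_rest.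
have hE k : (n <= k)%N -> hgt (steps (splice b rest)) k = hgt (steps (splice b rest)) n.
  move: (steps (splice b rest)) tl => w tl.
  elim: k => [|k IH]; first by rewrite leqn0 => /eqP->.
  by rewrite leq_eqVlt => /orP[/eqP<- //|nk]; rewrite hgtS IH // tl // addr0.
move/andP: vb' => [/forallP sb /forallP vb']; apply/andP; split; apply/forallP => i.
  have [lt_in|ni] := ltnP i n; first by have := sb (Ordinal lt_in).
  by rewrite tl.
have [lt_in|/ltnW ni] := ltnP i n.+1; first by have := vb' (Ordinal lt_in).
by rewrite hE //; have := vb' ord_max.
Qed.

Lemma Op_eq0P n (x : motz R n) :
  (forall b c : walk n, wv x (stepn b) (stepn c) = 0) <-> (forall F al, Op x F al = 0).
Proof.
split=> [z F al|z b c].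
  rewrite /wave_op big1 ?mulr0 // => c _.
  rewrite (@eq_wv n x (steps al) (stepn c) (stepn (prefix n al)) (stepn c)) ?z ?mul0r //.
  by move=> i lt_in; rewrite prefix_steps.
have [->//|/[dup] nz /wv_valid[vb _ _]] := eqVneq (wv x (stepn b) (stepn c)) 0.
have := z (fun al => (al == splice c rest)%:R) (splice b rest).
rewrite /wave_op legal_splice_rest // mul1r (bigD1 c) //= big1 => [|d dc].
  rewrite splice_splice eqxx mulr1 addr0 => <-; apply: eq_wv => // i lt_in.
  by rewrite steps_splice lt_in.
rewrite splice_splice (_ : _ == _ = false) ?mulr0 //; apply: contraNF dc => /eqP E.
by rewrite -(prefix_splice d rest) E prefix_splice.
Qed.

End Model.

(** A crude Cauchy-Schwarz inequality: the 2 comes from [r i * r j <= r i ^+ 2 + r j ^+ 2]. *)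
Lemma sqr_sum_le (C : numDomainType) (I : finType) (P : pred I) (r : I -> C) :
  (forall i, 0 <= r i) -> (\sum_(i | P i) r i) ^+ 2 <= (#|P| * 2)%:R * \sum_(i | P i) r i ^+ 2.
Proof.
move=> r0; rewrite expr2 mulr_suml.
apply: (@le_trans _ _ (\sum_(i | P i) \sum_(j | P j) (r i ^+ 2 + r j ^+ 2))).
  apply: ler_sum => i _; rewrite mulr_sumr; apply: ler_sum => j _.
  have /orP[ij|ji] := real_leVge (ger0_real (r0 i)) (ger0_real (r0 j)).
    by apply: (@le_trans _ _ (r j ^+ 2)); rewrite ?lerDr ?exprn_ge0 // expr2 ler_wpM2r.
  by apply: (@le_trans _ _ (r i ^+ 2)); rewrite ?lerDl ?exprn_ge0 // expr2 ler_wpM2l.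
under eq_bigr => i _ do rewrite big_split sumr_const /=.
by rewrite big_split sumr_const /= sumrMnl mulr_natl mulrnA mulr2n.
Qed.

(** * Trace, star and boundedness across the levels *)

Section Model.
Variables (R : realType) (D : R) (sq : int -> R).
Hypotheses (D_gt1 : 1 < D) (sq1 : sq 1 = 1) (sq_ge0 : forall z, 0 <= sq z).
Hypothesis sq_eigen : forall z, sq z != 0 ->
  sq (z - 1) ^+ 2 + sq z ^+ 2 + sq (z + 1) ^+ 2 = D * sq z ^+ 2.

Local Notation wv := (wv sq).
Local Notation Op := (wave_op sq).

Lemma eq_Op n (x y : motz R n) :
  (forall a b : nat -> int, wv x a b = wv y a b) -> Op x = Op y.
Proof.
move=> xy; apply/funext => F; apply/funext => al; rewrite /wave_op; congr (_ * _).
by apply: eq_bigr => b _; rewrite xy.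
Qed.

(** Summing the mass over the new last step gives [D] times the old mass by [sq_eigen]; this offsets
    the additional [D^-1] of the normalisation. *)
Lemma mtr_mwiden1 n (x : motz R n) : mtr D (mwiden n.+1 x) = mtr D x.
Proof.
have D0 : D != 0 by rewrite gt_eqF // (lt_trans _ D_gt1).
rewrite !(mtr_wv D_gt1 sq1 sq_ge0 sq_eigen) sum_walk_recr.
rewrite (eq_bigr (fun b : walk n => D%:C * (wv x (stepn b) (stepn b) * (mass sq b)%:C))); last first.
  move=> b _; have bE s i : (i < n)%N -> stepn (rcons_walk (b, s)) i = stepn b i.
    by move=> lt_in; rewrite stepn_rcons ltn_eqF.
  have wE s : wv x (stepn (rcons_walk (b, s))) (stepn (rcons_walk (b, s))) = wv x (stepn b) (stepn b).
    by apply: eq_wv => i /(bE s).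
  have [z|/[dup] nz /wv_valid[vb _ _]] := eqVneq (wv x (stepn b) (stepn b)) 0.
    by rewrite z mul0r mulr0 big1 // => s _; rewrite wv_mwiden // wE z mulr0 mul0r.
  have hn := valid_walk_neq0 vb (leqnn n).
  have hE s : hgt (stepn (rcons_walk (b, s))) n.+1 = hgt (stepn b) n + step s.
    by rewrite hgtS stepn_rcons eqxx (eq_hgt (bE s)).
  have vE s : valid_walk sq n.+1 (stepn (rcons_walk (b, s))) = (sq (hgt (stepn b) n + step s) != 0).
    apply/idP/idP => [v|nzs]; first by rewrite -hE (valid_walk_neq0 v).
    move/andP: vb => [/forallP sb /forallP vb]; apply/andP; split; apply/forallP => i.
      rewrite stepn_rcons; have [_|ni] := eqVneq (i : nat) n; first exact: small_step.
      have lt_in : (i < n)%N by have := ltn_ord i; lia.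
      exact: (sb (Ordinal lt_in)).
    have [->|ni] := eqVneq (i : nat) n.+1; first by rewrite hE.
    have lt_in : (i < n.+1)%N by have := ltn_ord i; lia.
    by rewrite (eq_hgt (bE s)) //; apply: (vb (Ordinal lt_in)).
  rewrite (eq_bigr (fun s => wv x (stepn b) (stepn b) * (sq (hgt (stepn b) n + step s) ^+ 2)%:C)); last first.
    move=> s _; rewrite wv_mwiden // wE /tails vE /mass hE (_ : [forall i, _] = true); last first.
      by apply/forallP => i; rewrite eqxx implybT.
    by case: eqP => [->|_]; rewrite /= ?mul1r // expr0n !mul0r mulr0.
  rewrite -mulr_sumr mulrCA; congr (_ * _).
  rewrite -(rmorph_sum (real_complex R)) -(rmorphM (real_complex R)) /=; congr (_%:C).
  by rewrite (sum_step (fun z => sq (hgt (stepn b) n + z) ^+ 2)) addr0 sq_eigen.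
rewrite -mulr_sumr mulrA; congr (_ * _); rewrite exprSr invfM divfK //.
by rewrite (fmorph_eq0 (real_complex R)).
Qed.

Lemma mtr_mwiden n m (x : motz R n) : (n <= m)%N -> mtr D (mwiden m x) = mtr D x.
Proof.
move=> nm; rewrite -(subnK nm); elim: (m - n)%N => [|k IH]; last first.
  by rewrite addSn -[RHS]IH -[RHS]mtr_mwiden1 mwiden_mwiden ?leq_addl.
rewrite add0n !(mtr_wv D_gt1 sq1 sq_ge0 sq_eigen); congr (_ * _); apply: eq_bigr => b _.
rewrite wv_mwiden // /tails (_ : [forall i, _] = true) /=; last first.
  by apply/forallP => i; rewrite eqxx implybT.
have [->|/wv_valid[-> _ _]] := eqVneq (wv x (stepn b) (stepn b)) 0; last by rewrite mul1r.
by rewrite !mulr0.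
Qed.

Lemma Op_diff n (x y : motz R n) : Op x = Op y -> forall F al, Op (x - y) F al = 0.
Proof.
move=> xy F al; rewrite addrC -scaleN1r Op_linear xy.
by rewrite mulN1r addNr.
Qed.

Lemma mtr_Op_eq n (x y : motz R n) : Op x = Op y -> mtr D x = mtr D y.
Proof.
move=> /Op_diff/(Op_eq0P sq) z; rewrite !(mtr_wv D_gt1 sq1 sq_ge0 sq_eigen); congr (_ * _).
apply: eq_bigr => b _; have := z b b; rewrite wvB => /eqP; rewrite subr_eq0 => /eqP ->.
by [].
Qed.

Lemma mtr_Op n m (x : motz R n) (y : motz R m) : Op x = Op y -> mtr D x = mtr D y.
Proof.
move=> xy; rewrite -(mtr_mwiden x (leq_maxl n m)) -(mtr_mwiden y (leq_maxr n m)).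
by apply: mtr_Op_eq; rewrite !Op_mwiden ?leq_maxl ?leq_maxr.
Qed.

Lemma mrad_Op n (x : motz R n) : x \in @mrad R D n <-> forall F al, Op x F al = 0.
Proof.
by rewrite (mradP D_gt1 sq1 sq_ge0 sq_eigen); apply: Op_eq0P.
Qed.

Lemma Op_mstar_mwiden n m (x : motz R n) : (n <= m)%N -> Op (mstar (mwiden m x)) = Op (mstar x).
Proof.
move=> nm; rewrite -(Op_mwiden sq (mstar x) nm); apply: eq_Op => a b.
rewrite wv_mstar wv_mwiden // [RHS]wv_mwiden // wv_mstar rmorphM rmorph_nat.
have [->|/wv_valid[vb va ba]] := eqVneq (wv x b a) 0; first by rewrite /= conjC0 !mulr0.
congr (_%:R * _); congr nat_of_bool; rewrite /tails.
have -> : [forall i : 'I_m, (n <= i)%N ==> (b i == a i)] =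
    [forall i : 'I_m, (n <= i)%N ==> (a i == b i)].
  by apply: eq_forallb => i; rewrite eq_sym.
case: forallP => //= tl.
have tl' i : (n <= i < m)%N -> a i = b i.
  by move=> /andP[ni im]; have := tl (Ordinal im); rewrite /= ni => /eqP.
apply/idP/idP => v; first by apply: (valid_walk_glue nm ba _ va v) => i /tl' ->.
exact: (valid_walk_glue nm (esym ba) tl' vb v).
Qed.

Lemma Op_mstar_eq0 n (x : motz R n) : (forall F al, Op x F al = 0) ->
  forall F al, Op (mstar x) F al = 0.
Proof.
move=> /(Op_eq0P sq) z; apply/(Op_eq0P sq) => b c.
by rewrite wv_mstar z conjC0.
Qed.

Lemma mstar_conj_linear n (c : R[i]) (x y : motz R n) a b :
  wv (mstar (c *: x + y)) a b = (c^*)%R * wv (mstar x) a b + wv (mstar y) a b.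
Proof. by rewrite !wv_mstar wv_linear rmorphD rmorphM. Qed.

(** The star of a class is computed on a representative; this makes its action independent of the
    representative and of the level. *)
Lemma Op_mstar n m (x : motz R n) (y : motz R m) : Op x = Op y -> Op (mstar x) = Op (mstar y).
Proof.
move=> xy; rewrite -(Op_mstar_mwiden x (leq_maxl n m)) -(Op_mstar_mwiden y (leq_maxr n m)).
move: (mwiden _ x) (mwiden _ y) (Op_mwiden sq x (leq_maxl n m)) (Op_mwiden sq y (leq_maxr n m)).
move=> x' y' xE yE; have /Op_diff/Op_mstar_eq0 z : Op x' = Op y' by rewrite xE yE.
apply/funext => F; apply/funext => al; have := z F al.
have -> : Op (mstar (x' - y')) = Op (mstar x' - mstar y').
  apply: eq_Op => a b; rewrite addrC -scaleN1r mstar_conj_linear rmorphN rmorph1.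
  by rewrite [RHS]wvB mulN1r addrC.
rewrite addrC -scaleN1r Op_linear mulN1r => /eqP.
by rewrite addrC subr_eq0 => /eqP.
Qed.

Lemma Op_mstarK n (x : motz R n) : Op (mstar (mstar x)) = Op x.
Proof. by apply: eq_Op => a b; rewrite !wv_mstar conjCK. Qed.

Lemma Op_mstar_mmul n (x y : motz R n) :
  Op (mstar (mmul D x y)) = Op (mstar y) \o Op (mstar x).
Proof.
rewrite -(Op_mmul sq1 sq_ge0 sq_eigen); apply: eq_Op => a b.
rewrite wv_mstar !(wv_mmul sq1 sq_ge0 sq_eigen) rmorph_sum; apply: eq_bigr => c _.
by rewrite !wv_mstar rmorphM mulrC.
Qed.

Lemma mtr_mstar n (x : motz R n) : mtr D (mstar x) = ((mtr D x)^*)%R.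
Proof.
have realJ (r : R) : ((r%:C)%C^*)%R = r%:C :> R[i] by rewrite -[LHS]/(conjc r%:C) conjc_real.
rewrite !(mtr_wv D_gt1 sq1 sq_ge0 sq_eigen) rmorphM fmorphV rmorphXn /= realJ; congr (_ * _).
by rewrite rmorph_sum; apply: eq_bigr => b _; rewrite wv_mstar [RHS]rmorphM /= realJ.
Qed.

Lemma wv_mone0 (a b : nat -> int) : wv (mone R 0) a b = 1.
Proof.
have vm : motzkin (vertical 0) by apply/motzkinP; split=> -[s []].
rewrite /mone wv_basis // /weight.
have v0 e : valid_walk sq 0 e.
  by apply/andP; split; apply/forallP => -[[]] // k; rewrite hgt0 sq1 oner_eq0.
rewrite !v0 (_ : antisym _ _ = true); last by apply/forallP => -[s []].
by rewrite big_pred0 ?mulr1 // => -[s []].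
Qed.

Lemma sum_walk0 (A : nmodType) (F : walk 0 -> A) : \sum_b F b = F [ffun i => 0].
Proof. by rewrite (big_pred1 [ffun i => 0]) // => b; apply/esym/eqP/ffunP => -[]. Qed.

Lemma mtr_mone : mtr D (mone R 0) = 1.
Proof.
rewrite (mtr_wv D_gt1 sq1 sq_ge0 sq_eigen) sum_walk0 wv_mone0 /mass hgt0 sq1.
by rewrite expr0 invr1 expr1n !mulr1.
Qed.

Lemma Op_mone F al : Op (mone R 0) F al = (legal sq al)%:R * F al.
Proof.
rewrite /wave_op sum_walk0 wv_mone0 mul1r; congr (_ * F _).
by apply/funext => i; rewrite splice_ge.
Qed.

Lemma Op_one_l n (x : motz R n) : Op (mone R 0) \o Op x = Op x.
Proof.
apply/funext => F; apply/funext => al /=; rewrite Op_mone /wave_op mulrA -natrM mulnb.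
by rewrite andbb.
Qed.

Lemma Op_one_r n (x : motz R n) : Op x \o Op (mone R 0) = Op x.
Proof.
apply/funext => F; apply/funext => al /=; rewrite /wave_op.
have [leg|_] := boolP (legal sq al); last by rewrite !mul0r.
congr (_ * _); apply: eq_bigr => b _; rewrite -/(Op _ _ _) Op_mone.
have [->|nz] := eqVneq (wv x (steps al) (stepn b)) 0; first by rewrite !mul0r.
by rewrite (legal_splice leg nz) mul1r.
Qed.

(** The point is a constant independent of [m]. Only walks that agree from [n] on interact under
    [mwiden m a], so each row and each column has at most [#|walk n|] nonzero entries, all bounded
    by [M]. *)
Lemma mmul_bounded n (a : motz R n) : exists2 c : R[i], 0 <= c &
  forall m (x z : motz R m), (n <= m)%N -> z = mmul D (mwiden m a) x ->
    mtr D (mmul D (mstar z) z) <= c * mtr D (mmul D (mstar x) x).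
Proof.
pose M : R[i] := \sum_(c : walk n) \sum_(e : walk n) `|wv a (stepn c) (stepn e)|.
have M0 : 0 <= M by apply: sumr_ge0 => c _; apply: sumr_ge0.
pose L : R[i] := (#|walk n|)%:R.
have L0 : 0 <= L by apply: ler0n.
(* [L * 2] is the price of [sqr_sum_le] on a row with at most [L] entries; the last [L] counts the
   rows in which a given column occurs. *)
exists (M ^+ 2 * (L * 2) * L); first by rewrite !mulr_ge0 ?exprn_ge0.
move=> m x z nm zE.
pose cl (c e : walk m) := [forall i : 'I_m, (n <= i)%N ==> (c i == e i)].
have clE c e : cl c e = [forall i : 'I_m, (n <= i)%N ==> (stepn c i == stepn e i)].
  by apply: eq_forallb => i; rewrite !stepn_ord (inj_eq step_inj).
have cl_sym c e : cl c e = cl e c by apply: eq_forallb => i; rewrite eq_sym.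
pose rs (c : walk m) : walk n := [ffun i => c (widen_ord nm i)].
have cardP c : (#|cl c| <= #|walk n|)%N.
  rewrite -(@card_in_image _ _ rs (cl c)) ?max_card // => e e' /forallP ce /forallP ce' /ffunP E.
  apply/ffunP => i; have [ni|lt_in] := leqP n i.
    by have := ce i; have := ce' i; rewrite ni /= => /eqP <- /eqP <-.
  have := E (Ordinal lt_in); rewrite !ffunE.
  by rewrite (_ : widen_ord _ _ = i) //; apply: val_inj.
have Mle (c e : walk m) : `|wv a (stepn c) (stepn e)| <= M.
  have rE (b : walk m) i : (i < n)%N -> stepn b i = stepn (rs b) i.
    move=> lt_in; rewrite (stepn_ord (rs b) (Ordinal lt_in)) ffunE.
    exact: (stepn_ord b (widen_ord nm (Ordinal lt_in))).
  rewrite (eq_wv sq a (rE c) (rE e)) /M (bigD1 (rs c)) //= (bigD1 (rs e)) //= -addrA lerDl.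
  by rewrite addr_ge0 ?sumr_ge0 // => c' _; apply: sumr_ge0.
rewrite [X in X <= _](mtr_star D_gt1 sq1 sq_ge0 sq_eigen z).
rewrite [X in _ <= _ * X](mtr_star D_gt1 sq1 sq_ge0 sq_eigen x) mulrCA ler_pM2l; last exact: (DVn_gt0 D_gt1).
rewrite mulr_sumr; apply: ler_sum => b _.
rewrite -!mulr_suml [X in _ <= X]mulrA; apply: ler_wpM2r; first exact: mass_ge0.
pose r (e : walk m) := `|wv x (stepn e) (stepn b)|.
pose Y : R[i] := \sum_(c : walk m) M ^+ 2 * (L * 2) * \sum_(e | cl c e) r e ^+ 2.
apply: (@le_trans _ _ Y); rewrite /Y.
  apply: ler_sum => c _.
  have le1 : `|wv z (stepn c) (stepn b)| <= M * \sum_(e | cl c e) r e.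
    rewrite zE (wv_mmul sq1 sq_ge0 sq_eigen) (bigID (cl c)) /= [X in _ + X]big1 ?addr0.
      apply: le_trans (ler_norm_sum _ _ _) _; rewrite mulr_sumr; apply: ler_sum => e _.
      rewrite normrM ler_wpM2r // wv_mwiden // normrM.
      by apply: le_trans (Mle c e); rewrite ler_piMl // normr_nat lern1 leq_b1.
    move=> e /negbTE ce; rewrite wv_mwiden // /tails -clE ce !mul0r //.
  have r0 e : 0 <= r e by apply: normr_ge0.
  pose y : R[i] := (M * \sum_(e | cl c e) r e) ^+ 2; apply: (@le_trans _ _ y); rewrite /y.
    by apply: lerXn2r => //; rewrite nnegrE ?normr_ge0 // mulr_ge0 // sumr_ge0.
  rewrite exprMn -mulrA ler_wpM2l ?exprn_ge0 //; apply: le_trans (sqr_sum_le _ r0) _.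
  rewrite ler_wpM2r ?sumr_ge0 // => [e _|]; first by rewrite exprn_ge0.
  by rewrite natrM ler_wpM2r // ler_nat cardP.
rewrite -mulr_sumr -[X in _ <= X]mulrA ler_wpM2l ?mulr_ge0 ?exprn_ge0 //.
rewrite (exchange_big_dep predT) //= mulr_sumr; apply: ler_sum => e _.
rewrite (eq_bigl (mem (cl e))) => [|i]; last by rewrite cl_sym.
by rewrite sumr_const -mulr_natl ler_wpM2r ?exprn_ge0 ?normr_ge0 // /L ler_nat cardP.
Qed.

End Model.

(** * Generators *)

Section Generators.
Variables (n i : nat).

Definition dot_diag : {ffun point n -> point n} :=
  [ffun p : point n => if p.2 == i :> nat then p else flip p].

(** A partial isometry [s] that moves the cut strand: as operators, [s^* s] is the dot at [i] and
    [s s^*] the dot at [i.+1]. *)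
Definition shift_diag : {ffun point n -> point n} :=
  [ffun p : point n => if p.2 == i :> nat then (if p.1 then (false, insubd p.2 i.+1) else p)
             else if p.2 == i.+1 :> nat then (if p.1 then p else (true, insubd p.2 i))
             else flip p].

(** The Temperley-Lieb generator. *)
Definition cup_cap_diag : {ffun point n -> point n} :=
  [ffun p : point n => if p.2 == i :> nat then (p.1, insubd p.2 i.+1)
             else if p.2 == i.+1 :> nat then (p.1, insubd p.2 i) else flip p].

Lemma dot_motzkin : motzkin dot_diag.
Proof.
apply/motzkinP; split=> [p|p q].
  case: p => [s j]; rewrite !ffunE /=; case E: (j == i :> nat); rewrite /= ?E //.
  by rewrite /flip /= negbK.
rewrite !ffunE; case: p => [s j]; case: q => [t k]; rewrite /flip /bpos /=.
have := ltn_ord j; have := ltn_ord k.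
by do 2?[case: eqP => ?]; case: s; case: t => /=; lia.
Qed.

Hypothesis lt_i : (i.+1 < n)%N.
Let lt_i' : (i < n)%N := ltnW lt_i.

Let val_i1 (j : 'I_n) : insubd j i.+1 = i.+1 :> nat.
Proof. by rewrite val_insubd lt_i. Qed.
Let val_i0 (j : 'I_n) : insubd j i = i :> nat.
Proof. by rewrite val_insubd lt_i'. Qed.

Lemma shift_motzkin : motzkin shift_diag.
Proof.
have neq1 : (i.+1 == i) = false by lia.
apply/motzkinP; split=> [[s j]|[s j] [t k]].
  rewrite !ffunE /=; case E: (j == i :> nat).
    case: s; rewrite /= ?val_i1 ?neq1 ?eqxx ?E //.
    by congr (_, _); apply: val_inj; rewrite /= val_i0 (eqP E).
  case E1: (j == i.+1 :> nat).
    case: s; rewrite /= ?val_i0 ?eqxx ?E ?E1 //.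
    by congr (_, _); apply: val_inj; rewrite /= val_i1 (eqP E1).
  by rewrite /= E E1 /flip /= negbK.
rewrite !ffunE /= /flip /bpos /=.
have := ltn_ord j; have := ltn_ord k; have := lt_i.
move: (val_i0 j) (val_i0 k) (val_i1 j) (val_i1 k).
by do 4?[case: eqP => ?]; case: s; case: t; rewrite /= ?val_i0 ?val_i1; lia.
Qed.

Lemma cup_cap_motzkin : motzkin cup_cap_diag.
Proof.
have neq1 : (i.+1 == i) = false by lia.
apply/motzkinP; split=> [[s j]|[s j] [t k]].
  rewrite !ffunE /=; case E: (j == i :> nat).
    rewrite /= val_i1 neq1 eqxx.
    by congr (_, _); apply: val_inj; rewrite /= val_i0 (eqP E).
  case E1: (j == i.+1 :> nat).
    rewrite /= val_i0 eqxx.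
    by congr (_, _); apply: val_inj; rewrite /= val_i1 (eqP E1).
  by rewrite /= E E1 /flip /= negbK.
rewrite !ffunE /= /flip /bpos /=.
have := ltn_ord j; have := ltn_ord k; have := lt_i.
move: (val_i0 j) (val_i0 k) (val_i1 j) (val_i1 k).
by do 4?[case: eqP => ?]; case: s; case: t; rewrite /= ?val_i0 ?val_i1; lia.
Qed.

End Generators.

Definition sw (i j : nat) : nat := if j == i then i.+1 else if j == i.+1 then i else j.

Lemma swK i : involutive (sw i).
Proof. by move=> j; rewrite /sw; do 4?case: eqP; lia. Qed.

Definition swap_state (i : nat) (al : nat -> 'I_3) : nat -> 'I_3 := fun j => al (sw i j).

Lemma swap_stateK i al : swap_state i (swap_state i al) = al.
Proof. by apply/funext => j; rewrite /swap_state swK. Qed.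

Lemma antisym_dot n i a b : (i < n)%N -> antisym (dot_diag n i) (@bdry n a b) =
  (a i == 0) && [forall j : 'I_n, a j == b j].
Proof.
move=> lt_in; apply/forallP/andP => [H|[/eqP ai /forallP ab] [s j]].
  have a0 : a i = 0.
    by have := H (true, Ordinal lt_in); rewrite ffunE /= eqxx /bdry /=; lia.
  split; first exact/eqP.
  apply/forallP => j; have := H (true, j); have := H (false, j); rewrite !ffunE /=.
  have [E|_] := eqVneq (j : nat) i; rewrite /bdry /=; last lia.
  by rewrite E a0; lia.
rewrite ffunE /=; have [E|_] := eqVneq (j : nat) i; rewrite /bdry /=.
  by have := ab j; rewrite E ai; case: s; lia.
by have := ab j; case: s => /=; lia.
Qed.

Lemma antisym_shift n i a b : (i.+1 < n)%N -> antisym (shift_diag n i) (@bdry n a b) =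
  (a i.+1 == 0) && [forall j : 'I_n, b j == a (sw i j)].
Proof.
move=> lt_in; have lt_in' := ltnW lt_in.
have v1 (j : 'I_n) : insubd j i.+1 = i.+1 :> nat by rewrite val_insubd lt_in.
have v0 (j : 'I_n) : insubd j i = i :> nat by rewrite val_insubd lt_in'.
have neq1 : (i.+1 == i) = false by lia.
apply/forallP/andP => [H|[/eqP ai /forallP ab] [s j]].
  have H1 := H (true, Ordinal lt_in'); have H2 := H (true, Ordinal lt_in).
  have H3 := H (false, Ordinal lt_in').
  move: H1 H2 H3; rewrite !ffunE /= !eqxx neq1 /bdry /= v1 => H1 H2 H3.
  have a1 : a i.+1 = 0 by lia.
  split; first exact/eqP.
  apply/forallP => j; have := H (true, j); rewrite ffunE /= /sw.
  have [->|ji] := eqVneq (j : nat) i; first by lia.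
  by have [->|ji1] := eqVneq (j : nat) i.+1; rewrite /bdry /=; lia.
have b1 := ab (Ordinal lt_in); have b0 := ab (Ordinal lt_in').
move: b0 b1; rewrite /sw /= !eqxx neq1 => /eqP b0 /eqP b1.
rewrite ffunE /=; have [E|ji] := eqVneq (j : nat) i.
  by case: s; rewrite /bdry /= ?v1 E ?b0 ?b1 ?ai; lia.
have [E|ji1] := eqVneq (j : nat) i.+1.
  by case: s; rewrite /bdry /= ?v0 E ?b0 ?b1 ?ai; lia.
have := ab j; rewrite /sw (negbTE ji) (negbTE ji1) => /eqP bj.
by case: s; rewrite /bdry /= bj; lia.
Qed.

(** * Action of the generators and their trace *)

Section GeneratorOps.
Variables (R : realType) (D : R) (sq : int -> R).
Hypotheses (D_gt1 : 1 < D) (sq1 : sq 1 = 1) (sq_ge0 : forall z, 0 <= sq z).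
Hypothesis sq_eigen : forall z, sq z != 0 ->
  sq (z - 1) ^+ 2 + sq z ^+ 2 + sq (z + 1) ^+ 2 = D * sq z ^+ 2.

Local Notation wv := (wv sq).
Local Notation Op := (wave_op sq).
Local Notation legal := (legal sq).
Local Notation state := (nat -> 'I_3).
Local Notation wave := ((nat -> 'I_3) -> R[i]).

Lemma legal_valid al n : legal al -> valid_walk sq n (steps al).
Proof. by move/asboolP. Qed.

Lemma weight_flat n (d : point n -> point n) a b : (forall p, ~~ same_side d p) ->
  weight sq d a b = [&& antisym d (@bdry n a b), valid_walk sq n a & valid_walk sq n b]%:R.
Proof. by move=> flat; rewrite /weight big_pred0 ?mulr1 // => p; apply/negbTE. Qed.

Lemma wv_flat n (d : {ffun point n -> point n}) a b : motzkin d ->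
  (forall p, ~~ same_side d p) ->
  wv (mbasis R d) a b =
  [&& antisym d (@bdry n a b), valid_walk sq n a & valid_walk sq n b]%:R.
Proof.
by move=> dm flat; rewrite wv_basis // weight_flat // (rmorph_nat (real_complex R)).
Qed.

(** Without arcs inside a side the entries are 0 and 1; if moreover the bottom walk is determined by
    the top one, the diagram acts by the substitution [phi], cut down to the states that satisfy
    [c]. *)
Lemma Op_flat n (x : motz R n) (phi : state -> state) (c : state -> bool) :
  (forall al (b : walk n), legal al -> wv x (steps al) (stepn b) =
     [&& c al, b == prefix n (phi al) & valid_walk sq n (stepn b)]%:R) ->
  (forall al, legal al -> c al -> legal (phi al)) ->
  (forall al i, (n <= i)%N -> phi al i = al i) ->
  forall F al, Op x F al = (legal al && c al)%:R * F (phi al).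
Proof.
move=> xE leg_phi phi_ge F al; rewrite /wave_op.
have [leg|_] := boolP (legal al); last by rewrite !mul0r.
rewrite mul1r (bigD1 (prefix n (phi al))) //= big1 => [|b /negbTE bE]; last first.
  by rewrite xE // bE andbF mul0r.
rewrite addr0 xE // eqxx /= (_ : splice _ al = phi al); last first.
  apply/funext => i; have [lt_in|ni] := ltnP i n; last by rewrite splice_ge // phi_ge.
  by rewrite splice_lt ffunE.
have [cal|_] := boolP (c al); last by rewrite mul0r.
rewrite (@eq_valid_walk R sq n _ (steps (phi al))) => [|i lt_in]; last by rewrite prefix_steps.
by rewrite (legal_valid _ (leg_phi _ leg cal)).
Qed.

Definition dotv i : motz R i.+1 := mbasis R (dot_diag i.+1 i).
Definition shiftv i : motz R i.+2 := mbasis R (shift_diag i.+2 i).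
Lemma forall_eq_prefix n (f : nat -> 'I_3) (b : walk n) :
  [forall j : 'I_n, step (f j) == stepn b j] = (b == prefix n f).
Proof.
apply/forallP/eqP => [H|-> j]; last by rewrite stepn_ord ffunE.
by apply/ffunP => j; have := H j; rewrite stepn_ord ffunE => /eqP/step_inj ->.
Qed.

Lemma dot_flat n i p : ~~ same_side (dot_diag n i) p.
Proof.
by rewrite /same_side ffunE; case: ifP => _; rewrite ?ltnn ?andbF //; case: p => [[] j].
Qed.

Lemma wv_dot n i a b : (i < n)%N -> wv (mbasis R (dot_diag n i)) a b =
  [&& a i == 0, [forall j : 'I_n, a j == b j] & valid_walk sq n b]%:R.
Proof.
move=> lt_in; rewrite wv_flat ?dot_motzkin //; last exact: dot_flat.
rewrite antisym_dot //; case: eqP => //= _; case: forallP => //= ab.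
rewrite (@eq_valid_walk R sq n a b) ?andbb // => j lt_jn.
exact/eqP/(ab (Ordinal lt_jn)).
Qed.

Lemma Op_dot_level n i F al : (i < n)%N ->
  Op (mbasis R (dot_diag n i)) F al = (legal al && (steps al i == 0))%:R * F al.
Proof.
move=> lt_in; apply: (@Op_flat _ _ id (fun al => steps al i == 0)) => // {}al b leg.
rewrite wv_dot // (_ : [forall j, _] = (b == prefix n al)) //.
exact: forall_eq_prefix.
Qed.

Lemma Op_dot i F al : Op (dotv i) F al = (legal al && (steps al i == 0))%:R * F al.
Proof. exact: Op_dot_level. Qed.

(** Exchanging a zero step with its neighbour changes a single height, and the new value is again a
    height of the old walk; hence legality survives. *)
Lemma hgt_swap i (a : nat -> int) k : a i.+1 = 0 \/ a i = 0 ->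
  hgt (fun j => a (sw i j)) k = if k == i.+1 then hgt a i + a i.+1 else hgt a k.
Proof.
move=> a0; have lt : forall k, (k <= i)%N -> hgt (fun j => a (sw i j)) k = hgt a k.
  move=> m mi; apply: (@eq_hgt _ _ m) => // j jm; rewrite /sw.
  by do 2?case: eqP => ?; lia.
have E1 : hgt (fun j => a (sw i j)) i.+1 = hgt a i + a i.+1.
  by rewrite hgtS lt // /sw eqxx.
case: eqP => [->//|/eqP ki]; have [kl|kg] := leqP k i; first exact: lt.
have {kg ki} : (i.+2 <= k)%N by lia.
elim: k => // k IH; rewrite leq_eqVlt => /orP[/eqP <-|ik].
  rewrite hgtS E1 /sw eqxx (_ : (i.+1 == i) = false); last lia.
  by rewrite !hgtS; lia.
by rewrite !hgtS IH // /sw; do 2?case: eqP => ?; lia.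
Qed.

Lemma legal_swap i al : legal al -> steps al i.+1 = 0 \/ steps al i = 0 ->
  legal (swap_state i al).
Proof.
move=> /asboolP leg a0; apply/asboolP => m.
have hE k : sq (hgt (steps (swap_state i al)) k) != 0.
  rewrite (hgt_swap k a0); case: ifP => _; last by rewrite (valid_walk_neq0 (leg k)).
  case: a0 => a0; first by rewrite a0 addr0 (valid_walk_neq0 (leg i)).
  by have := valid_walk_neq0 (leg i.+2) (leqnn _); rewrite !hgtS a0 addr0.
by apply/andP; split; apply/forallP => j //; apply: small_step.
Qed.

Lemma shift_flat n i p : (i.+1 < n)%N -> ~~ same_side (shift_diag n i) p.
Proof.
move=> lt_in; case: p => [s j]; rewrite /same_side ffunE /=.
have [E|_] := eqVneq (j : nat) i; first by case: s; rewrite /= ?ltnn.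
by have [E|_] := eqVneq (j : nat) i.+1; case: s; rewrite /= ?ltnn.
Qed.

Lemma wv_shift n i a b : (i.+1 < n)%N -> wv (mbasis R (shift_diag n i)) a b =
  [&& a i.+1 == 0, [forall j : 'I_n, b j == a (sw i j)], valid_walk sq n a
    & valid_walk sq n b]%:R.
Proof.
move=> lt_in; rewrite wv_flat ?shift_motzkin // => [|p]; last exact: shift_flat.
by rewrite antisym_shift // -andbA.
Qed.

Lemma Op_shift i F al :
  Op (shiftv i) F al = (legal al && (steps al i.+1 == 0))%:R * F (swap_state i al).
Proof.
apply: (@Op_flat _ _ (swap_state i) (fun al => steps al i.+1 == 0)) => [{}al b leg|{}al leg /eqP a1|{}al j ij].
- rewrite wv_shift // (legal_valid _ leg) /=; congr (_%:R); congr nat_of_bool.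
  congr [&& _, _ & _]; rewrite -(forall_eq_prefix (swap_state i al)).
  by apply: eq_forallb => j; rewrite eq_sym.
- by apply: legal_swap => //; left.
- by rewrite /swap_state /sw; do 2?[case: eqP => ?]; [lia|lia|].
Qed.

Lemma Op_shift_star i F al :
  Op (mstar (shiftv i)) F al = (legal al && (steps al i == 0))%:R * F (swap_state i al).
Proof.
apply: (@Op_flat _ _ (swap_state i) (fun al => steps al i == 0)) => [{}al b leg|{}al leg /eqP a1|{}al j ij].
- rewrite wv_mstar wv_shift // (legal_valid _ leg) andbT conjC_nat; congr (_%:R).
  congr nat_of_bool; rewrite -(forall_eq_prefix (swap_state i al)).
  have -> : [forall j : 'I_i.+2, steps al j == stepn b (sw i j)] =
      [forall j : 'I_i.+2, step (swap_state i al j) == stepn b j].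
    have sw_lt (j : 'I_i.+2) : (sw i j < i.+2)%N.
      by have := ltn_ord j; rewrite /sw; do 2?case: eqP => ?; lia.
    apply/forallP/forallP => H j; have := H (Ordinal (sw_lt j)); rewrite /= /swap_state.
      by rewrite swK.
    by rewrite swK.
  case: forallP => // H; rewrite ?andbF // !andbA !andbT; congr andb.
  have := H (@Ordinal i.+2 i.+1 (ltnSn _)); rewrite /swap_state /sw /= eqxx.
  by rewrite (_ : (i.+1 == i) = false); [move=> /eqP <-|lia].
- by apply: legal_swap => //; right.
- by rewrite /swap_state /sw; do 2?[case: eqP => ?]; [lia|lia|].
Qed.

Lemma shift_star_shift i : Op (mstar (shiftv i)) \o Op (shiftv i) = Op (dotv i).
Proof.
apply/funext => F; apply/funext => al /=; rewrite Op_shift_star Op_shift Op_dot.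
case: (boolP (legal al)) => leg; last by rewrite !mul0r.
case: eqP => a0; last by rewrite !mul0r.
rewrite legal_swap //; last by right.
rewrite swap_stateK (_ : steps (swap_state i al) i.+1 = steps al i); last first.
  by rewrite /steps /swap_state /sw eqxx (_ : (i.+1 == i) = false) //; lia.
by rewrite a0 eqxx !mul1r.
Qed.

Lemma shift_shift_star i : Op (shiftv i) \o Op (mstar (shiftv i)) = Op (dotv i.+1).
Proof.
apply/funext => F; apply/funext => al /=; rewrite Op_shift Op_shift_star Op_dot.
case: (boolP (legal al)) => leg; last by rewrite !mul0r.
case: eqP => a0; last by rewrite !mul0r.
rewrite legal_swap //; last by left.
rewrite swap_stateK (_ : steps (swap_state i al) i = steps al i.+1); last first.
  by rewrite /steps /swap_state /sw eqxx.
by rewrite a0 eqxx !mul1r.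
Qed.

(** [T] tests and changes positions from [n] on only, whereas [x] acts on the first [n]
    positions. *)
Lemma Op_commute n (x : motz R n) (phi : state -> state) (c : state -> bool) (T : wave -> wave) :
  (forall F al, T F al = (legal al && c al)%:R * F (phi al)) ->
  (forall al, legal al -> c al -> legal (phi al)) ->
  (forall al (b : walk n), c (splice b al) = c al) ->
  (forall al (b : walk n), phi (splice b al) = splice b (phi al)) ->
  (forall al i, (i < n)%N -> phi al i = al i) ->
  Op x \o T = T \o Op x.
Proof.
move=> TE leg_phi c_spl phi_spl phi_lt; apply/funext => F; apply/funext => al /=.
rewrite TE /wave_op; have [leg|_] := boolP (legal al); last by rewrite !mul0r.
have [cal|ncal] := boolP (c al); last first.
  by rewrite mul0r big1 ?mulr0 // => b _; rewrite TE c_spl (negbTE ncal) andbF mul0r mulr0.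
rewrite !mul1r leg_phi // mul1r; apply: eq_bigr => b _.
rewrite TE c_spl cal andbT phi_spl.
rewrite (@eq_wv R sq n x (steps (phi al)) (stepn b) (steps al) (stepn b)) // => [|i lt_in].
  have [->|nz] := eqVneq (wv x (steps al) (stepn b)) 0; first by rewrite !mul0r.
  by rewrite (legal_splice leg nz) mul1r.
by rewrite /steps phi_lt.
Qed.

Lemma steps_splice_ge n (b : walk n) al i : (n <= i)%N -> steps (splice b al) i = steps al i.
Proof. by move=> ni; rewrite steps_splice ltnNge ni. Qed.

Lemma swap_splice n (b : walk n) al i : (n <= i)%N ->
  swap_state i (splice b al) = splice b (swap_state i al).
Proof.
move=> ni; apply/funext => j; rewrite /swap_state; have [lt_jn|nj] := ltnP j n.
  have -> : sw i j = j by rewrite /sw; do 2?case: eqP => ?; lia.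
  by rewrite !splice_lt.
rewrite !splice_ge // /sw; do 2?case: eqP => ?; lia.
Qed.

Lemma Op_shift_commute n (x : motz R n) i : (n <= i)%N ->
  Op x \o Op (shiftv i) = Op (shiftv i) \o Op x.
Proof.
move=> ni; apply: (@Op_commute _ _ (swap_state i) (fun al => steps al i.+1 == 0)).
- by move=> F al; apply: Op_shift.
- by move=> al leg /eqP a0; apply: legal_swap => //; left.
- by move=> al b; rewrite steps_splice_ge // ltnW.
- by move=> al b; apply: swap_splice.
- by move=> al j jn; rewrite /swap_state /sw; do 2?[case: eqP => ?]; [lia|lia|].
Qed.

(** Of the last steps the dot keeps only the flat one, which preserves the height and so the mass;
    there remains the [D^-1] of the normalisation. *)
Lemma mtr_dot n (x : motz R n) i : (n <= i)%N ->
  mtr D (mmul D (mwiden i.+1 x) (dotv i)) = D%:C^-1 * mtr D x.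
Proof.
move=> ni; rewrite -(mtr_mwiden D_gt1 sq1 sq_ge0 sq_eigen x ni).
rewrite !(mtr_wv D_gt1 sq1 sq_ge0 sq_eigen) sum_walk_recr exprS invfM -mulrA.
congr (_ * (_ * _)); apply: eq_bigr => b _.
pose z : 'I_3 := inord 1.
have z0 : step z = 0 by rewrite /step inordK.
set bz := rcons_walk (b, z).
have bE j : (j < i)%N -> stepn bz j = stepn b j by move=> ji; rewrite stepn_rcons ltn_eqF.
have diag s : wv (mmul D (mwiden i.+1 x) (dotv i)) (stepn (rcons_walk (b, s)))
      (stepn (rcons_walk (b, s))) = (s == z)%:R * wv (mwiden i.+1 x) (stepn bz) (stepn bz).
  set bs := rcons_walk (b, s); rewrite (wv_mmul sq1 sq_ge0 sq_eigen) (bigD1 bs) //= big1 ?addr0.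
    rewrite wv_dot // [stepn bs i]stepn_rcons eqxx -{1}z0 (inj_eq step_inj).
    rewrite (_ : [forall j, _] = true); last by apply/forallP => j; rewrite eqxx.
    rewrite mulrC; case: eqP => [sz|_]; last by rewrite !mul0r.
    rewrite /bs sz -/bz; have [->|/wv_valid[v _ _]] := eqVneq (wv (mwiden i.+1 x) (stepn bz) (stepn bz)) 0.
      by rewrite !mulr0.
    by rewrite v.
  move=> c /negbTE cb; rewrite wv_dot // (_ : [forall j, _] = false) ?andbF ?mulr0 //.
  apply: contraFF cb => /forallP H; apply/eqP/ffunP => j.
  by have := H j; rewrite !stepn_ord => /eqP/step_inj.
rewrite (bigD1 z) //= big1 ?addr0 => [|s /negbTE sz]; last by rewrite diag sz !mul0r.
rewrite diag eqxx mul1r -/bz wv_mwiden ?leqW // wv_mwiden //.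
rewrite (@eq_wv R sq n x (stepn bz) (stepn bz) (stepn b) (stepn b)); last 2 first.
- by move=> j jn; apply: bE; apply: leq_trans jn ni.
- by move=> j jn; apply: bE; apply: leq_trans jn ni.
have -> : mass sq bz = mass sq b.
  by rewrite /mass hgtS stepn_rcons eqxx z0 addr0 (eq_hgt bE).
congr (_%:R * _ * _); congr nat_of_bool; rewrite /tails.
have tl : [forall j : 'I_i.+1, (n <= j)%N ==> (stepn bz j == stepn bz j)].
  by apply/forallP => j; rewrite eqxx implybT.
have tl' : [forall j : 'I_i, (n <= j)%N ==> (stepn b j == stepn b j)].
  by apply/forallP => j; rewrite eqxx implybT.
rewrite ?tl ?tl' ?andbT /=.
apply/idP/idP => v; first by rewrite -(eq_valid_walk sq bE); apply: valid_walk_le v.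
move/andP: v => [/forallP sb /forallP vb]; apply/andP; split; apply/forallP => j.
  by rewrite stepn_ord; apply: small_step.
have [ji|ij] := leqP j i; first by rewrite (eq_hgt bE) //; apply: (vb (Ordinal (ji : j < i.+1)%N)).
have -> : (j = i.+1 :> nat) by have := ltn_ord j; lia.
by rewrite hgtS stepn_rcons eqxx z0 addr0 (eq_hgt bE) //; have := vb ord_max.
Qed.

End GeneratorOps.

(** * Compression of a diagram to one strand fewer *)

Lemma eq_opp_int (x : int) : (x == - x) = (x == 0).
Proof. lia. Qed.

(** The last strand is cut off, and a point that was joined to it becomes unmatched. [Op_restrict]
    realises this by dots on both sides. *)
Definition restrict n (z : {ffun point n.+1 -> point n.+1}) : {ffun point n -> point n} :=
  [ffun p => let q := z (widen_point (leqnSn n) p) in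
             if insub (val q.2) is Some j then (q.1, j) else p].

Section Restrict.
Variables (n : nat) (z : {ffun point n.+1 -> point n.+1}).
Hypothesis zm : motzkin z.
Local Notation W := (widen_point (leqnSn n)).

Lemma restrict_old p r : z (W p) = W r -> restrict z p = r.
Proof.
move=> E; rewrite ffunE E /=; case: r E => s j /= _.
by rewrite insubT //= => lt_j; congr (_, _); apply: val_inj.
Qed.

Lemma restrict_new p : (n <= (z (W p)).2)%N -> restrict z p = p.
Proof. by move=> E; rewrite ffunE /= insubF // ltnNge E. Qed.

Lemma bpos_restrict (p q : point n) : (bpos (W p) < bpos (W q))%N = (bpos p < bpos q)%N.
Proof.
case: p q => [[] i] [[] j]; rewrite /bpos /=; have := ltn_ord i; have := ltn_ord j; lia.
Qed.

Lemma restrict_motzkin : motzkin (restrict z).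
Proof.
have /motzkinP[zK zN] := zm; apply/motzkinP; split=> [p|p q].
  case: (pointP (leqnSn n) (z (W p))) => [r zp|zp]; last by rewrite !restrict_new.
  by rewrite (restrict_old zp); apply: restrict_old; rewrite -zp zK.
case: (pointP (leqnSn n) (z (W p))) => [r zp|zp]; last by rewrite (restrict_new zp); lia.
case: (pointP (leqnSn n) (z (W q))) => [t zq|zq]; last by rewrite (restrict_new zq); lia.
by have := zN (W p) (W q); rewrite zp zq !bpos_restrict (restrict_old zp) (restrict_old zq).
Qed.

Variables (K : numFieldType) (sq : int -> K) (a b : nat -> int).
Hypotheses (a_n : a n = 0) (b_n : b n = 0).

Lemma valid_walk_flat (c : nat -> int) : c n = 0 -> valid_walk sq n.+1 c = valid_walk sq n c.
Proof.
move=> c0; apply/idP/idP => [|/andP[/forallP sc /forallP vc]]; first exact: valid_walk_le.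
apply/andP; split; apply/forallP => j.
  have [jn|nj] := ltnP j n; first exact: (sc (Ordinal jn)).
  by rewrite (_ : (j : nat) = n) ?c0 //; have := ltn_ord j; lia.
have [jn|nj] := leqP j n; first exact: (vc (Ordinal (jn : j < n.+1)%N)).
rewrite (_ : (j : nat) = n.+1); last by have := ltn_ord j; lia.
by rewrite hgtS c0 addr0; apply: (vc ord_max).
Qed.

Lemma bdry_old (p : point n) : bdry a b (W p) = bdry a b p. Proof. by []. Qed.

Lemma bdry_new (p : point n.+1) : (n <= p.2)%N -> bdry a b p = 0.
Proof.
case: p => s j /= nj; have jn : (j : nat) = n by have := ltn_ord j; lia.
by rewrite /bdry /= jn a_n b_n oppr0; case: s.
Qed.

Lemma antisym_restrict :
  antisym z (@bdry n.+1 a b) = antisym (restrict z) (@bdry n a b).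
Proof.
have /motzkinP[zK zN] := zm; apply/forallP/forallP => H p.
  have := H (W p); case: (pointP (leqnSn n) (z (W p))) => [r zp|zp].
    by rewrite (restrict_old zp) zp.
  by rewrite (restrict_new zp) (bdry_new zp) (bdry_old p) eq_opp_int [0 == _]eq_sym oppr_eq0.
have new0 r : (n <= (z (W r)).2)%N -> bdry a b r = 0.
  by move=> zr; have := H r; rewrite (restrict_new zr) eq_opp_int => /eqP.
case: (pointP (leqnSn n) p) => [r ->|np].
  case: (pointP (leqnSn n) (z (W r))) => [t zr|zr].
    by have := H r; rewrite (restrict_old zr) zr.
  by rewrite (bdry_new zr) (bdry_old r) new0 // oppr0.
rewrite (bdry_new np) oppr0; case: (pointP (leqnSn n) (z p)) => [r zp|zp].
  by rewrite zp (bdry_old r) new0 // -zp zK.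
by rewrite (bdry_new zp).
Qed.

(** As [a] and [b] have step 0 at [n], an arc lost in the restriction carries step 0 and has weight
    1. *)
Lemma weight_restrict : weight sq z a b = weight sq (restrict z) a b.
Proof.
rewrite /weight antisym_restrict !valid_walk_flat //.
case: and3P => [[anti va vb]|]; last by rewrite !mul0r.
congr (_ * _); rewrite !big_point.
have term s (i : 'I_n) :
    (if same_side z (s, widen_ord (leqnSn n) i)
     then gap sq a b (s, widen_ord (leqnSn n) i : 'I_n.+1) else 1) =
    (if same_side (restrict z) (s, i) then gap sq a b (s, i) else 1).
  case: (pointP (leqnSn n) (z (W (s, i)))) => [r zp|zp].
    by rewrite /same_side (restrict_old zp) zp.
  rewrite /same_side (restrict_new zp) ltnn andbF; case: ifP => // _.
  have := forallP anti (s, i); rewrite (restrict_new zp) /bdry /gap /= !hgtS.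
  have nz c : valid_walk sq n c -> sq (hgt c i) != 0.
    by move=> vc; apply: (valid_walk_neq0 vc); apply: ltnW.
  case: s {zp} => eq0.
    have -> : a i = 0 by lia.
    by rewrite addr0 divff // nz.
  have -> : b i = 0 by lia.
  by rewrite addr0 divff // nz.
have last_false s : same_side z (s, ord_max) = false.
  by rewrite /same_side ltnNge -ltnS ltn_ord andbF.
congr (_ * _).
  rewrite big_mkcond big_ord_recr /= last_false mulr1 [RHS]big_mkcond.
  by apply: eq_bigr => i _; apply: (term true).
rewrite big_mkcond big_ord_recr /= last_false mulr1 [RHS]big_mkcond.
by apply: eq_bigr => i _; apply: (term false).
Qed.

End Restrict.

(** * Factoring a diagram through a cut strand *)

Lemma bottom_through n (d : mdiag n) :
  (forall i : 'I_n, (d (false, i)).1) -> matching d = vertical n.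
Proof.
move=> thr; pose f i := (d (false, i)).2; pose g i := (d (true, i)).2.
have dF i : d (false, i) = (true, f i) by rewrite [LHS]surjective_pairing thr.
have f_inj : injective f.
  move=> i j fij; have : d (false, i) = d (false, j) by rewrite !dF fij.
  by move/(can_inj (mdiagK d)) => -[].
have [h fh hf] := injF_bij f_inj.
have dT i : d (true, i) = (false, h i) by rewrite -[i in LHS]hf -dF mdiagK.
(* Noncrossing makes [f] increasing, and likewise its inverse; an increasing self-map of ['I_n] lies
   above the identity, so both are the identity. *)
have f_mono (i j : 'I_n) : (i < j)%N -> (f i < f j)%N.
  move=> ij; rewrite ltn_neqAle; apply/andP; split.
    by apply: contraTneq ij => /val_inj/f_inj ->; rewrite ltnn.
  rewrite leqNgt; apply/negP => fji; have := mdiagN d (true, f j) (true, f i).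
  rewrite !dT !fh /bpos /=; have := ltn_ord i; have := ltn_ord j; have := ltn_ord (f i).
  by have := ltn_ord (f j); lia.
have h_mono (i j : 'I_n) : (i < j)%N -> (h i < h j)%N.
  move=> ij; rewrite ltnNge leq_eqVlt; apply/negP => /orP[/eqP/val_inj/(can_inj hf) E|/f_mono].
    by rewrite E ltnn in ij.
  by rewrite !hf ltnNge ltnW.
have ge (k : 'I_n -> 'I_n) : (forall i j : 'I_n, (i < j)%N -> (k i < k j)%N) ->
    forall i : 'I_n, (i <= k i)%N.
  move=> k_mono; suff H m : forall i : 'I_n, (i : nat) = m -> (m <= k i)%N by move=> i; apply: H.
  elim: m => // m IH i im; have lt_mn : (m < n)%N by have := ltn_ord i; lia.
  apply: leq_ltn_trans (IH (Ordinal lt_mn) erefl) _; apply: k_mono; rewrite /=; lia.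
have fE i : f i = i.
  apply: val_inj; apply/eqP; rewrite eqn_leq (ge f f_mono) andbT.
  by have := ge h h_mono (f i); rewrite fh.
have hE i : h i = i by rewrite -[in RHS](hf i) fE.
by apply/ffunP => -[[] i]; rewrite ffunE /flip /= ?dT ?dF ?fE ?hE.
Qed.

(* An innermost arc between bottom points joins neighbours, unless it covers an unmatched point. *)
Lemma bottom_reducible n (d : mdiag n) : matching d != vertical n ->
  (exists i : 'I_n, d (false, i) = (false, i)) \/
  exists i j : 'I_n, j = i.+1 :> nat /\ d (false, i) = (false, j).
Proof.
move=> nv; suff H m : forall i j : 'I_n, (j < i + m)%N -> (i < j)%N -> d (false, i) = (false, j) ->
    (exists i : 'I_n, d (false, i) = (false, i)) \/
    exists i j : 'I_n, j = i.+1 :> nat /\ d (false, i) = (false, j).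
  have [i dF] : exists i : 'I_n, ~~ (d (false, i)).1.
    apply/existsP; apply: contraNT nv; rewrite negb_exists => /forallP thr.
    by apply/eqP/bottom_through => i; rewrite -[(_).1]negbK.
  case E : (d (false, i)) dF => [s j] /= /negbTE sF; rewrite {s}sF in E.
  have [ij|ji|/val_inj ij] := ltngtP (i : nat) j.
  - by apply: (H n.+1 i j) => //; have := ltn_ord j; lia.
  - by apply: (H n.+1 j i) => //; [have := ltn_ord i; lia|rewrite -E mdiagK].
  - by left; exists i; rewrite E ij.
elim: m => [|m IH] i j jm ij dij; first by lia.
have [ji|ji] := eqVneq (j : nat) i.+1; first by right; exists i, j.
have lt_i1 : (i.+1 < n)%N by have := ltn_ord j; lia.
(* The right neighbour [k] of [i] lies under the arc; by noncrossing its partner is a bottom point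
   under the arc too, or [k] itself. *)
pose k := Ordinal lt_i1; have ik : (i < k)%N by rewrite /=.
have kj : (k < j)%N by rewrite /=; lia.
have dji : d (false, j) = (false, i) by rewrite -dij mdiagK.
case dk : (d (false, k)) => [s l].
have N1 := mdiagN d (false, j) (false, k); have N2 := mdiagN d (false, k) (false, i).
have N3 := mdiagN d (s, l) (false, j); have N4 := mdiagN d (false, i) (s, l).
have dl : d (s, l) = (false, k) by rewrite -dk mdiagK.
move: N1 N2 N3 N4; rewrite dl dij dji dk /bpos /=.
have := ltn_ord l; have := ltn_ord j; have := ltn_ord i; have := ltn_ord k.
case: s dk dl => dk dl.
  by move: ik kj; clear; move: (nat_of_ord k) => k'; lia.
have [kl|lk|/val_inj kl] := ltngtP (k : nat) l; last by left; exists k; rewrite dk kl.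
- have [lj _ _ _ _ N1 _ _ _|jl] := ltnP l j; first by apply: (IH k l) => //=; lia.
  have [/val_inj lj|nlj] := eqVneq (l : nat) j.
    by move: dk; rewrite lj -dij => /(can_inj (mdiagK d)) -[] E; rewrite -E ltnn in ik.
  by move: ik kj kl jl nlj; clear; move: (nat_of_ord k) => k'; lia.
- have [/val_inj li|nli] := eqVneq (l : nat) i.
    by move: dk; rewrite li -dji => /(can_inj (mdiagK d)) -[] E; rewrite -E ltnn in kj.
  by move: ik kj lk nli => /=; lia.
Qed.

Lemma cup_cap_same_side n i (p : point n) : (i.+1 < n)%N ->
  same_side (cup_cap_diag n i) p = (p.2 == i :> nat).
Proof.
move=> lt_in; case: p => s j; rewrite /same_side ffunE /=.
have [E|_] := eqVneq (j : nat) i.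
  by rewrite /= eqxx val_insubd lt_in E ltnSn.
have [E|_] := eqVneq (j : nat) i.+1; last by case: s.
by rewrite /= eqxx val_insubd (ltnW lt_in) E ltnNge leqnSn.
Qed.

Lemma antisym_cup_cap n i a b : (i.+1 < n)%N -> antisym (cup_cap_diag n i) (@bdry n a b) =
  [&& a i.+1 == - a i, b i.+1 == - b i &
      [forall j : 'I_n, [|| j == i :> nat, j == i.+1 :> nat | a j == b j]]].
Proof.
move=> lt_in; have lt_in' := ltnW lt_in.
have v1 (j : 'I_n) : insubd j i.+1 = i.+1 :> nat by rewrite val_insubd lt_in.
have v0 (j : 'I_n) : insubd j i = i :> nat by rewrite val_insubd lt_in'.
have neq1 : (i.+1 == i) = false by lia.
apply/forallP/and3P => [H|[/eqP ai /eqP bi /forallP ab] [s j]].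
  have H1 := H (true, Ordinal lt_in'); have H2 := H (false, Ordinal lt_in').
  move: H1 H2; rewrite !ffunE /= !eqxx /bdry /= !v1 => H1 H2.
  split; [exact: H1 | by rewrite -eqr_opp; exact: H2|].
  apply/forallP => j; have := H (true, j); rewrite ffunE /=.
  have [//|ji] := eqVneq (j : nat) i.
  have [//|ji1] := eqVneq (j : nat) i.+1; rewrite /bdry /=.
  by rewrite eqr_opp eq_sym.
rewrite ffunE /=; have [E|ji] := eqVneq (j : nat) i.
  by case: s; rewrite /bdry /= v1 E ?ai ?bi.
have [E|ji1] := eqVneq (j : nat) i.+1.
  by case: s; rewrite /bdry /= v0 E ?ai ?bi ?opprK.
have := ab j; rewrite (negbTE ji) (negbTE ji1) /= => /eqP aj.
by case: s; rewrite /bdry /flip /= aj ?opprK.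
Qed.

Definition zap i (c : nat -> int) : nat -> int := fun j => if (j == i) || (j == i.+1) then 0 else c j.

Lemma hgt_zap i c k : c i.+1 = - c i ->
  hgt (zap i c) k = if k == i.+1 then hgt c i else hgt c k.
Proof.
move=> c1; have lt : forall k, (k <= i)%N -> hgt (zap i c) k = hgt c k.
  move=> m mi; apply: (@eq_hgt _ _ m) => // j jm; rewrite /zap.
  by rewrite (_ : (j == i) || (j == i.+1) = false) //; lia.
have E1 : hgt (zap i c) i.+1 = hgt c i by rewrite hgtS lt // /zap eqxx addr0.
case: eqP => [->//|/eqP ki]; have [kl|kg] := leqP k i; first exact: lt.
have {kg ki} : (i.+2 <= k)%N by lia.
elim: k => // k IH; rewrite leq_eqVlt => /orP[/eqP <-|ik].
  by rewrite hgtS E1 /zap eqxx orbT !hgtS c1 addr0 addrK.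
by rewrite !hgtS IH // /zap (_ : (k == i) || (k == i.+1) = false) //; lia.
Qed.

Lemma valid_zap (K : numFieldType) (sq : int -> K) n i c : (i.+1 < n)%N -> c i.+1 = - c i ->
  valid_walk sq n c -> valid_walk sq n (zap i c).
Proof.
move=> lt_in c1 vc; have /andP[/forallP sc _] := vc; apply/andP; split; apply/forallP => j.
  by rewrite /zap; case: ifP => // _; apply: sc.
rewrite hgt_zap //; case: ifP => _; apply: (valid_walk_neq0 vc).
  by rewrite ltnW // ltnW.
by rewrite -ltnS.
Qed.

(** The weight identity behind [Op_bottom_arc]: [zap i c] is the walk between the two diagrams. On
    it the bottom arc of [d] has weight 1, and the lower arc of the cup-cap, which sees [c],
    supplies the missing ratio. *)
Lemma weight_zap (K : numFieldType) (sq : int -> K) n (d : mdiag n) i (j j' : 'I_n) a c :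
  j = i :> nat -> j' = i.+1 :> nat -> d (false, j) = (false, j') ->
  weight sq d a (zap i c) * weight sq (cup_cap_diag n i) (zap i c) c = weight sq d a c.
Proof.
move=> ji ji' dj; have lt_in : (i.+1 < n)%N by rewrite -ji'.
have dj' : d (false, j') = (false, j) by rewrite -dj mdiagK.
rewrite /weight mulrACA -natrM mulnb antisym_cup_cap //.
have zi : zap i c i = 0 by rewrite /zap eqxx.
have zi1 : zap i c i.+1 = 0 by rewrite /zap eqxx orbT.
have zj k : [|| k == i, k == i.+1 | zap i c k == c k].
  by rewrite /zap; case: (k == i); case: (k == i.+1) => //=.
rewrite zi zi1 oppr0 eqxx /= (_ : [forall k : 'I_n, _] = true) ?andbT; last exact/forallP.
have anti_c : antisym d (@bdry n a c) -> c i.+1 = - c i.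
  by move=> /forallP/(_ (false, j)); rewrite dj /bdry /= ji ji'; lia.
have [c1|nc1] := eqVneq (c i.+1) (- c i); last first.
  rewrite !andbF !mul0r; case: and3P => [[/anti_c c1 _ _]|]; last by rewrite mul0r.
  by rewrite c1 eqxx in nc1.
have anti_zap : antisym d (@bdry n a (zap i c)) = antisym d (@bdry n a c).
  have bE p : (p \notin [:: (false, j); (false, j')]) -> bdry a (zap i c) p = bdry a c p.
    case: p => [[]] // k; rewrite !inE !xpair_eqE /= negb_or -!(inj_eq val_inj) /= ji ji'.
    by rewrite /bdry /zap /= => /andP[/negbTE -> /negbTE ->].
  apply: eq_forallb => p; have [|np] := boolP (p \in [:: (false, j); (false, j')]).
    rewrite !inE => /orP[]/eqP ->; rewrite ?dj ?dj' /bdry /= ji ji' zi zi1 c1; lia.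
  rewrite !bE //; apply: contra np; rewrite !inE => /orP[]/eqP E; apply/orP; [right|left].
    by apply/eqP; rewrite -dj -E mdiagK.
  by apply/eqP; rewrite -dj' -E mdiagK.
rewrite anti_zap; have [vc|nvc] := boolP (valid_walk sq n c); last by rewrite !andbF !mul0r.
rewrite valid_zap //= !andbT; case: (_ && _); last by rewrite !mul0r.
rewrite !mul1r; have nz k : (k <= n)%N -> sq (hgt c k) != 0 by apply: valid_walk_neq0.
have lt_in' := ltnW (ltnW lt_in).
have same_j : same_side d (false, j) by rewrite /same_side dj /= ji ji'.
rewrite [X in _ * X](eq_bigl _ _ (fun p => cup_cap_same_side p lt_in)).
rewrite [in X in _ * X]big_point /= !(big_pred1 j) => [|k|k]; last 2 first.
- by rewrite -ji.
- by rewrite -ji.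
rewrite (bigD1 (false, j)) // [RHS](bigD1 (false, j)) //= /gap /= !hgtS ji zi !addr0.
rewrite hgt_zap // (_ : (i == i.+1) = false); last lia.
rewrite divff ?nz // mul1r mul1r mulrC; congr (_ * _); apply: eq_bigr => p /andP[sp pj].
case: p sp pj => [[] k] // sp; rewrite xpair_eqE /= -(inj_eq val_inj) /= ji => ki.
have ki1 : (k : nat) != i.+1.
  apply: contraTneq sp => kE; have -> : k = j' by apply: val_inj; rewrite /= kE.
  by rewrite /same_side dj' /= ji ji' ltnNge leqnSn.
rewrite !hgt_zap // (negbTE ki1) (_ : (k.+1 == i.+1) = false) //.
exact/negbTE.
Qed.

Section Reductions.
Variables (R : realType) (D : R) (sq : int -> R).
Hypotheses (sq1 : sq 1 = 1) (sq_ge0 : forall z, 0 <= sq z).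
Hypothesis sq_eigen : forall z, sq z != 0 ->
  sq (z - 1) ^+ 2 + sq z ^+ 2 + sq (z + 1) ^+ 2 = D * sq z ^+ 2.

Local Notation wv := (wv sq).
Local Notation Op := (wave_op sq).
Local Notation legal := (legal sq).
Local Notation dot n i := (mbasis R (dot_diag n i)).

Lemma splice_at n (b : walk n) al i : (i < n)%N -> steps (splice b al) i = stepn b i.
Proof. by move=> lt_in; rewrite steps_splice lt_in. Qed.

Lemma Op_vertical n : Op (mbasis R (vertical n)) = Op (mone R 0).
Proof.
have vm : motzkin (vertical 0) by apply/motzkinP; split=> -[s []].
rewrite -(Op_mwiden sq (mone R 0) (leq0n n)); congr Op.
rewrite /mwiden (@sum_mbasis R 0 (motz R n) (Mdiag vm)) /=; congr mbasis.
by apply/ffunP => p; rewrite pad_new // ffunE.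
Qed.

Lemma Op_bottom_dot n (d : mdiag n) (i : 'I_n) : d (false, i) = (false, i) ->
  Op (mbasis R d) = Op (mbasis R d) \o Op (dot n i).
Proof.
move=> di; apply/funext => F; apply/funext => al /=; rewrite /wave_op.
have [leg|_] := boolP (legal al); last by rewrite !mul0r.
congr (_ * _); apply: eq_bigr => b _; rewrite -/(Op _ _ _) Op_dot_level //.
have [->|nz] := eqVneq (wv (mbasis R d) (steps al) (stepn b)) 0; first by rewrite !mul0r.
rewrite (legal_splice leg nz) splice_at //= (_ : stepn b i == 0) ?mul1r //.
move: nz; rewrite wv_basis ?matchingP // fmorph_eq0 => /weight_valid[/forallP/(_ (false, i)) + _ _].
by rewrite di /bdry /= eq_opp_int oppr_eq0.
Qed.

(** Stacked directly on the cup-cap, the bottom arc of [d] would close to a loop. The dot cuts this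
    loop to an open string, which has factor 1, and the lower arc of the cup-cap restores [d]. *)
Lemma Op_bottom_arc n (d : mdiag n) (i j : 'I_n) : j = i.+1 :> nat -> d (false, i) = (false, j) ->
  Op (mbasis R d) = Op (mbasis R d) \o Op (dot n i) \o Op (mbasis R (cup_cap_diag n i)).
Proof.
move=> ji dij; have lt_in : (i.+1 < n)%N by rewrite -ji.
set t := mbasis R (cup_cap_diag n i); have tm := cup_cap_motzkin lt_in.
apply/funext => F; apply/funext => al /=; rewrite [RHS]/wave_op [LHS]/wave_op.
have [leg|_] := boolP (legal al); last by rewrite !mul0r.
congr (_ * _).
have -> : \sum_(b : walk n) wv (mbasis R d) (steps al) (stepn b) *
    Op (dot n i) (Op t F) (splice b al) =
  \sum_(b : walk n) \sum_(c : walk n) (stepn b i == 0)%:R * wv (mbasis R d) (steps al) (stepn b) *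
    wv t (stepn b) (stepn c) * F (splice c al).
  apply: eq_bigr => b _; rewrite Op_dot_level // splice_at //.
  have [->|nz] := eqVneq (wv (mbasis R d) (steps al) (stepn b)) 0.
    by rewrite mul0r big1 // => c _; rewrite mulr0 !mul0r.
  rewrite /wave_op (legal_splice leg nz) /= mul1r; rewrite [in LHS]mulr_sumr [LHS]mulr_sumr; apply: eq_bigr => c _.
  rewrite splice_splice (@eq_wv R sq n t _ _ (stepn b) (stepn c)) // => [|k kn].
    by rewrite mulrCA !mulrA.
  exact: splice_at.
rewrite exchange_big; apply: eq_bigr => c _ /=.
(* The only middle walk allowed by the dot and the cup-cap: [c] with the steps at [i] and [j]
   replaced by 0. *)
pose c' : walk n := [ffun k => if (k == i) || (k == j) then inord 1 else c k].
have c'E k : (k < n)%N -> stepn c' k = zap i (stepn c) k.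
  move=> kn; rewrite (stepn_ord _ (Ordinal kn)) ffunE /zap -!(inj_eq val_inj) /= ji.
  by case: ifP => _; rewrite ?(stepn_ord _ (Ordinal kn)) // /step inordK.
rewrite (bigD1 c') //= big1 ?addr0 => [|b].
  rewrite c'E // /zap eqxx /= mul1r !wv_basis ?matchingP // -(rmorphM (real_complex R)) /=.
  rewrite (@eq_weight _ sq n d _ (stepn c') (steps al) (zap i (stepn c))) //.
  rewrite (@eq_weight _ sq n (cup_cap_diag n i) (stepn c') _ (zap i (stepn c)) (stepn c)) //.
  by rewrite (weight_zap _ _ _ _ ji dij).
apply: contraNeq; rewrite wv_basis ?matchingP // /t wv_basis // !mulf_eq0 !negb_or.
rewrite pnatr_eq0 eqb0 negbK !fmorph_eq0 => /andP[/andP[/andP[/eqP b0 _]]].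
move=> /weight_valid[+ _ _]; rewrite antisym_cup_cap // b0 oppr0 => /and3P[/eqP b1 _ /forallP bE] _.
apply/eqP/ffunP => k; rewrite ffunE -!(inj_eq val_inj) /= ji.
apply: step_inj; have := bE k; rewrite -!stepn_ord; case: eqVneq => [->|_] /=.
  by rewrite b0 /step inordK.
case: eqVneq => [->|_] /= => [_|/eqP ->]; first by rewrite b1 /step inordK.
by rewrite stepn_ord.
Qed.

Lemma Op_reducible n (d : mdiag n) : matching d != vertical n ->
  exists i (b : motz R n), (i < n)%N /\
    Op (mbasis R d) = Op (mbasis R d) \o Op (dot n i) \o Op b.
Proof.
case/bottom_reducible => [[i di]|[i [j [ji dij]]]].
  exists i, (mwiden n (mone R 0)); split=> //; rewrite Op_mwiden // -compA.
  by rewrite Op_one_r //; apply: Op_bottom_dot.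
by exists i, (mbasis R (cup_cap_diag n i)); split=> //; apply: Op_bottom_arc ji dij.
Qed.

Lemma Op_restrict n (z : mdiag n.+1) : Op (dotv R n) \o Op (mbasis R z) \o Op (dotv R n) =
  Op (mbasis R (restrict z)) \o Op (dotv R n).
Proof.
have rm := restrict_motzkin (matchingP z).
rewrite -(Op_mwiden sq (mbasis R (restrict z)) (leqnSn n)).
apply/funext => F; apply/funext => al /=; rewrite Op_dot /wave_op.
have [leg|_] := boolP (legal al); last by rewrite !mul0r.
rewrite /= mulrA mulr1 mulr_sumr mulr_sumr; apply: eq_bigr => b _.
rewrite -/(Op _ _ _) Op_dot splice_at //.
have [b0|] := eqVneq (stepn b n) 0; last by rewrite andbF !(mul0r, mulr0).
rewrite wv_mwiden // /tails.
have -> : [forall k : 'I_n.+1, (n <= k)%N ==> (steps al k == stepn b k)] = (steps al n == 0).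
  apply/forallP/eqP => [/(_ ord_max)|al0 k]; first by rewrite /= leqnn b0 => /eqP.
  apply/implyP => nk; rewrite (_ : (k : nat) = n) ?al0 ?b0 //.
  by have := ltn_ord k; lia.
rewrite (legal_valid _ leg) andbT !wv_basis ?matchingP //.
have [al0|_] := eqVneq (steps al n) 0; last by rewrite !mul0r mulr0.
by rewrite (weight_restrict _ _ al0 b0) ?matchingP // !mul1r.
Qed.

End Reductions.

(** * The unions of the levels and their trace *)

Section Tower.
Variables (R : realType) (D : R) (sq : int -> R).
Hypotheses (D_gt1 : 1 < D) (sq1 : sq 1 = 1) (sq_ge0 : forall z, 0 <= sq z).
Hypothesis sq_eigen : forall z, sq z != 0 ->
  sq (z - 1) ^+ 2 + sq z ^+ 2 + sq (z + 1) ^+ 2 = D * sq z ^+ 2.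
Variable K : forall n, submodClosed (motz R n).
Hypothesis K_mrad : forall n x, x \in K n -> x \in @mrad R D n.

Local Notation C := R[i].
Local Notation A := (union_algebra D K).
Local Notation Op := (wave_op sq).
Local Notation wave := ((nat -> 'I_3) -> C).
Local Notation "x ** y" := (sa_mul x y) (at level 40, left associativity).
Local Notation star := (@sa_star C A).
Local Notation one := (sa_one A).
Local Notation cls := (@union_class R K _).

(** Elements of the radical act as 0 and [K] lies in the radical, so the choice of representative
    does not affect the operator. *)
Definition rep (x : A) : wave -> wave := Op (tagged (repr (x : tower_union K))).
Definition phi (x : A) : C := union_tr x.

Lemma Op_mrad n (x y : motz R n) : x - y \in @mrad R D n -> Op x = Op y.
Proof.
move=> /(mrad_Op D_gt1 sq1 sq_ge0 sq_eigen) z; apply/funext => F; apply/funext => al.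
have := z F al; rewrite addrC -scaleN1r Op_linear mulN1r => /eqP.
by rewrite addrC subr_eq0 => /eqP.
Qed.

Lemma rep_class n (x : motz R n) : rep (cls x) = Op x.
Proof.
have [N _ H] := repr_class K x.
set r := repr (union_class K x) in H *; pose m := maxn N (maxn n (tag r)).
have /K_mrad/Op_mrad : at_level m r - mwiden m x \in K m by apply: H; rewrite /= leq_maxl.
by rewrite /at_level !Op_mwiden // /m !leq_max leqnn ?orbT.
Qed.

Lemma rep_mul x y : rep (x ** y) = rep x \o rep y.
Proof.
by rewrite [LHS]rep_class (Op_mmul sq1 sq_ge0 sq_eigen) /at_level !Op_mwiden ?leq_maxl ?leq_maxr.
Qed.

Lemma rep_add x y F al : rep (x + y) F al = rep x F al + rep y F al.
Proof.
rewrite [rep (x + y)]rep_class -[at_level _ (repr (x : tower_union K))]scale1r Op_linear mul1r.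
by rewrite /at_level !Op_mwiden ?leq_maxl ?leq_maxr.
Qed.

Lemma rep_scale c x F al : rep (c *: x) F al = c * rep x F al.
Proof.
rewrite [rep (c *: x)]rep_class -[_ *: _]addr0 Op_linear.
suff -> : Op (0 : motz R (tag (repr (x : tower_union K)))) F al = 0 by rewrite addr0.
by apply: (Op_eq0P sq 0).1 => b d; rewrite wv0.
Qed.

Lemma rep_lin c x y F al : rep (c *: x + y) F al = c * rep x F al + rep y F al.
Proof. by rewrite rep_add rep_scale. Qed.

Lemma rep_wave_lin x c F G al :
  rep x (fun be => c * F be + G be) al = c * rep x F al + rep x G al.
Proof. exact: Op_wave_linear. Qed.

Lemma rep_one : rep one = Op (mone R 0).
Proof. exact: rep_class. Qed.

Lemma rep_star n (v : motz R n) x : rep x = Op v -> rep (star x) = Op (mstar v).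
Proof. by move=> xv; rewrite [LHS]rep_class; apply: Op_mstar xv. Qed.

Lemma eq_rep_star x y : rep x = rep y -> rep (star x) = rep (star y).
Proof. by move=> xy; rewrite (rep_star xy) [RHS](rep_star erefl). Qed.

Lemma rep_starK x : rep (star (star x)) = rep x.
Proof. by rewrite (rep_star (rep_star erefl)) Op_mstarK. Qed.

Lemma rep_star_mul x y : rep (star (x ** y)) = rep (star y) \o rep (star x).
Proof.
pose n := maxn (tag (repr (x : tower_union K))) (tag (repr (y : tower_union K))).
pose v := at_level n (repr (x : tower_union K)); pose w := at_level n (repr (y : tower_union K)).
have xv : rep x = Op v by rewrite /v /at_level Op_mwiden // leq_maxl.
have yw : rep y = Op w by rewrite /w /at_level Op_mwiden // leq_maxr.
rewrite (rep_star xv) (rep_star yw) -(Op_mstar_mmul sq1 sq_ge0 sq_eigen).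
by apply: rep_star; rewrite rep_mul xv yw (Op_mmul sq1 sq_ge0 sq_eigen).
Qed.

Lemma rep_one_l x : rep one \o rep x = rep x.
Proof. by rewrite rep_one; apply: Op_one_l. Qed.

Lemma rep_one_r x : rep x \o rep one = rep x.
Proof. by rewrite rep_one; apply: Op_one_r. Qed.

Lemma phi_rep n (v : motz R n) x : rep x = Op v -> phi x = mtr D v.
Proof. exact: (mtr_Op D_gt1 sq1 sq_ge0 sq_eigen). Qed.

Lemma eq_phi x y : rep x = rep y -> phi x = phi y.
Proof. exact: phi_rep. Qed.

Lemma rep_level x n : (tag (repr (x : tower_union K)) <= n)%N ->
  rep x = Op (at_level n (repr (x : tower_union K))).
Proof. by move=> xn; rewrite /at_level Op_mwiden. Qed.

Lemma phi_linear : scalar phi.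
Proof.
move=> c x y.
pose n := maxn (tag (repr (x : tower_union K))) (tag (repr (y : tower_union K))).
have xv := rep_level (leq_maxl _ _ : (_ <= n)%N); have yw := rep_level (leq_maxr _ _ : (_ <= n)%N).
rewrite (phi_rep xv) (phi_rep yw) -(mtr_linear D); apply: phi_rep.
by apply/funext => F; apply/funext => al; rewrite rep_lin Op_linear xv yw.
Qed.

Lemma phi_tr x y : phi (x ** y) = phi (y ** x).
Proof.
pose n := maxn (tag (repr (x : tower_union K))) (tag (repr (y : tower_union K))).
have xv := rep_level (leq_maxl _ _ : (_ <= n)%N); have yw := rep_level (leq_maxr _ _ : (_ <= n)%N).
rewrite (@phi_rep n (mmul D (at_level n (repr (x : tower_union K))) (at_level n (repr (y : tower_union K))))); last first.
  by rewrite rep_mul (Op_mmul sq1 sq_ge0 sq_eigen) xv yw.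
rewrite (mtr_mmulC D_gt1 sq1 sq_ge0 sq_eigen); apply/esym/phi_rep.
by rewrite rep_mul (Op_mmul sq1 sq_ge0 sq_eigen) xv yw.
Qed.

Lemma phi_sqr n (v : motz R n) x : rep x = Op v ->
  phi (star x ** x) = mtr D (mmul D (mstar v) v).
Proof.
move=> xv; apply: phi_rep.
by rewrite rep_mul (Op_mmul sq1 sq_ge0 sq_eigen) (rep_star xv) xv.
Qed.

Lemma phi_ge0 x : 0 <= phi (star x ** x).
Proof. by rewrite (phi_sqr erefl) (mtr_star_ge0 D_gt1 sq1 sq_ge0 sq_eigen). Qed.

Lemma phi_one : phi one = 1.
Proof. by rewrite (phi_rep rep_one) (mtr_mone D_gt1 sq1 sq_ge0 sq_eigen). Qed.

Lemma phi_star x : phi (star x) = ((phi x)^*)%R.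
Proof. by rewrite (phi_rep (rep_star erefl)) (mtr_mstar D_gt1 sq1 sq_ge0 sq_eigen). Qed.

Lemma phi_bounded a : exists2 c : C, 0 <= c &
  forall x, phi (star (a ** x) ** (a ** x)) <= c * phi (star x ** x).
Proof.
have [c c0 H] := mmul_bounded D_gt1 sq1 sq_ge0 sq_eigen (tagged (repr (a : tower_union K))).
exists c => // x.
pose n := maxn (tag (repr (a : tower_union K))) (tag (repr (x : tower_union K))).
have av := rep_level (leq_maxl _ _ : (_ <= n)%N); have xv := rep_level (leq_maxr _ _ : (_ <= n)%N).
rewrite (phi_sqr xv) (@phi_sqr n (mmul D (at_level n (repr (a : tower_union K))) (at_level n (repr (x : tower_union K))))).
  exact: (H n _ _ (leq_maxl _ _)).
by rewrite rep_mul (Op_mmul sq1 sq_ge0 sq_eigen) av xv.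
Qed.

Lemma phi_tracial_state : tracial_state phi.
Proof. by split; [exact: phi_linear|exact: phi_one|exact: phi_ge0|exact: phi_tr]. Qed.

End Tower.

(** * Trace laws *)

Definition gns_form (R : realType) (A : star_algebra R[i]) (phi : A -> R[i]) (x y : A) : R[i] :=
  phi (sa_mul (sa_star y) x).

(** All that the Hilbert space part uses of the algebra. The identities are paired with a vector
    since they are asserted only up to null vectors. [form_dots] provides self-adjoint idempotents,
    eventually of trace [D^-m] and uncorrelated with any given element. *)
Record trace_laws (R : realType) (D : R) (A : star_algebra R[i]) (phi : A -> R[i]) : Prop :=
  TraceLaws {
  form_lin : forall c x y z, gns_form phi (c *: x + y) z = c * gns_form phi x z + gns_form phi y z ;
  form_conj : forall x y, gns_form phi y x = ((gns_form phi x y)^*)%R ;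
  form_ge0 : forall x, 0 <= gns_form phi x x ;
  form_bounded : forall a, exists2 c, 0 <= c &
    forall x, gns_form phi (sa_mul a x) (sa_mul a x) <= c * gns_form phi x x ;
  form_mul_lin : forall a c x y z,
    gns_form phi (sa_mul a (c *: x + y)) z = c * gns_form phi (sa_mul a x) z + gns_form phi (sa_mul a y) z ;
  form_mulA : forall a b x z,
    gns_form phi (sa_mul (sa_mul a b) x) z = gns_form phi (sa_mul a (sa_mul b x)) z ;
  form_mul1 : forall a z, gns_form phi (sa_mul a (sa_one A)) z = gns_form phi a z ;
  form_1mul : forall a z, gns_form phi (sa_mul (sa_one A) a) z = gns_form phi a z ;
  form_adjl : forall a x y, gns_form phi (sa_mul a x) y = gns_form phi x (sa_mul (sa_star a) y) ;
  form_adjr : forall a x y, gns_form phi (sa_mul x a) y = gns_form phi x (sa_mul y (sa_star a)) ;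
  form_star : forall x y, gns_form phi (sa_star x) y = gns_form phi (sa_star y) x ;
  form_starK : forall x y, gns_form phi (sa_star (sa_star x)) y = gns_form phi x y ;
  form_star_mul : forall x y z,
    gns_form phi (sa_star (sa_mul x y)) z = gns_form phi (sa_mul (sa_star y) (sa_star x)) z ;
  form_one : gns_form phi (sa_one A) (sa_one A) = 1 ;
  form_unique : forall tau : A -> R[i], scalar tau ->
    (forall x y, tau (sa_mul x y) = tau (sa_mul y x)) ->
    (exists c, forall x, `|tau x| ^+ 2 <= c * gns_form phi x x) ->
    forall x, tau x = tau (sa_one A) * gns_form phi x (sa_one A) ;
  form_dots : forall m : nat, exists p : nat -> A,
    [/\ forall j x y, gns_form phi (sa_mul (p j) x) y = gns_form phi x (sa_mul (p j) y),
        forall j x y, gns_form phi (sa_mul (p j) (sa_mul (p j) x)) y = gns_form phi (sa_mul (p j) x) y &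
        forall a, exists n, forall j, (n <= j)%N ->
          gns_form phi a (p j) = D%:C ^- m * gns_form phi a (sa_one A)] }.

(** Nonnegative elements of [R[i]] are real, so the archimedean property of [R] applies. *)
Lemma nat_mul_bounded (R : realType) (x c : R[i]) : 0 <= x ->
  (forall N : nat, N%:R * x <= c) -> x = 0.
Proof.
move=> x0 H; have c0 : 0 <= c by have := H 0; rewrite mul0r.
case: x c x0 c0 H => [a a'] [c c']; rewrite !lecE /= => /andP[/eqP -> a0] /andP[/eqP -> c0] H.
congr (_ +i* _); apply/eqP; rewrite eq_le a0 andbT leNgt; apply/negP => lt0a.
have := H (Num.bound (c / a)); rewrite -(rmorph_nat (real_complex R)) lecE /= !mul0r subr0 => /andP[_].
rewrite leNgt => /negP; apply; rewrite -ltr_pdivrMr //.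
by apply: archi_boundP; rewrite divr_ge0.
Qed.

Lemma motz_sum_basis (R : realType) n (v : motz R n) : v = \sum_(d : mdiag n) v d *: mbasis R d.
Proof.
apply/ffunP => e.
have evD : {morph (fun w : motz R n => w e) : x y / x + y} by move=> x y; rewrite ffunE.
have ev0 : (0 : motz R n) e = 0 by rewrite ffunE.
rewrite (big_morph (fun w : motz R n => w e) evD ev0) (bigD1 e) //= big1 => [|d ne].
  by rewrite !ffunE eqxx addr0 [RHS]mulr1.
rewrite !ffunE (_ : (matching e == matching d) = false) ?[LHS]mulr0 //.
by apply/negbTE; rewrite eq_sym.
Qed.

Section ScalarMaps.
Variables (C : comNzRingType) (V : lmodType C) (f : V -> C).
Hypothesis f_lin : scalar f.

Lemma scalar_map0 : f 0 = 0.
Proof. by have := f_lin (-1) 0 0; rewrite scaler0 addr0 mulN1r addNr. Qed.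

Lemma scalar_mapD x y : f (x + y) = f x + f y.
Proof. by rewrite -[x]scale1r f_lin mul1r scale1r. Qed.

Lemma scalar_mapZ c x : f (c *: x) = c * f x.
Proof. by rewrite -[c *: x]addr0 f_lin scalar_map0 addr0. Qed.

Lemma scalar_mapB x y : f (x - y) = f x - f y.
Proof. by rewrite -scaleN1r scalar_mapD scalar_mapZ mulN1r. Qed.

Lemma scalar_map_sum (I : Type) (r : seq I) (P : pred I) (F : I -> V) :
  f (\sum_(i <- r | P i) F i) = \sum_(i <- r | P i) f (F i).
Proof. exact: (big_morph f scalar_mapD scalar_map0). Qed.

End ScalarMaps.

(** * Laws of the form and uniqueness of the trace *)

Section Laws.
Variables (R : realType) (D : R) (sq : int -> R).
Hypotheses (D_gt1 : 1 < D) (sq1 : sq 1 = 1) (sq_ge0 : forall z, 0 <= sq z).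
Hypothesis sq_eigen : forall z, sq z != 0 ->
  sq (z - 1) ^+ 2 + sq z ^+ 2 + sq (z + 1) ^+ 2 = D * sq z ^+ 2.
Variable K : forall n, submodClosed (motz R n).
Hypothesis K_mrad : forall n x, x \in K n -> x \in @mrad R D n.

Local Notation C := R[i].
Local Notation A := (union_algebra D K).
Local Notation Op := (wave_op sq).
Local Notation "x ** y" := (sa_mul x y) (at level 40, left associativity).
Local Notation star := (@sa_star C A).
Local Notation one := (sa_one A).
Local Notation cls n x := (@union_class R K n x : A).
Local Notation rep := (@rep R D sq K).
Local Notation phi := (@phi R D K).
Local Notation form := (gns_form phi).

Let rep_class := rep_class D_gt1 sq1 sq_ge0 sq_eigen K_mrad.
Let rep_mul := rep_mul D_gt1 sq1 sq_ge0 sq_eigen K_mrad.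
Let rep_lin := rep_lin D_gt1 sq1 sq_ge0 sq_eigen K_mrad.
Let rep_star := rep_star D_gt1 sq1 sq_ge0 sq_eigen K_mrad.
Let rep_starK := rep_starK D_gt1 sq1 sq_ge0 sq_eigen K_mrad.
Let rep_star_mul := rep_star_mul D_gt1 sq1 sq_ge0 sq_eigen K_mrad.
Let rep_one := rep_one D_gt1 sq1 sq_ge0 sq_eigen K_mrad.
Let rep_one_l := rep_one_l D_gt1 sq1 sq_ge0 sq_eigen K_mrad.
Let rep_one_r := rep_one_r D_gt1 sq1 sq_ge0 sq_eigen K_mrad.
Let eq_rep_star := eq_rep_star D_gt1 sq1 sq_ge0 sq_eigen K_mrad.
Let eq_phi := @eq_phi R D sq D_gt1 sq1 sq_ge0 sq_eigen K.
Let phi_rep := phi_rep D_gt1 sq1 sq_ge0 sq_eigen.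
Let phi_tr := phi_tr D_gt1 sq1 sq_ge0 sq_eigen K_mrad.
Let phi_star := phi_star D_gt1 sq1 sq_ge0 sq_eigen K_mrad.
Let phi_linear := phi_linear D_gt1 sq1 sq_ge0 sq_eigen K_mrad.
Let phi_one := phi_one D_gt1 sq1 sq_ge0 sq_eigen K_mrad.

Lemma eq_form (x x' y y' : A) : rep x = rep x' -> rep y = rep y' -> form x y = form x' y'.
Proof. by move=> xx yy; apply: eq_phi; rewrite !rep_mul xx (eq_rep_star yy). Qed.

Lemma formP c x y z : form (c *: x + y) z = c * form x z + form y z.
Proof.
rewrite -phi_linear; apply: eq_phi; apply/funext => F; apply/funext => al.
rewrite rep_mul rep_lin !rep_mul /= -rep_wave_lin.
by congr rep; apply/funext => be; rewrite rep_lin.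
Qed.

Lemma formC x y : form y x = ((form x y)^*)%R.
Proof.
by rewrite -phi_star; apply: eq_phi; rewrite rep_mul rep_star_mul rep_starK.
Qed.

Lemma rep_mul_lin a c x y : rep (a ** (c *: x + y)) = rep (c *: (a ** x) + a ** y).
Proof.
apply/funext => F; apply/funext => al; rewrite rep_mul rep_lin !rep_mul /= -rep_wave_lin.
by congr rep; apply/funext => be; rewrite rep_lin.
Qed.

Lemma rep_star_one : rep (star one) = rep one.
Proof.
have /eq_rep_star : rep (one ** star one) = rep (star one) by rewrite rep_mul rep_one_l.
by rewrite rep_star_mul rep_starK rep_one_l.
Qed.

Lemma form_one_r x : form x one = phi x.
Proof. by apply: eq_phi; rewrite rep_mul rep_star_one rep_one_l. Qed.

Lemma formAl a x y : form (a ** x) y = form x (star a ** y).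
Proof. by apply: eq_phi; rewrite !rep_mul rep_star_mul rep_starK compA. Qed.

Lemma formAr a x y : form (x ** a) y = form x (y ** star a).
Proof.
rewrite /gns_form (@eq_phi (star y ** (x ** a)) ((star y ** x) ** a)) ?rep_mul ?compA //.
by rewrite phi_tr; apply: eq_phi; rewrite !rep_mul rep_star_mul rep_starK compA.
Qed.

(** The level is read off the operator, so it depends on no representative and passes to products
    and stars. *)
Definition has_level n (x : A) : Prop := exists v : motz R n, rep x = Op v.

Lemma has_level_class n m (v : motz R n) : (n <= m)%N -> has_level m (cls n v).
Proof. by move=> nm; exists (mwiden m v); rewrite Op_mwiden // rep_class. Qed.

Lemma has_level_mul n x y : has_level n x -> has_level n y -> has_level n (x ** y).
Proof.
move=> [v xv] [w yw]; exists (mmul D v w).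
by rewrite rep_mul xv yw (Op_mmul sq1 sq_ge0 sq_eigen).
Qed.

Lemma has_level_star n x : has_level n x -> has_level n (star x).
Proof. by move=> [v xv]; exists (mstar v); apply: rep_star. Qed.

Lemma has_level_le n m x : (n <= m)%N -> has_level n x -> has_level m x.
Proof. by move=> nm [v xv]; exists (mwiden m v); rewrite Op_mwiden. Qed.

Lemma has_levelP x : exists n, has_level n x.
Proof. by exists (tag (repr (x : tower_union K))), (tagged (repr (x : tower_union K))). Qed.

Definition dot i : A := cls i.+1 (dotv R i).
Definition shift i : A := cls i.+2 (shiftv R i).

Lemma rep_dot i F al : rep (dot i) F al = (legal sq al && (steps al i == 0))%:R * F al.
Proof. by rewrite rep_class Op_dot. Qed.

Lemma dot_idem i : rep (dot i ** dot i) = rep (dot i).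
Proof.
apply/funext => F; apply/funext => al; rewrite rep_mul /= !rep_dot mulrA -natrM mulnb.
by rewrite andbb.
Qed.

Lemma shift_starK i : rep (star (shift i) ** shift i) = rep (dot i).
Proof.
rewrite rep_mul (rep_star (rep_class _)) !rep_class.
exact: (shift_star_shift sq D_gt1 i).
Qed.

Lemma shiftK_star i : rep (shift i ** star (shift i)) = rep (dot i.+1).
Proof.
rewrite rep_mul (rep_star (rep_class _)) !rep_class.
exact: (shift_shift_star sq D_gt1 i).
Qed.

Lemma shift_commute n x i : has_level n x -> (n <= i)%N -> rep (shift i ** x) = rep (x ** shift i).
Proof. by move=> [v xv] ni; rewrite !rep_mul xv rep_class; apply/esym/(Op_shift_commute sq D_gt1). Qed.

Lemma dot_star i : rep (star (dot i)) = rep (dot i).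
Proof.
rewrite -[RHS]shift_starK -(eq_rep_star (shift_starK i)).
by rewrite rep_star_mul rep_starK rep_mul.
Qed.

Lemma phi_dot n x i : has_level n x -> (n <= i)%N -> phi (x ** dot i) = D%:C^-1 * phi x.
Proof.
move=> [v xv] ni; rewrite (phi_rep xv) -(mtr_dot D_gt1 sq1 sq_ge0 sq_eigen v ni).
apply: phi_rep; rewrite rep_mul (Op_mmul sq1 sq_ge0 sq_eigen) xv rep_class.
by rewrite Op_mwiden // ltnW.
Qed.

Let form_scalar y : scalar (form ^~ y). Proof. by move=> c x x'; apply: formP. Qed.

Lemma form_suml (I : Type) (r : seq I) (F : I -> A) y :
  form (\sum_(i <- r) F i) y = \sum_(i <- r) form (F i) y.
Proof. exact: (scalar_map_sum (form_scalar y)). Qed.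

Lemma form_sumr (I : Type) (r : seq I) (F : I -> A) x :
  form x (\sum_(i <- r) F i) = \sum_(i <- r) form x (F i).
Proof. by rewrite formC form_suml rmorph_sum; apply: eq_bigr => i _; rewrite [RHS]formC. Qed.

Lemma has_level_one n : has_level n one.
Proof. by apply: (has_level_le (leq0n n)); exists (mone R 0); apply: rep_one. Qed.

Lemma form_one_one : form one one = 1.
Proof. by rewrite form_one_r phi_one. Qed.

Lemma phi_dot1 i : phi (dot i) = D%:C^-1.
Proof.
rewrite (@eq_phi _ (one ** dot i)); last by rewrite rep_mul rep_one_l.
by rewrite (phi_dot (has_level_one 0)) // phi_one mulr1.
Qed.

Lemma form_dot_dot i j : form (dot i) (dot j) = if i == j then D%:C^-1 else D%:C^-1 ^+ 2.
Proof.
have -> : form (dot i) (dot j) = phi (dot j ** dot i).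
  by apply: eq_phi; rewrite !rep_mul dot_star.
have [->|ij] := eqVneq i j; first by rewrite (eq_phi (dot_idem j)) phi_dot1.
have lt a b : (a < b)%N -> phi (dot a ** dot b) = D%:C^-1 ^+ 2.
  by move=> ab; rewrite (phi_dot (has_level_class (dotv R a) ab)) // phi_dot1.
by case: (ltngtP i j) ij => // ij _; [rewrite phi_tr lt|rewrite lt].
Qed.

Let realD : (D%:C^*)%R = D%:C :> C.
Proof. by rewrite -[LHS]/(conjc D%:C) conjc_real. Qed.

Let D_neq0 : D%:C != 0 :> C.
Proof. by rewrite fmorph_eq0 gt_eqF // (lt_trans _ D_gt1). Qed.

Definition fluct i : A := D%:C *: dot i - one.

Lemma form_fluct i j : form (fluct i) (fluct j) = if i == j then D%:C - 1 else 0.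
Proof.
have E x y : form (D%:C *: x - one) y = D%:C * form x y - form one y.
  by rewrite (scalar_mapB (form_scalar y)) (scalar_mapZ (form_scalar y)).
have E' x y : form x (D%:C *: y - one) = D%:C * form x y - form x one.
  by rewrite formC E rmorphB rmorphM /= realD -!formC.
have d1 k : form (dot k) one = D%:C^-1 by rewrite form_one_r phi_dot1.
have d1' k : form one (dot k) = D%:C^-1 by rewrite formC d1 fmorphV /= realD.
rewrite /fluct E !E' d1 d1' form_one_one form_dot_dot.
by case: eqP => _; field; apply: D_neq0.
Qed.

(* Law of large numbers: the centred projections [fluct j] are orthogonal and of constant norm. *)
Lemma mean_dot (psi : A -> C) n c s : scalar psi ->
  (forall y, `|psi y| ^+ 2 <= c * form y y) -> (forall j, (n <= j)%N -> psi (dot j) = s) ->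
  s = D%:C^-1 * psi one.
Proof.
move=> psi_lin psi_bd psi_dot.
have psiB x y : psi (D%:C *: x - y) = D%:C * psi x - psi y.
  by rewrite (scalar_mapB psi_lin) (scalar_mapZ psi_lin).
have c0 : 0 <= c.
  have := psi_bd one; rewrite form_one_one mulr1; apply: le_trans.
  by rewrite exprn_ge0.
suff : `|D%:C * s - psi one| ^+ 2 = 0.
  move/eqP; rewrite sqrf_eq0 normr_eq0 subr_eq0 => /eqP <-.
  by rewrite mulKf.
(* A sum of [N] fluctuations has squared norm [N * (D - 1)], while [psi] takes on it the value
   [N * (D * s - psi 1)]. The bound on [psi] therefore keeps [N * |D * s - psi 1| ^+ 2] below
   [c * (D - 1)]. *)
apply: (@nat_mul_bounded _ _ (c * (D%:C - 1))) => [|N]; first by rewrite exprn_ge0.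
case: N => [|N].
  by rewrite mul0r mulr_ge0 // subr_ge0 -(rmorph1 (real_complex R)) lecR ltW.
pose S := \sum_(0 <= i < N.+1) fluct (n + i).
have psiS : psi S = N.+1%:R * (D%:C * s - psi one).
  rewrite /S (scalar_map_sum psi_lin).
  rewrite (eq_bigr (fun=> D%:C * s - psi one)) => [|i _]; last by rewrite psiB psi_dot ?leq_addr.
  by rewrite sumr_const_nat subn0 mulr_natl.
have formS : form S S = N.+1%:R * (D%:C - 1).
  rewrite /S form_suml (eq_big_nat _ _ (F2 := fun=> D%:C - 1)) => [|i /andP[_ iN]].
    by rewrite sumr_const_nat subn0 mulr_natl.
  rewrite form_sumr (bigD1_seq i) ?mem_index_iota ?iota_uniq //= form_fluct eqxx.
  rewrite big1 ?addr0 // => j ji; rewrite form_fluct eqn_add2l eq_sym.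
  by rewrite (negbTE ji).
have := psi_bd S; rewrite psiS formS normrM exprMn normr_nat => H.
have N0 : 0 < N.+1%:R :> C by rewrite ltr0n.
rewrite -(ler_pM2l N0); apply: le_trans (_ : c * (N.+1%:R * (D%:C - 1)) <= _); last by rewrite mulrCA.
by apply: le_trans H; rewrite expr2 mulrA.
Qed.

Section Uniqueness.
Variable tau : A -> C.
Hypotheses (tau_lin : scalar tau) (tau_tr : forall x y, tau (x ** y) = tau (y ** x)).
Hypothesis tau_rep : forall x y, rep x = rep y -> tau x = tau y.

(** With [s := shift i] the dot at [i] is [s^* s]; traciality brings [s] to the front, where it
    commutes with [x], and [s s^*] is the dot at [i.+1]. *)
Lemma tau_shift n x i : has_level n x -> (n <= i)%N -> tau (x ** dot i.+1) = tau (x ** dot i).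
Proof.
move=> xn ni.
rewrite (@tau_rep (x ** dot i) ((x ** star (shift i)) ** shift i)); last first.
  by rewrite rep_mul -shift_starK !rep_mul compA.
rewrite [RHS]tau_tr; apply: tau_rep; have := shift_commute xn ni; rewrite !rep_mul => E.
by rewrite -shiftK_star rep_mul !compA E.
Qed.

Lemma tau_dot_const n x i : has_level n x -> (n <= i)%N -> tau (x ** dot i) = tau (x ** dot n).
Proof.
move=> xn ni; rewrite -(subnK ni) addnC; elim: (i - n)%N => [|k IH]; first by rewrite addn0.
by rewrite addnS (tau_shift xn) ?leq_addr.
Qed.

Lemma tau_mul_lin a c x y : tau (a ** (c *: x + y)) = c * tau (a ** x) + tau (a ** y).
Proof. by rewrite -tau_lin; apply: tau_rep; apply: rep_mul_lin. Qed.

(** This is [mean_dot] for the functional [y |-> tau (x ** y)], which is bounded because left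
    multiplication by [x] is. *)
Lemma tau_dot c n x i : (forall y, `|tau y| ^+ 2 <= c * form y y) ->
  has_level n x -> (n <= i)%N -> tau (x ** dot i) = D%:C^-1 * tau x.
Proof.
move=> tau_bd xn ni; rewrite (tau_dot_const xn ni).
have c0 : 0 <= c.
  by have := tau_bd one; rewrite form_one_one mulr1; apply: le_trans; rewrite exprn_ge0.
have [c' c'0 bd] := phi_bounded D_gt1 sq1 sq_ge0 sq_eigen K_mrad x.
rewrite (@mean_dot (fun y => tau (x ** y)) n (c * c') (tau (x ** dot n))); last 3 first.
- by move=> e y z; apply: tau_mul_lin.
- move=> y; apply: le_trans (tau_bd _) _; rewrite -mulrA; apply: ler_wpM2l => //.
  exact: bd.
- by move=> j nj; apply: tau_dot_const.
by congr (_ * _); apply: tau_rep; rewrite rep_mul rep_one_r.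
Qed.

End Uniqueness.

Section Vanishing.
Variable tau : A -> C.
Hypotheses (tau_lin : scalar tau) (tau_tr : forall x y, tau (x ** y) = tau (y ** x)).
Hypothesis tau_rep : forall x y, rep x = rep y -> tau x = tau y.
Hypothesis tau_dot : forall n x, has_level n x -> tau (x ** dot n) = D%:C^-1 * tau x.
Hypothesis tau_one : tau one = 0.

Lemma tau_basis n (a b : A) : (forall d : mdiag n, tau (a ** (cls n (mbasis R d) ** b)) = 0) ->
  forall v : motz R n, tau (a ** (cls n v ** b)) = 0.
Proof.
move=> H v; have lin : scalar (fun w : motz R n => tau (a ** (cls n w ** b))).
  move=> c w w'; rewrite -tau_lin; apply: tau_rep.
  apply/funext => F; apply/funext => al; rewrite rep_lin !rep_mul /= -rep_wave_lin.
  by congr rep; apply/funext => be; rewrite !rep_class Op_linear.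
have -> : v = \sum_(d : mdiag n) v d *: mbasis R d by apply: motz_sum_basis.
rewrite (scalar_map_sum lin) big1 // => d _; rewrite (scalar_mapZ lin) H mulr0 //.
Qed.

(** Conjugation by shifts moves the dot to the last strand while [z] stays of level [k.+1]. There
    the compression of a diagram is an element of level [k] times [dot k], so [tau] of it is [D^-1]
    times a value that vanishes by hypothesis. *)
Lemma tau_corner k i z : (forall v : motz R k, tau (cls k v) = 0) -> (i <= k)%N ->
  has_level k.+1 z -> tau (dot i ** (z ** dot i)) = 0.
Proof.
move=> IH ik; rewrite -(subKn ik); move: (leq_subr i k); move: (k - i)%N => m.
elim: m z => [|m IHm] z mk [v zv].
  rewrite subn0 (@tau_rep _ (dot k ** (cls k.+1 v ** dot k))); last first.
    by rewrite !rep_mul zv rep_class.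
  apply: tau_basis => d.
  rewrite (@tau_rep _ (cls k (mbasis R (restrict d)) ** dot k)); last first.
    by rewrite !rep_mul !rep_class compA (Op_restrict sq d).
  by rewrite (tau_dot (has_level_class _ (leqnn k))) IH mulr0.
pose j := (k - m.+1)%N; have jk : (j.+2 <= k.+1)%N by rewrite /j; lia.
have kj : (k - m)%N = j.+1 by rewrite /j; lia.
have ls : has_level k.+1 (shift j) by apply: has_level_class.
have ls' := has_level_star ls.
have := IHm ((shift j ** z) ** star (shift j)) (ltnW mk); rewrite kj => <-; last first.
  by apply: has_level_mul => //; apply: has_level_mul => //; exists v.
rewrite -/j; set l := shift j; set w := dot j.+1 ** _.
rewrite (@tau_rep _ (star l ** (w ** l))); last first.
  have P F : rep (star l) (rep l F) = rep (dot j) F by rewrite -shift_starK rep_mul.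
  have Q F : rep (dot j.+1) F = rep l (rep (star l) F) by rewrite -shiftK_star rep_mul.
  have I F : rep (dot j) (rep (dot j) F) = rep (dot j) F.
    by rewrite -[RHS](congr1 (fun f => f F) (dot_idem j)) rep_mul.
  by apply/funext => F; rewrite /w !rep_mul /= !Q !P !I.
rewrite tau_tr; apply: tau_rep; rewrite !rep_mul -!compA.
have Q : rep l \o rep (star l) = rep (dot j.+1) by rewrite -rep_mul shiftK_star.
have I : rep (dot j.+1) \o rep (dot j.+1) = rep (dot j.+1) by rewrite -rep_mul dot_idem.
by rewrite Q I.
Qed.

Lemma tau_level k (v : motz R k) : tau (cls k v) = 0.
Proof.
have reduce n (x : motz R n) : tau (one ** (cls n x ** one)) = tau (cls n x).
  by apply: tau_rep; rewrite !rep_mul rep_one_r rep_one_l.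
elim: k v => [|k IH] v; rewrite -reduce; apply: tau_basis => d; rewrite reduce.
  rewrite (@tau_rep _ one) // rep_class rep_one /mone; congr (Op (mbasis R _)).
  by apply/ffunP => -[s []].
have [->|nv] := eqVneq (matching d) (vertical k.+1).
  by rewrite (@tau_rep _ one) // rep_class rep_one Op_vertical.
have [i [b [ik E]]] := Op_reducible sq1 nv.
pose e := cls k.+1 (mbasis R d).
have di : rep (cls k.+1 (mbasis R (dot_diag k.+1 i))) = rep (dot i).
  apply/funext => F; apply/funext => al; rewrite rep_class rep_dot Op_dot_level //.
have I F : rep (dot i) (rep (dot i) F) = rep (dot i) F.
  by rewrite -[RHS](congr1 (fun f => f F) (dot_idem i)) rep_mul.
(* Doubling the idempotent dot and rotating the product encloses it between two dots, as
   [tau_corner] requires. *)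
rewrite (@tau_rep _ ((e ** dot i) ** (dot i ** cls k.+1 b))); last first.
  apply/funext => F; rewrite !rep_mul /= I -di /e !rep_class.
  exact: (congr1 (fun f => f F) E).
rewrite tau_tr (@tau_rep _ (dot i ** ((cls k.+1 b ** e) ** dot i))); last first.
  by rewrite !rep_mul !compA.
apply: (@tau_corner k) => //; apply: has_level_mul; apply: has_level_class; exact: leqnn.
Qed.

Lemma tau_zero x : tau x = 0.
Proof.
rewrite -(tau_level (tagged (repr (x : tower_union K)))); apply: tau_rep.
by rewrite rep_class.
Qed.

End Vanishing.

Lemma trace_unique (tau : A -> C) : scalar tau -> (forall x y, tau (x ** y) = tau (y ** x)) ->
  (exists c, forall x, `|tau x| ^+ 2 <= c * form x x) ->
  forall x, tau x = tau one * form x one.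
Proof.
move=> tau_lin tau_tr [c tau_bd] x.
(* The bound makes [tau] vanish on null vectors, hence depend on the operator only. *)
have tau_rep y z : rep y = rep z -> tau y = tau z.
  move=> yz; apply/eqP; rewrite -subr_eq0 -(scalar_mapB tau_lin) -normr_eq0 -sqrf_eq0 eq_le.
  rewrite exprn_ge0 // andbT; apply: le_trans (tau_bd _) _.
  rewrite (scalar_mapB (form_scalar _)) (eq_form yz (erefl (rep (y - z)))).
  by rewrite subrr mulr0.
pose tau' y := tau y - tau one * phi y.
have phiB := scalar_mapB phi_linear; have tau0 : tau' x = 0.
  apply: tau_zero; rewrite /tau'.
  - by move=> a y z; rewrite tau_lin phi_linear; ring.
  - by move=> y z; rewrite tau_tr phi_tr.
  - by move=> y z yz; rewrite (tau_rep _ _ yz) (eq_phi yz).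
  - move=> n y yn; rewrite (tau_dot tau_lin tau_tr tau_rep tau_bd yn) // (phi_dot yn) //.
    by ring.
  - by rewrite phi_one mulr1 subrr.
by rewrite form_one_r; apply/eqP; rewrite -subr_eq0; apply/eqP.
Qed.

Fixpoint dots m j : A := if m is m'.+1 then dots m' j ** dot (j + m') else one.

Lemma rep_dots m j F al : rep (dots m j) F al =
  (legal sq al && [forall i : 'I_m, steps al (j + i) == 0])%:R * F al.
Proof.
elim: m F al => [|m IH] F al /=.
  rewrite rep_one Op_mone //; congr (_%:R * _); congr nat_of_bool.
  by case: (legal sq al) => //=; apply/esym/forallP => -[].
rewrite rep_mul /= IH rep_dot mulrA -natrM mulnb; congr (_%:R * _); congr nat_of_bool.
have [leg|] := boolP (legal sq al) => //=.
apply/andP/forallP => [[/forallP H /eqP Hm] i|H]; last first.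
  by split; [apply/forallP => i; apply: (H (widen_ord (leqnSn m) i))|apply: (H ord_max)].
have [im|mi] := ltnP i m; first exact: (H (Ordinal im)).
by rewrite (_ : (i : nat) = m) ?Hm //; have := ltn_ord i; lia.
Qed.

Lemma dots_commute m j i : rep (dots m j ** dot i) = rep (dot i ** dots m j).
Proof.
apply/funext => F; apply/funext => al; rewrite !rep_mul /= rep_dots !rep_dot rep_dots.
by rewrite mulrCA.
Qed.

Lemma dots_star m j : rep (star (dots m j)) = rep (dots m j).
Proof.
elim: m => [|m IH] /=; first exact: rep_star_one.
by rewrite rep_star_mul IH dot_star dots_commute rep_mul.
Qed.

Lemma dots_idem m j : rep (dots m j ** dots m j) = rep (dots m j).
Proof.
apply/funext => F; apply/funext => al; rewrite rep_mul /= !rep_dots mulrA -natrM mulnb.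
by rewrite andbb.
Qed.

(** Each further dot lies beyond the level of the product before it, so [phi_dot] applies [m]
    times. *)
Lemma phi_dots m n j x : has_level n x -> (n <= j)%N -> phi (x ** dots m j) = D%:C ^- m * phi x.
Proof.
move=> xn nj; elim: m => [|m IH] /=.
  by rewrite expr0 invr1 mul1r; apply: eq_phi; rewrite rep_mul rep_one_r.
have lev : has_level (j + m) (x ** dots m j).
  apply: has_level_mul; first exact: has_level_le (leq_trans nj (leq_addr _ _)) xn.
  elim: (m) => [|k IHk] /=; first exact: has_level_one.
  by rewrite addnS; apply: has_level_mul; [apply: has_level_le IHk|apply: has_level_class].
rewrite (@eq_phi _ ((x ** dots m j) ** dot (j + m))); last by rewrite !rep_mul compA.
by rewrite (phi_dot lev) // IH mulrA exprS invfM.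
Qed.

Lemma union_trace_laws : trace_laws D (@phi).
Proof.
split.
- exact: formP.
- exact: formC.
- exact: (phi_ge0 D_gt1 sq1 sq_ge0 sq_eigen K_mrad).
- exact: (phi_bounded D_gt1 sq1 sq_ge0 sq_eigen K_mrad).
- by move=> a c x y z; rewrite -formP; apply: eq_form => //; apply: rep_mul_lin.
- by move=> a b x z; apply: eq_form => //; rewrite !rep_mul compA.
- by move=> a z; apply: eq_form => //; rewrite rep_mul rep_one_r.
- by move=> a z; apply: eq_form => //; rewrite rep_mul rep_one_l.
- exact: formAl.
- exact: formAr.
- by move=> x y; apply: phi_tr.
- by move=> x y; apply: eq_form => //; apply: rep_starK.
- by move=> x y z; apply: eq_form => //; rewrite rep_star_mul rep_mul.
- exact: form_one_one.
- exact: trace_unique.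
move=> m; exists (dots m); split=> [j x y|j x y|a].
- by rewrite formAl; apply: eq_form => //; rewrite !rep_mul dots_star.
- by apply: eq_form => //; rewrite !rep_mul compA -rep_mul dots_idem.
have [n an] := has_levelP a; exists n => j nj.
rewrite form_one_r -(phi_dots m an nj) [form _ _]phi_tr.
by apply: eq_phi; rewrite !rep_mul dots_star.
Qed.

End Laws.

(** * Hilbert spaces *)

Section Epsilon.
Variable R : realType.
Local Notation C := R[i].
Implicit Types a b c x : C.

(** Estimates linear in [e] replace limits in what follows; the restriction [e <= 1] lets quadratic
    error terms be absorbed in [c]. *)
Lemma squeeze0 c x : 0 <= x -> (forall e : C, 0 < e -> e <= 1 -> x <= c * e) -> x = 0.
Proof.
move=> x0 H; apply: (@nat_mul_bounded _ x c) => // -[|N].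
  rewrite mul0r; apply: le_trans x0 _.
  by rewrite -[c]mulr1; apply: H.
have N0 : 0 < N.+1%:R :> C by rewrite ltr0n.
have := H (N.+1%:R^-1); rewrite invr_gt0 => /(_ N0).
rewrite invf_le1 // ler1n => /(_ isT).
by rewrite mulrC -ler_pdivrMl ?invr_gt0 // invrK.
Qed.

Lemma le_eps a b c : 0 <= a -> 0 <= b ->
  (forall e : C, 0 < e -> e <= 1 -> a <= b + c * e) -> a <= b.
Proof.
move=> a0 b0 H; have [//|ba] := real_leP (ger0_real a0) (ger0_real b0).
have : a - b = 0.
  apply: (@squeeze0 c) => [|e e0 e1]; first by rewrite subr_ge0 ltW.
  by rewrite lerBlDl H.
by move=> E; rewrite -subr_gt0 E ltxx in ba.
Qed.

Lemma inv_nat_small (e : C) : 0 < e -> exists N, forall n, (N <= n)%N -> n.+1%:R^-1 <= e.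
Proof.
move=> e0; apply: contrapT => /forallNP H.
have : e = 0.
  apply: (@nat_mul_bounded _ e 1) => [|N]; first exact: ltW.
  have /existsNP[n /not_implyP[Nn /negP nle]] := H N.
  have n0 : 0 < n.+1%:R :> C by rewrite ltr0n.
  have en : e <= n.+1%:R^-1.
    have := real_leP (ger0_real (ltW e0)) (ger0_real (_ : 0 <= n.+1%:R^-1 :> C)).
    rewrite invr_ge0 ler0n => /(_ isT) [//|lt]; move: nle; rewrite ltW //.
  apply: (@le_trans _ _ (n.+1%:R * e)).
    by rewrite ler_pM2r // ler_nat ltnW.
  by rewrite mulrC -ler_pdivlMr // mul1r.
by move=> e00; rewrite e00 ltxx in e0.
Qed.

Definition cauchy_seq (V : normedZmodType C) (u : nat -> V) : Prop :=
  forall e : C, 0 < e -> exists N, forall n m, (N <= n)%N -> (N <= m)%N -> `|u n - u m| <= e.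

Definition converges (V : normedZmodType C) (u : nat -> V) (l : V) : Prop :=
  forall e : C, 0 < e -> exists N, forall n, (N <= n)%N -> `|l - u n| <= e.

Lemma cauchy_seq_rate (V : normedZmodType C) (u : nat -> V) (k : C) : 0 <= k ->
  (forall n m, `|u n - u m| <= k * (n.+1%:R^-1 + m.+1%:R^-1)) -> cauchy_seq u.
Proof.
move=> k0 H e e0; have k1 : 0 < 2 * (k + 1) by rewrite mulr_gt0 // ltr_wpDl.
have [N HN] := inv_nat_small (divr_gt0 e0 k1).
exists N => n m Nn Nm; apply: le_trans (H n m) _.
apply: (@le_trans _ _ ((k + 1) * (e / (2 * (k + 1)) + e / (2 * (k + 1))))).
  apply: ler_pM; rewrite ?addr_ge0 ?invr_ge0 ?lerDl //.
  by apply: lerD; apply: HN.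
have k10 : k + 1 != 0 by rewrite gt_eqF // ltr_wpDl.
by rewrite (_ : _ * _ = e) //; field; rewrite k10.
Qed.

Lemma complete_converges (H : completeNormedModType C) (u : nat -> H) :
  cauchy_seq u -> exists l, converges u l.
Proof.
move=> cu; have /cauchy_cvg/cvg_ex[l ul] : cauchy (u @ \oo)%classic.
  apply/cauchyP => e e0; have e20 : 0 < e / 2 by rewrite divr_gt0.
  have [N HN] := cu _ e20; exists (u N); exists N => //= n /= Nn.
  rewrite -ball_normE /ball_ /=; apply: le_lt_trans (HN _ _ (leqnn N) Nn) _.
  by rewrite ltr_pdivrMr // ltr_pMr // ltr1n.
exists l => e e0; have /cvgrPdist_le/(_ e e0)[N _ HN] := ul.
by exists N => n Nn; apply: HN.
Qed.

Lemma normc_Re_le (z : C) : `|complex.Re z|%:C <= `|z|.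
Proof. by case: z => a b; rewrite normc_def /= lecR -sqrtr_sqr ler_wsqrtr // lerDl sqr_ge0. Qed.

Lemma normc_Im_le (z : C) : `|complex.Im z|%:C <= `|z|.
Proof. by case: z => a b; rewrite normc_def /= lecR -sqrtr_sqr ler_wsqrtr // lerDr sqr_ge0. Qed.

Lemma real_cauchy (u : nat -> R) :
  (forall e : R, 0 < e -> exists N, forall n m, (N <= n)%N -> (N <= m)%N -> `|u n - u m| <= e) ->
  exists l, forall e : R, 0 < e -> exists N, forall n, (N <= n)%N -> `|l - u n| <= e.
Proof.
move=> cu; have /R_complete/cvg_ex[l ul] : cauchy (u @ \oo)%classic.
  apply/cauchyP => e e0; have e20 : 0 < e / 2 by rewrite divr_gt0.
  have [N HN] := cu _ e20; exists (u N); exists N => //= n /= Nn.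
  rewrite -ball_normE /ball_ /=; apply: le_lt_trans (HN _ _ (leqnn N) Nn) _.
  by rewrite ltr_pdivrMr // ltr_pMr // ltr1n.
exists l => e e0; have /cvgrPdist_le/(_ e e0)[N _ HN] := ul.
by exists N => n Nn; apply: HN.
Qed.

Lemma complex_converges (u : nat -> C) : cauchy_seq u -> exists l, converges u l.
Proof.
move=> cu; have cuR (f : C -> R) : (forall z w, f (z - w) = f z - f w) ->
    (forall z, `|f z|%:C <= `|z|) -> exists l, forall e : R, 0 < e ->
      exists N, forall n, (N <= n)%N -> `|l - f (u n)| <= e.
  move=> fB fle; apply: real_cauchy => e e0.
  have [|N HN] := cu e%:C; first by rewrite ltcR.
  exists N => n m Nn Nm; rewrite -lecR -fB; apply: le_trans (fle _) _.
  exact: HN.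
have [a Ha] := cuR _ (raddfB (@complex.Re R)) normc_Re_le.
have [b Hb] := cuR _ (raddfB (@complex.Im R)) normc_Im_le.
exists (a +i* b) => e e0.
have [r r0 re] : exists2 r : R, 0 < r & e = r%:C.
  by case: e e0 => r s; rewrite ltcE /= => /andP[/eqP -> r0]; exists r.
have r20 : 0 < r / 2 by rewrite divr_gt0.
have [N HN] := Ha _ r20; have [M HM] := Hb _ r20.
exists (maxn N M) => n; rewrite geq_max => /andP[/HN na /HM nb].
rewrite {}re; have -> : a +i* b - u n = (a - complex.Re (u n))%:C + 'i%C * (b - complex.Im (u n))%:C.
  by case: (u n) => c d /=; apply/eqP; rewrite eq_complex /=; apply/andP; split; apply/eqP; ring.
apply: le_trans (ler_normD _ _) _.
have nR (x : R) : `|x%:C| = `|x|%:C :> C by rewrite normc_def /= expr0n /= addr0 sqrtr_sqr.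
have ni : `|'i%C| = 1 :> C by rewrite normc_def /= expr0n /= add0r expr1n sqrtr1.
rewrite normrM ni mul1r !nR -(rmorphD (real_complex R)) lecR /=.
by apply: le_trans (lerD na nb) _; rewrite -splitr.
Qed.

End Epsilon.

(** Definiteness is left out because [gns_form] may have null vectors; [hdot] and [cdot] are treated
    by the same theory. *)
Record semi_inner (R : realType) (V : lmodType R[i]) (g : V -> V -> R[i]) : Prop := SemiInner {
  ip_lin : forall c x y z, g (c *: x + y) z = c * g x z + g y z ;
  ip_conj : forall x y, g y x = ((g x y)^*)%R ;
  ip_ge0 : forall x, 0 <= g x x }.

Section SemiInnerTheory.
Variables (R : realType) (V : lmodType R[i]) (g : V -> V -> R[i]).
Hypothesis gP : semi_inner g.
Local Notation C := R[i].

Lemma ip_scalar z : scalar (g^~ z). Proof. by move=> c x y; apply: (ip_lin gP). Qed.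
Lemma ip0l z : g 0 z = 0. Proof. exact: (scalar_map0 (ip_scalar z)). Qed.
Lemma ipDl x y z : g (x + y) z = g x z + g y z. Proof. exact: (scalar_mapD (ip_scalar z)). Qed.
Lemma ipBl x y z : g (x - y) z = g x z - g y z. Proof. exact: (scalar_mapB (ip_scalar z)). Qed.
Lemma ipZl c x z : g (c *: x) z = c * g x z. Proof. exact: (scalar_mapZ (ip_scalar z)). Qed.
Lemma ipDr x y z : g z (x + y) = g z x + g z y.
Proof. by rewrite !(ip_conj gP _ z) ipDl rmorphD. Qed.
Lemma ipBr x y z : g z (x - y) = g z x - g z y.
Proof. by rewrite !(ip_conj gP _ z) ipBl rmorphB. Qed.
Lemma ipZr c x z : g z (c *: x) = (c^*)%R * g z x.
Proof. by rewrite !(ip_conj gP _ z) ipZl rmorphM. Qed.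

Lemma ip_square c x y : g (x - c *: y) (x - c *: y) =
  g x x - (c^*)%R * g x y - c * ((g x y)^*)%R + `|c| ^+ 2 * g y y.
Proof. by rewrite ipBl !ipBr !ipZl !ipZr normCK (ip_conj gP x y); ring. Qed.

Lemma ip_CS x y : `|g x y| ^+ 2 <= g x x * g y y.
Proof.
set d := g x y; have [q0|q0] := eqVneq (g y y) 0.
  suff -> : `|d| ^+ 2 = 0 by rewrite q0 mulr0.
  apply: (@nat_mul_bounded _ _ (g x x)) => [|N]; first by rewrite exprn_ge0.
  (* For a null vector [y] the square is affine in the coefficient; the choice [N / 2 * d] turns it
     into [g x x - N * |d| ^+ 2], for every [N]. *)
  have := ip_ge0 gP (x - (N%:R / 2 * d) *: y); rewrite ip_square q0 mulr0 addr0 -/d.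
  rewrite !rmorphM /= fmorphV !rmorph_nat => H; rewrite -subr_ge0.
  by apply: le_trans H _; rewrite normCK le_eqVlt; apply/orP; left; apply/eqP; field.
have q1 : 0 < g y y by rewrite lt_def q0 (ip_ge0 gP).
have := ip_ge0 gP (x - (d / g y y) *: y); rewrite ip_square -/d rmorphM /= fmorphV /=.
have -> : ((g y y)^*)%R = g y y by rewrite -(ip_conj gP).
have -> : `|d / g y y| ^+ 2 * g y y = d * (d^*)%R / g y y.
  by rewrite normrM exprMn normrV ?unitfE // (gtr0_norm q1) normCK; field.
rewrite -(ler_pM2r q1) mul0r => H; rewrite -subr_ge0; apply: le_trans H _.
by rewrite normCK le_eqVlt; apply/orP; left; apply/eqP; field.
Qed.

Definition ipn x : C := sqrtC (g x x).

Lemma ipn_ge0 x : 0 <= ipn x. Proof. by rewrite sqrtC_ge0 (ip_ge0 gP). Qed.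

Lemma ipn_sqr x : ipn x ^+ 2 = g x x. Proof. exact: sqrtCK. Qed.

Lemma ip_le x y : `|g x y| <= ipn x * ipn y.
Proof.
have h : 0 <= ipn x * ipn y by rewrite mulr_ge0 ?ipn_ge0.
by rewrite -(ler_pXn2r (ltn0Sn 1)) ?nnegrE // exprMn !ipn_sqr ip_CS.
Qed.

Lemma ipn_triangle x y : ipn (x + y) <= ipn x + ipn y.
Proof.
have h : 0 <= ipn x + ipn y by rewrite addr_ge0 ?ipn_ge0.
rewrite -(ler_pXn2r (ltn0Sn 1)) ?nnegrE ?ipn_ge0 // ipn_sqr ipDl !ipDr sqrrD !ipn_sqr.
have -> : g x x + g x y + (g y x + g y y) = g x x + (g x y + g y x) + g y y by ring.
rewrite lerD2r lerD2l -mulr_natl; have r : g x y + g y x \is Num.real.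
  by apply/CrealP; rewrite rmorphD /= -!(ip_conj gP) addrC.
apply: le_trans (real_ler_norm r) _; apply: le_trans (ler_normD _ _) _.
rewrite -[2]/(1 + 1) mulrDl !mul1r; apply: lerD; first exact: ip_le.
by rewrite mulrC ip_le.
Qed.

Lemma ipnZ c x : ipn (c *: x) = `|c| * ipn x.
Proof.
apply/eqP; rewrite -(@eqrXn2 _ 2) ?mulr_ge0 ?ipn_ge0 //.
by rewrite exprMn !ipn_sqr ipZl ipZr mulrA normCK.
Qed.

End SemiInnerTheory.

Section Hilbert.
Variables (R : realType) (H : hilbert R).
Local Notation C := R[i].
Local Notation "''[' u , v ]" := (hdot H u%R v%R) : ring_scope.
Implicit Types u v w : H.

Lemma hdot_semi : semi_inner (hdot H).
Proof.
split=> [c x y z|x y|x].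
- by rewrite linearPl.
- by rewrite hermC mul1r.
- exact: dnorm_ge0.
Qed.

Lemma hdotC u v : '[v, u] = ('[u, v]^*)%R. Proof. exact: (ip_conj hdot_semi). Qed.
Lemma hdotDl u v w : '[u + v, w] = '[u, w] + '[v, w]. Proof. exact: (ipDl hdot_semi). Qed.
Lemma hdotBl u v w : '[u - v, w] = '[u, w] - '[v, w]. Proof. exact: (ipBl hdot_semi). Qed.
Lemma hdotZl c u w : '[c *: u, w] = c * '[u, w]. Proof. exact: (ipZl hdot_semi). Qed.
Lemma hdotBr u v w : '[w, u - v] = '[w, u] - '[w, v]. Proof. exact: (ipBr hdot_semi). Qed.
Lemma hdot0l w : '[0, w] = 0. Proof. exact: (ip0l hdot_semi). Qed.
Lemma hdot_norm v : '[v, v] = `|v| ^+ 2. Proof. exact: hdotE. Qed.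

Lemma hdot_le u v : `|'[u, v]| <= `|u| * `|v|.
Proof.
have n w : ipn (hdot H) w = `|w|.
  by rewrite /ipn hdot_norm sqrCK.
by rewrite -!n; apply: (ip_le hdot_semi).
Qed.

Lemma hdot_eq u v : (forall w, '[u, w] = '[v, w]) -> u = v.
Proof.
move=> uv; apply/eqP; rewrite -subr_eq0 -normr_eq0 -sqrf_eq0 -hdot_norm.
by rewrite hdotBl uv subrr.
Qed.

Lemma bounded_opP (T : H -> H) : bounded_operators T <->
  linear T /\ exists2 c : C, 0 <= c & forall v, `|T v| <= c * `|v|.
Proof.
split=> -[lin]; pose T' : {linear H -> H} := HB.pack T (GRing.isLinear.Build C H H *:%R T lin).
  move/(linear_bounded_continuous T').2/(linear_boundedP T')/pinfty_ex_gt0 => [c c0 Tc].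
  by split=> //; exists c; [exact: ltW|exact: Tc].
case=> c c0 Tc; split=> //.
apply/(linear_bounded_continuous T')/(linear_boundedP T').
exists c; split; first exact: ger0_real.
by move=> r cr v; apply: le_trans (Tc v) _; rewrite ler_wpM2r // ltW.
Qed.

Lemma linear_op0 (T : H -> H) : linear T -> T 0 = 0.
Proof. by move=> lin; have := lin (-1) 0 0; rewrite scaler0 addr0 scaleN1r addNr. Qed.
Lemma linear_opD (T : H -> H) u v : linear T -> T (u + v) = T u + T v.
Proof. by move=> lin; rewrite -[u]scale1r lin !scale1r. Qed.
Lemma linear_opZ (T : H -> H) c v : linear T -> T (c *: v) = c *: T v.
Proof. by move=> lin; rewrite -[c *: v]addr0 lin linear_op0 // addr0. Qed.
Lemma linear_opB (T : H -> H) u v : linear T -> T (u - v) = T u - T v.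
Proof. by move=> lin; rewrite -scaleN1r linear_opD // linear_opZ // scaleN1r. Qed.

Lemma adjoint_sym (T T' : H -> H) : adjoint T T' -> adjoint T' T.
Proof. by move=> TT u v; rewrite hdotC -TT -hdotC. Qed.

Section Dense.
Variables (X : Type) (eta : X -> H).
Hypothesis eta_dense : closure (range eta) = setT.

Lemma dense_near v (e : C) : 0 < e -> exists x, `|v - eta x| < e.
Proof.
move=> e0; have : closure (range eta) v by rewrite eta_dense.
move=> /(_ (ball v e) (nbhsx_ballx _ _ e0)) [_ [[x _ <-]]].
by rewrite -ball_normE => vx; exists x.
Qed.

Lemma dense_hdot u v : (forall x, '[u, eta x] = '[v, eta x]) -> u = v.
Proof.
move=> uv; apply/eqP; rewrite -subr_eq0; set w := u - v.
have w0 x : '[w, eta x] = 0 by rewrite hdotBl uv subrr.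
rewrite -normr_eq0 -sqrf_eq0; apply/eqP/(@squeeze0 _ `|w|); first by rewrite exprn_ge0.
move=> e e0 _; have [x wx] := dense_near w e0.
rewrite -hdot_norm -[hdot H w w]subr0 -(w0 x) -hdotBr.
have : 0 <= '[w, w - eta x] by rewrite hdotBr w0 subr0 hdot_norm exprn_ge0.
move/ger0_norm <-; apply: le_trans (hdot_le _ _) _.
by rewrite ler_wpM2l // ltW.
Qed.

(** [X] is a bare type and [f] merely Lipschitz, so the conjugate-linear [J] is covered as well. The
    estimate in the conclusion determines [F] as the continuous extension. *)
Lemma dense_extend (H' : completeNormedModType C) (f : X -> H') (c : C) : 0 <= c ->
  (forall x y, `|f x - f y| <= c * `|eta x - eta y|) ->
  exists F : H -> H', forall x v, `|f x - F v| <= c * `|eta x - v|.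
Proof.
move=> c0 fc; suff : forall v, exists l, forall x, `|f x - l| <= c * `|eta x - v|.
  by move/choice => [F FE]; exists F => x v; apply: FE.
move=> v; have /choice[u Hu] n : exists x, `|v - eta x| < n.+1%:R^-1.
  by apply: dense_near; rewrite invr_gt0 ltr0n.
have [|l Hl] := @complete_converges R H' (f \o u).
  apply: (@cauchy_seq_rate _ _ _ c c0) => n m /=; apply: le_trans (fc _ _) _.
  rewrite ler_wpM2l // -(subrK v (eta (u n))) -addrA; apply: le_trans (ler_normD _ _) _.
  by apply: lerD; rewrite ltW // distrC.
exists l => x; apply: (@le_eps _ _ _ (c + 1)); rewrite ?mulr_ge0 // => e e0 _.
have [N HN] := Hl e e0; have [M HM] := inv_nat_small e0.
pose n := maxn N M; have nl := HN n (leq_maxl _ _); have nM := HM n (leq_maxr _ _).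
have -> : f x - l = (f x - f (u n)) + (f (u n) - l) by rewrite addrA subrK.
apply: le_trans (ler_normD _ _) _; rewrite mulrDl mul1r addrA.
apply: lerD; last by rewrite distrC.
apply: le_trans (fc _ _) _; rewrite -mulrDr ler_wpM2l //.
have -> : eta x - eta (u n) = (eta x - v) + (v - eta (u n)) by rewrite addrA subrK.
apply: le_trans (ler_normD _ _) _; rewrite lerD2l.
by apply: le_trans nM; apply: ltW.
Qed.

Lemma dense_op (T T' : H -> H) : bounded_operators T -> bounded_operators T' ->
  (forall x, T (eta x) = T' (eta x)) -> T = T'.
Proof.
move=> /bounded_opP[lT [c c0 Tc]] /bounded_opP[lT' [c' c'0 Tc']] TT; apply/funext => v.
apply/eqP; rewrite -subr_eq0 -normr_eq0; apply/eqP/(@squeeze0 _ (c + c')) => // e e0 _.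
have [x vx] := dense_near v e0.
have -> : T v - T' v = T (v - eta x) - T' (v - eta x).
  by rewrite (linear_opB _ _ lT) (linear_opB _ _ lT') TT opprB addrA subrK.
apply: le_trans (ler_normB _ _) _; rewrite mulrDl.
apply: lerD; [apply: le_trans (Tc _) _|apply: le_trans (Tc' _) _].
  by rewrite ler_wpM2l // ltW.
by rewrite ler_wpM2l // ltW.
Qed.

End Dense.

End Hilbert.

Section Operators.
Variables (R : realType) (H : hilbert R).
Local Notation C := R[i].
Local Notation "''[' u , v ]" := (hdot H u%R v%R) : ring_scope.
Implicit Types u v w : H.

Lemma bounded_op_comp (S T : H -> H) : bounded_operators S -> bounded_operators T ->
  bounded_operators (S \o T).
Proof.
move=> /bounded_opP[lS [c c0 Sc]] /bounded_opP[lT [d d0 Td]]; apply/bounded_opP; split.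
  by move=> k u v /=; rewrite lT lS.
exists (c * d); first by rewrite mulr_ge0.
by move=> v; apply: le_trans (Sc _) _; rewrite -mulrA ler_wpM2l.
Qed.

Lemma bounded_op_scale (k : C) : bounded_operators (fun v : H => k *: v).
Proof.
apply/bounded_opP; split; first by move=> c u v; rewrite scalerDr !scalerA mulrC.
by exists `|k| => // v; rewrite normrZ.
Qed.

Lemma bounded_op_id : bounded_operators (@idfun H).
Proof. by apply/bounded_opP; split=> //; exists 1 => // v; rewrite mul1r. Qed.

Lemma bounded_op_sub (S T : H -> H) : bounded_operators S -> bounded_operators T ->
  bounded_operators (fun v => S v - T v).
Proof.
move=> /bounded_opP[lS [c c0 Sc]] /bounded_opP[lT [d d0 Td]]; apply/bounded_opP; split.
  by move=> k u v; rewrite lS lT scalerBr opprD addrACA.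
exists (c + d); first by rewrite addr_ge0.
move=> v; apply: le_trans (ler_normB _ _) _; rewrite mulrDl.
by apply: lerD.
Qed.

Lemma adjoint_comp (S S' T T' : H -> H) : adjoint S S' -> adjoint T T' ->
  adjoint (S \o T) (T' \o S').
Proof. by move=> SS TT u v /=; rewrite SS TT. Qed.

Lemma adjoint_bounded (T T' : H -> H) : bounded_operators T -> adjoint T T' ->
  bounded_operators T'.
Proof.
move=> /bounded_opP[lT [c c0 Tc]] TT; have TT' := adjoint_sym TT; apply/bounded_opP; split.
  move=> k u v; apply: hdot_eq => w.
  by rewrite TT' hdotDl hdotZl [in RHS]hdotDl hdotZl !TT'.
exists c => // v; have [->|nz] := eqVneq (T' v) 0; first by rewrite normr0 mulr_ge0.
have n0 : 0 < `|T' v| by rewrite normr_gt0.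
rewrite -(ler_pM2l n0) -expr2 -hdot_norm TT'.
have : 0 <= '[v, T (T' v)] by rewrite -TT' hdot_norm exprn_ge0.
move/ger0_norm <-; apply: le_trans (hdot_le _ _) _.
have -> : `|T' v| * (c * `|v|) = `|v| * (c * `|T' v|) by ring.
by rewrite ler_wpM2l.
Qed.

Lemma projection_norm (p : H -> H) v : projection p -> '[p v, v] = `|p v| ^+ 2.
Proof. by case=> _ pp ap; rewrite -hdot_norm -{1}pp /= ap. Qed.

Lemma projection_le (p : H -> H) v : projection p -> `|p v| <= `|v|.
Proof.
move=> pP; have [->|nz] := eqVneq (p v) 0; first by rewrite normr0.
have n0 : 0 < `|p v| by rewrite normr_gt0.
rewrite -(ler_pM2l n0) -expr2 -(projection_norm v pP).
have : 0 <= '[p v, v] by rewrite (projection_norm v pP) exprn_ge0.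
by move/ger0_norm <-; apply: hdot_le.
Qed.

(** The tool for extending identities from [range eta] to the whole space: [f] is the difference of
    the two sides. *)
Lemma dense_zero (X : Type) (eta : X -> H) (f : H -> C) (c : C) :
  closure (range eta) = setT -> 0 <= c -> (forall u v, `|f u - f v| <= c * `|u - v|) ->
  (forall x, f (eta x) = 0) -> forall v, f v = 0.
Proof.
move=> dense c0 fc f0 v; apply/normr0_eq0/(@squeeze0 _ c) => // e e0 _.
have [x vx] := dense_near dense v e0.
rewrite -[f v]subr0 -(f0 x); apply: le_trans (fc _ _) _.
by rewrite ler_wpM2l // ltW.
Qed.

Lemma dense_form (X : Type) (eta : X -> H) (T : H -> H) w w' :
  closure (range eta) = setT -> bounded_operators T ->
  (forall x, '[T (eta x), w] = '[eta x, w']) -> forall v, '[T v, w] = '[v, w'].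
Proof.
move=> dense /bounded_opP[lT [c c0 Tc]] E v; apply/eqP; rewrite -subr_eq0; apply/eqP.
apply: (@dense_zero _ eta (fun v => '[T v, w] - '[v, w']) (c * `|w| + `|w'|)) => //.
- by rewrite addr_ge0 // mulr_ge0.
- move=> a b; rewrite opprD addrACA -opprD -hdotBl -hdotBl -(linear_opB _ _ lT).
  apply: le_trans (ler_normB _ _) _; rewrite mulrDl; apply: lerD.
    apply: le_trans (hdot_le _ _) _; apply: le_trans (ler_wpM2r _ (Tc _)) _ => //.
    by rewrite mulrAC.
  by rewrite mulrC; apply: hdot_le.
- by move=> x; rewrite E subrr.
Qed.

Lemma adjoint_dense (X : Type) (eta : X -> H) (T T' : H -> H) :
  closure (range eta) = setT -> bounded_operators T -> bounded_operators T' ->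
  (forall x y, '[T (eta x), eta y] = '[eta x, T' (eta y)]) -> adjoint T T'.
Proof.
move=> dense bT bT' E; apply: adjoint_sym => u v; apply: (dense_form dense bT') => y.
by rewrite hdotC -(dense_form dense bT (w := eta y)) -?hdotC.
Qed.

Lemma norm_comb_sub (k : C) (a b a' b' : H) :
  `|(k *: a + b) - (k *: a' + b')| <= `|k| * `|a - a'| + `|b - b'|.
Proof. by rewrite opprD addrACA -scalerBr -normrZ; apply: ler_normD. Qed.

Lemma dense_extend_op (V : lmodType C) (eta f : V -> H) (c : C) :
  closure (range eta) = setT -> linear eta -> linear f -> 0 <= c ->
  (forall x, `|f x| <= c * `|eta x|) ->
  exists2 T : H -> H, bounded_operators T & forall x, T (eta x) = f x.
Proof.
move=> dense leta lf c0 fc.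
have sub (g : V -> H) x y : linear g -> g (x - y) = g x - g y.
  by move=> lg; rewrite -scaleN1r addrC lg scaleN1r addrC.
have [F FE] : exists F : H -> H, forall x v, `|f x - F v| <= c * `|eta x - v|.
  by apply: (dense_extend dense c0) => x y; rewrite -(sub f) // -(sub eta).
have Fx x : F (eta x) = f x.
  apply/eqP; rewrite eq_sym -subr_eq0 -normr_eq0 eq_le normr_ge0 andbT.
  by apply: le_trans (FE _ _) _; rewrite subrr normr0 mulr0.
exists F => //; apply/bounded_opP; split.
  move=> k u v; apply/eqP; rewrite -subr_eq0 -normr_eq0.
  apply/eqP/(@squeeze0 _ (2 * c * (`|k| + 1))) => // e e0 _.
  have [x ux] := dense_near dense u e0; have [y vy] := dense_near dense v e0.
  have xu : `|eta x - u| <= e by rewrite distrC ltW.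
  have yv : `|eta y - v| <= e by rewrite distrC ltW.
  apply: le_trans (ler_distD (f (k *: x + y)) _ _) _; rewrite [`|F _ - _|]distrC {2}lf.
  have -> : 2 * c * (`|k| + 1) * e = c * (`|k| * e + e) + (`|k| * (c * e) + c * e) by ring.
  apply: lerD.
    apply: le_trans (FE _ _) _; rewrite ler_wpM2l // leta.
    by apply: le_trans (norm_comb_sub _ _ _ _ _) _; rewrite lerD // ler_wpM2l.
  apply: le_trans (norm_comb_sub _ _ _ _ _) _; apply: lerD.
    by rewrite ler_wpM2l //; apply: le_trans (FE _ _) _; rewrite ler_wpM2l.
  by apply: le_trans (FE _ _) _; rewrite ler_wpM2l.
exists c => // v; apply: (@le_eps _ _ _ (2 * c)); rewrite ?mulr_ge0 // => e e0 _.
have [x vx] := dense_near dense v e0.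
have xv : `|eta x - v| <= e by rewrite distrC ltW.
rewrite -[F v](subrK (f x)); apply: le_trans (ler_normD _ _) _.
have -> : c * `|v| + 2 * c * e = c * e + c * (`|v| + e) by ring.
apply: lerD; first by rewrite distrC; apply: le_trans (FE _ _) _; rewrite ler_wpM2l.
apply: le_trans (fc _) _; rewrite ler_wpM2l // -{1}[eta x](subrK v) addrC.
by apply: le_trans (ler_normD _ _) _; rewrite lerD2l.
Qed.

Lemma converges_unique (u : nat -> H) l l' : converges u l -> converges u l' -> l = l'.
Proof.
move=> ul ul'; apply/eqP; rewrite -subr_eq0 -normr_eq0.
apply/eqP/(@squeeze0 _ 2) => // e e0 _; have [N HN] := ul e e0; have [M HM] := ul' e e0.
apply: le_trans (ler_distD (u (maxn N M)) _ _) _; rewrite -[2]/(1 + 1) mulrDl mul1r.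
by apply: lerD; [apply: HN; apply: leq_maxl|rewrite distrC; apply: HM; apply: leq_maxr].
Qed.

Lemma converges_op (T : H -> H) (u : nat -> H) l : bounded_operators T ->
  converges u l -> converges (T \o u) (T l).
Proof.
move=> /bounded_opP[lT [c c0 Tc]] ul e e0; have c1 : 0 < c + 1 by rewrite ltr_wpDl.
have [N HN] := ul _ (divr_gt0 e0 c1); exists N => n Nn /=.
rewrite -(linear_opB _ _ lT); apply: le_trans (Tc _) _.
apply: (@le_trans _ _ ((c + 1) * (e / (c + 1)))); last by rewrite mulrCA divff ?mulr1 // gt_eqF.
by apply: ler_pM; rewrite ?lerDl //; apply: HN.
Qed.

Lemma converges_lin (k : C) (u w : nat -> H) l l' : converges u l -> converges w l' ->
  converges (fun n => k *: u n + w n) (k *: l + l').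
Proof.
move=> ul wl e e0; have k1 : 0 < `|k| + 1 by rewrite ltr_wpDl.
have [N HN] := ul _ (divr_gt0 e0 k1); have [M HM] := wl _ (divr_gt0 e0 k1).
exists (maxn N M) => n; rewrite geq_max => /andP[/HN ln /HM l'n].
apply: le_trans (norm_comb_sub _ _ _ _ _) _.
rewrite [leRHS](_ : e = `|k| * (e / (`|k| + 1)) + e / (`|k| + 1)); last by field; rewrite gt_eqF.
by apply: lerD => //; rewrite ler_wpM2l.
Qed.

Lemma converges_shift (u : nat -> H) l : converges u l -> converges (fun n => u n.+1) l.
Proof. by move=> ul e /ul[N HN]; exists N => n Nn; apply: HN; apply: leqW. Qed.

Lemma converges_hdot (u : nat -> H) l w z : converges u l -> (forall n, '[u n, w] = z n) ->
  forall e, 0 < e -> exists N, forall n, (N <= n)%N -> `|'[l, w] - z n| <= e.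
Proof.
move=> ul uz e e0; have w1 : 0 < `|w| + 1 by rewrite ltr_wpDl.
have [N HN] := ul _ (divr_gt0 e0 w1); exists N => n Nn.
rewrite -uz -hdotBl; apply: le_trans (hdot_le _ _) _.
apply: (@le_trans _ _ ((e / (`|w| + 1)) * (`|w| + 1))); last by rewrite divfK // gt_eqF.
by apply: ler_pM; rewrite ?lerDl //; apply: HN.
Qed.

Lemma converges_norm (u : nat -> H) l k : 0 <= k -> converges u l -> (forall n, `|u n| <= k) ->
  `|l| <= k.
Proof.
move=> k0 ul uk; apply: (@le_eps _ _ _ 1) => // e e0 _; have [N HN] := ul e e0.
rewrite -[l](subrK (u N)); apply: le_trans (ler_normD _ _) _; rewrite mul1r addrC.
by apply: lerD; [apply: uk|apply: HN].
Qed.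

(** Otherwise [s] drops by [e] arbitrarily often, and the total drop is at most [s 0]. *)
Lemma decreasing_cauchy (s : nat -> C) : (forall n, 0 <= s n.+1 <= s n) ->
  forall e, 0 < e -> exists N, forall n, (N <= n)%N -> s N - s n <= e.
Proof.
move=> sP e e0; have s0 n : 0 <= s n.
  by case: n => [|n]; have /andP[h1 h2] := sP 0%N; [apply: le_trans h2|have /andP[]:= sP n].
apply: contrapT => /forallNP nH.
have far k : exists n, k%:R * e <= s 0 - s n.
  elim: k => [|k [n IH]]; first by exists 0; rewrite mul0r subrr.
  have /existsNP[m /not_implyP[_ /negP H1]] := nH n; exists m.
  have r : s n - s m \is Num.real by rewrite rpredB // ger0_real.
  have lt : e <= s n - s m.
    by apply: ltW; rewrite real_ltNge // ger0_real // ltW.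
  rewrite mulrS mulrDl mul1r addrC.
  have -> : s 0 - s m = (s 0 - s n) + (s n - s m) by rewrite addrA subrK.
  exact: lerD.
have : e = 0.
  apply: (@nat_mul_bounded _ e (s 0)) => [|k]; first exact: ltW.
  by have [n H1] := far k; apply: le_trans H1 _; rewrite lerBlDr lerDl.
by move=> e00; rewrite e00 ltxx in e0.
Qed.

End Operators.

Lemma commutant_sub (R : realType) (H : hilbert R) (S T : set (H -> H)) :
  (S `<=` T)%classic -> (commutant T `<=` commutant S)%classic.
Proof. by move=> ST X [bX cX]; split=> // Y /ST; apply: cX. Qed.

Lemma sub_bicommutant (R : realType) (H : hilbert R) (S : set (H -> H)) :
  (S `<=` @bounded_operators R H)%classic -> (S `<=` commutant (commutant S))%classic.
Proof. by move=> bS X SX; split; [exact: bS|move=> Y [_ cY]; rewrite cY]. Qed.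

Lemma eq_sqr_ge0 (F : numDomainType) (a b : F) : 0 <= a -> 0 <= b -> a ^+ 2 = b ^+ 2 -> a = b.
Proof. by move=> a0 b0 /eqP; rewrite eqrXn2 // => /eqP. Qed.

(** * The von Neumann algebra *)

Section Corner.
Variables (R : realType) (H : hilbert R) (e p : H -> H).
Hypotheses (eP : projection e) (pP : projection p).
Local Notation C := R[i].
Local Notation "''[' u , v ]" := (hdot H u%R v%R) : ring_scope.

Definition corner : H -> H := fun v => e v - e (p (e v)).

Let ee v : e (e v) = e v. Proof. by have [_ E _] := eP; have := congr1 (fun f => f v) E. Qed.
Let pp v : p (p v) = p v. Proof. by have [_ E _] := pP; have := congr1 (fun f => f v) E. Qed.
Let ae : adjoint e e. Proof. by case: eP. Qed.
Let ap : adjoint p p. Proof. by case: pP. Qed.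
Let be : bounded_operators e. Proof. by case: eP. Qed.
Let bp : bounded_operators p. Proof. by case: pP. Qed.

Lemma corner_bounded : bounded_operators corner.
Proof. exact: bounded_op_sub be (bounded_op_comp be (bounded_op_comp bp be)). Qed.

Lemma corner_adjoint : adjoint corner corner.
Proof. by move=> u v; rewrite /corner hdotBl hdotBr !ae ap ae. Qed.

Lemma e_corner v : e (corner v) = corner v.
Proof. by have /bounded_opP[le _] := be; rewrite /corner (linear_opB _ _ le) !ee. Qed.

Lemma iter_corner_bounded n : bounded_operators (iter n corner).
Proof.
elim: n => [|n IH]; first exact: bounded_op_id.
exact: bounded_op_comp corner_bounded IH.
Qed.

Lemma iter_corner_adjoint n : adjoint (iter n corner) (iter n corner).
Proof.
by elim: n => [|n IH] // u v; rewrite iterSr IH corner_adjoint.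
Qed.

Let defect v := e v - p (e v).

Let corner_defect v : corner v = e (defect v).
Proof. by have /bounded_opP[le _] := be; rewrite /corner /defect (linear_opB _ _ le) ee. Qed.

Let corner_dot v : '[corner v, v] = `|defect v| ^+ 2.
Proof.
have pd : p (defect v) = 0.
  by have /bounded_opP[lp _] := bp; rewrite /defect (linear_opB _ _ lp) pp subrr.
rewrite corner_defect ae -hdot_norm {3}/defect hdotBr.
by rewrite -[hdot H _ (p _)]ap pd hdot0l subr0.
Qed.

Let corner_step v : 0 <= '[corner v, v] <= `|v| ^+ 2 /\ `|corner v| ^+ 2 <= '[corner v, v].
Proof.
rewrite corner_dot exprn_ge0 //=; split.
  apply: lerXn2r; rewrite ?nnegrE //; apply: le_trans (projection_le v eP).
  have /bounded_opP[le _] := be; have /bounded_opP[lp _] := bp.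
  rewrite -(ler_pXn2r (ltn0Sn 1)) ?nnegrE // -!hdot_norm /defect hdotBl !hdotBr.
  rewrite !ap pp subrr subr0 lerBlDr lerDl -ap (projection_norm _ pP).
  by rewrite exprn_ge0.
by apply: lerXn2r; rewrite ?nnegrE // corner_defect; apply: projection_le.
Qed.

(** For [T := corner], self-adjointness gives [<T^(n+2) v, v> = <T^n T v, T v>], which reduces the
    claim to [0 <= T <= 1] and [T^2 <= T]. *)
Lemma iter_corner_dot n v : 0 <= '[iter n.+1 corner v, v] <= '[iter n corner v, v].
Proof.
elim/ltn_ind: n v => -[|[|n]] IH v.
- by rewrite /= hdot_norm; have [] := corner_step v.
- rewrite /= corner_adjoint hdot_norm exprn_ge0 //=.
  by have [] := corner_step v.
have key k : '[iter k.+2 corner v, v] = '[iter k corner (corner v), corner v].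
  by rewrite iterSr iterS corner_adjoint.
by rewrite (key n.+1) (key n); apply: IH.
Qed.

Lemma iter_corner_ge0 n v : 0 <= '[iter n corner v, v].
Proof.
by case: n => [|n]; [rewrite /= hdot_norm exprn_ge0|have /andP[] := iter_corner_dot n v].
Qed.

(** With [T := corner] and [s n = <T^n v, v>], the squared distance of [T^n v] and [T^m v] is
    [s (2 n) - 2 s (n + m) + s (2 m)], which is small since [s] decreases and is nonnegative. *)
Lemma iter_corner_converges v : exists l, converges (fun n => iter n corner v) l.
Proof.
apply: complete_converges => eps eps0.
have eps2 : 0 < eps ^+ 2 / 2 by rewrite divr_gt0 // exprn_gt0.
pose s n := '[iter n corner v, v].
have sP n : 0 <= s n.+1 <= s n by apply: iter_corner_dot.
have [N HN] := decreasing_cauchy sP eps2.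
have sle n m : (n <= m)%N -> s m <= s n.
  move=> nm; rewrite -(subnK nm); elim: (m - n)%N => [|k IH]; first by rewrite add0n.
  by rewrite addSn; apply: le_trans IH; have /andP[] := sP (k + n)%N.
have epsn := ltW eps0.
exists N => n m Nn Nm; rewrite -(ler_pXn2r (ltn0Sn 1)) ?nnegrE // -hdot_norm.
have prod i j : '[iter i corner v, iter j corner v] = s (j + i)%N.
  by rewrite -iter_corner_adjoint -iterD.
rewrite hdotBl !hdotBr !prod.
have -> : s (n + n)%N - s (m + n)%N - (s (n + m)%N - s (m + m)%N) =
    (s (n + n)%N - s (m + n)%N) + (s (m + m)%N - s (m + n)%N) by rewrite [(n + m)%N]addnC; ring.
have lo : s N - eps ^+ 2 / 2 <= s (m + n)%N.
  by rewrite lerBlDr -lerBlDl; apply: HN; apply: leq_trans Nm _; apply: leq_addr.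
have d k : (N <= k)%N -> s (k + k)%N - s (m + n)%N <= eps ^+ 2 / 2.
  move=> Nk; rewrite lerBlDr; apply: le_trans (sle N _ _) _.
    by apply: leq_trans Nk _; apply: leq_addr.
  by rewrite -lerBlDl.
have -> : eps ^+ 2 = eps ^+ 2 / 2 + eps ^+ 2 / 2 by field.
by apply: lerD; apply: d.
Qed.

(* The powers of [e (1 - p) e] decrease to the projection onto [e H] intersected with [ker p]. *)
Lemma corner_limit : exists q : H -> H,
  [/\ forall v, converges (fun n => iter n corner v) (q v), projection q,
      forall v, e (q v) = q v & forall v, corner (q v) = q v].
Proof.
have [q qE] := choice iter_corner_converges; exists q.
have /bounded_opP[le _] := be.
have cq v : corner (q v) = q v.
  move: (converges_op corner_bounded (qE v)) => /converges_unique; apply.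
  exact: (converges_shift (qE v)).
have eq v : e (q v) = q v by rewrite -cq e_corner.
have icq n v : iter n corner (q v) = q v by elim: n => //= n ->.
have le_iter n v : `|iter n corner v| <= `|v|.
  elim: n => [|n IH] //=; apply: le_trans IH; set w := iter n corner v.
  have [/andP[_ h1] h2] := corner_step w.
  rewrite -(ler_pXn2r (ltn0Sn 1)) ?nnegrE //; exact: le_trans h2 h1.
have bq : bounded_operators q.
  apply/bounded_opP; split=> [k u v|].
    apply: (converges_unique (qE _)); have := converges_lin k (qE u) (qE v).
    move=> h eps /h[N HN]; exists N => n /HN; have /bounded_opP[li _] := iter_corner_bounded n.
    by rewrite li.
  by exists 1 => // v; rewrite mul1r; apply: (converges_norm _ (qE v)).
split=> //; split=> //.
  apply/funext => v /=; apply: (converges_unique (qE _)).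
  by move=> eps eps0; exists 0 => n _; rewrite icq subrr normr0 ltW.
move=> u v; apply/eqP; rewrite -subr_eq0; apply/eqP/normr0_eq0/(@squeeze0 _ 2) => // eps eps0 _.
have [N HN] := converges_hdot (qE u) (fun n => erefl '[iter n corner u, v]) eps0.
have [K HK] := converges_hdot (qE v) (fun n => erefl '[iter n corner v, u]) eps0.
pose n := maxn N K; have h1 := HN n (leq_maxl _ _); have h2 := HK n (leq_maxr _ _).
apply: le_trans (ler_distD ('[iter n corner u, v]) _ _) _; rewrite -[2]/(1 + 1) mulrDl mul1r.
apply: lerD => //; rewrite iter_corner_adjoint [hdot H u _]hdotC [hdot H u (q v)]hdotC.
by rewrite -rmorphB norm_conjC distrC.
Qed.

End Corner.

(** * Factoriality, finiteness, absence of minimal projections *)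

Section Factor.
Variables (R : realType) (D : R) (A : star_algebra R[i]) (phi : A -> R[i]).
Hypotheses (D_gt1 : 1 < D) (laws : trace_laws D phi).
Variables (H : hilbert R) (eta : A -> H) (pi : A -> H -> H).
Hypothesis gns : is_GNS phi eta pi.

Local Notation C := R[i].
Local Notation "''[' u , v ]" := (hdot H u%R v%R) : ring_scope.
Local Notation "x ** y" := (sa_mul x y) (at level 40, left associativity).
Local Notation star := (@sa_star C A).
Local Notation one := (sa_one A).
Local Notation Omega := (eta one).
Local Notation M := (commutant (commutant (range pi))).
Implicit Types (u v w : H) (T X : H -> H) (a b x y : A).

Let eta_linear : linear eta. Proof. by have [? _ _ _ _] := gns. Qed.
Let eta_form x y : '[eta x, eta y] = gns_form phi x y. Proof. by have [_ e _ _ _] := gns; apply: e. Qed.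
Let eta_dense : closure (range eta) = setT. Proof. by have [_ _ d _ _] := gns. Qed.
Let pi_bounded a : bounded_operators (pi a). Proof. by have [_ _ _ p _] := gns; apply: p. Qed.
Let pi_eta a x : pi a (eta x) = eta (a ** x). Proof. by have [_ _ _ _ p] := gns; apply: p. Qed.

Lemma eta_eq x y : (forall z, gns_form phi x z = gns_form phi y z) -> eta x = eta y.
Proof. by move=> xy; apply: (dense_hdot eta_dense) => z; rewrite !eta_form. Qed.

Lemma pi_Omega a : pi a Omega = eta a.
Proof. by rewrite pi_eta; apply: eta_eq => z; apply: (form_mul1 laws). Qed.

Lemma norm_eta x : `|eta x| ^+ 2 = gns_form phi x x.
Proof. by rewrite -hdot_norm eta_form. Qed.

Lemma norm_Omega : `|Omega| = 1.
Proof. by apply: eq_sqr_ge0 => //; rewrite norm_eta (form_one laws) expr1n. Qed.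

Lemma pi_adjoint a : adjoint (pi a) (pi (star a)).
Proof.
apply: (adjoint_dense eta_dense (pi_bounded a) (pi_bounded _)) => x y.
by rewrite !pi_eta !eta_form (form_adjl laws).
Qed.

Lemma form_starC x y : gns_form phi (star x) (star y) = gns_form phi y x.
Proof. by rewrite (form_star laws) (form_starK laws). Qed.

Lemma norm_eta_star x : `|eta (star x)| = `|eta x|.
Proof. by apply: eq_sqr_ge0 => //; rewrite !norm_eta form_starC. Qed.

(** The involution is isometric because [phi] is a trace; being conjugate-linear, it is extended by
    [dense_extend]. *)
Lemma conjugation_exists : exists J : H -> H,
  [/\ forall x, J (eta x) = eta (star x), forall v b, '[J v, eta b] = '[eta (star b), v],
      forall v, `|J v| = `|v| & forall u v, `|J u - J v| <= `|u - v|].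
Proof.
have iso x y : `|eta (star x) - eta (star y)| = `|eta x - eta y|.
  apply: eq_sqr_ge0 => //.
  by rewrite -!hdot_norm !hdotBl !hdotBr !eta_form !form_starC; ring.
have [J JE] : exists J : H -> H, forall x v, `|eta (star x) - J v| <= 1 * `|eta x - v|.
  by apply: (dense_extend eta_dense) => // x y; rewrite mul1r iso.
have Je x : J (eta x) = eta (star x).
  apply/eqP; rewrite eq_sym -subr_eq0 -normr_eq0 eq_le normr_ge0 andbT.
  by apply: le_trans (JE _ _) _; rewrite subrr normr0 mulr0.
have Jl u v : `|J u - J v| <= `|u - v|.
  apply: (@le_eps _ _ _ 2) => // e e0 _; have [x ux] := dense_near eta_dense u e0.
  have xu : `|eta x - u| <= e by rewrite distrC ltW.
  apply: le_trans (ler_distD (eta (star x)) _ _) _; rewrite distrC.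
  apply: le_trans (lerD (JE _ _) (JE _ _)) _; rewrite !mul1r.
  have -> : `|u - v| + 2 * e = e + (e + `|u - v|) by ring.
  apply: lerD => //; apply: le_trans (ler_distD u _ _) _.
  by rewrite lerD2r.
exists J; split=> // [v b|v].
  apply/eqP; rewrite -subr_eq0; apply/eqP.
  apply: (@dense_zero _ _ _ eta (fun v => '[J v, eta b] - '[eta (star b), v])
    (`|eta b| + `|eta (star b)|)) => //; rewrite ?addr_ge0 //.
  - move=> u w; rewrite opprD addrACA -opprD -hdotBl -hdotBr.
    apply: le_trans (ler_normB _ _) _; rewrite mulrDl; apply: lerD.
      by apply: le_trans (hdot_le _ _) _; rewrite mulrC ler_wpM2l.
    exact: hdot_le.
  - by move=> x; rewrite Je !eta_form (form_star laws) subrr.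
apply/eqP; rewrite -subr_eq0; apply/eqP.
apply: (@dense_zero _ _ _ eta (fun v => `|J v| - `|v|) 2) => // [u w|x].
  rewrite opprD addrACA -opprD; apply: le_trans (ler_normB _ _) _.
  rewrite -[2]/(1 + 1) mulrDl mul1r; apply: lerD; last exact: ler_dist_dist.
  exact: le_trans (ler_dist_dist _ _) (Jl _ _).
by rewrite Je norm_eta_star subrr.
Qed.

(** The isometric involution turns right multiplication by [a] into left multiplication by [star a],
    which is bounded. These operators give access to the commutant of [range pi]. *)
Lemma right_mul_exists : exists Rm : A -> H -> H,
  [/\ forall a, bounded_operators (Rm a), forall a x, Rm a (eta x) = eta (x ** a),
      forall a, adjoint (Rm a) (Rm (star a)) & forall a, commutant (range pi) (Rm a)].
Proof.
have ex a : exists T, bounded_operators T /\ forall x, T (eta x) = eta (x ** a).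
  have [c c0 bd] := form_bounded laws (star a).
  have lin : linear (fun x => eta (x ** a)).
    move=> k x y; apply: (dense_hdot eta_dense) => z.
    by rewrite hdotDl hdotZl !eta_form !(form_adjr laws) (form_lin laws).
  have bdd x : `|eta (x ** a)| <= sqrtC c * `|eta x|.
    have h : 0 <= sqrtC c * `|eta x| by rewrite mulr_ge0 ?sqrtC_ge0.
    rewrite -(ler_pXn2r (ltn0Sn 1)) ?nnegrE // exprMn sqrtCK -(norm_eta_star (x ** a)).
    rewrite (eta_eq (form_star_mul laws x a)) !norm_eta -[gns_form phi x x]form_starC; exact: bd.
  have c0' : 0 <= sqrtC c by rewrite sqrtC_ge0.
  have [T bT TE] := dense_extend_op eta_dense eta_linear lin c0' bdd.
  by exists T.
have [Rm RmP] := choice ex; exists Rm; split=> [a|a|a|a].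
- by case: (RmP a).
- by case: (RmP a).
- apply: (adjoint_dense eta_dense (RmP a).1 (RmP _).1) => x y.
  by rewrite (RmP a).2 (RmP _).2 !eta_form (form_adjr laws).
split; first by case: (RmP a).
move=> _ [b _ <-]; apply: (dense_op eta_dense); try exact: bounded_op_comp (RmP a).1 _;
  try exact: bounded_op_comp _ (RmP a).1.
move=> x /=; rewrite (RmP a).2 !pi_eta (RmP a).2; apply: eta_eq => z.
exact: (form_mulA laws).
Qed.

Lemma M_bounded T : M T -> bounded_operators T. Proof. by case. Qed.

Lemma range_pi_bounded : (range pi `<=` @bounded_operators R H)%classic.
Proof. by move=> _ [a _ <-]. Qed.

Lemma M_pi a : M (pi a).
Proof. by apply: (sub_bicommutant range_pi_bounded); exists a. Qed.

Lemma M_idfun : M idfun.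
Proof. by split; [exact: bounded_op_id|]. Qed.

Lemma M_comp S T : M S -> M T -> M (S \o T).
Proof.
move=> [bS cS] [bT cT]; split; first exact: bounded_op_comp.
by move=> X cX; rewrite -compA cT // compA cS.
Qed.

Lemma M_sub S T : M S -> M T -> M (fun v => S v - T v).
Proof.
move=> [bS cS] [bT cT]; split; first exact: bounded_op_sub.
move=> X cX; have [/bounded_opP[lX _] _] := cX; apply/funext => v /=.
rewrite (linear_opB _ _ lX); congr (_ - _).
  by have := congr1 (fun f => f v) (cS _ cX).
by have := congr1 (fun f => f v) (cT _ cX).
Qed.

Lemma M_commutes T X v : M T -> commutant (range pi) X -> T (X v) = X (T v).
Proof. by move=> [_ cT] /cT E; have := congr1 (fun f => f v) E. Qed.

Lemma commutant_pi X a v : commutant (range pi) X -> X (pi a v) = pi a (X v).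
Proof. by move=> [_ cX]; have := congr1 (fun f => f v) (cX (pi a) (ex_intro2 _ _ a I erefl)). Qed.

Lemma commutant_M X T v : commutant M X -> M T -> X (T v) = T (X v).
Proof. by move=> [_ cX] /cX E; have := congr1 (fun f => f v) E. Qed.

(** [Omega] is separating for [M]: right multiplications commute with [M] and carry [Omega] to the
    dense set of vectors [eta x]. *)
Lemma M_eta_eq S T : M S -> M T -> S Omega = T Omega -> S = T.
Proof.
have [Rm [bR RE _ cR]] := right_mul_exists; move=> MS MT ST.
apply: (dense_op eta_dense (M_bounded MS) (M_bounded MT)) => x.
have -> : eta x = Rm x Omega by rewrite RE; apply: eta_eq => z; rewrite (form_1mul laws).
by rewrite (M_commutes _ MS) // (M_commutes _ MT) // ST.
Qed.

(** The usual argument passes to the adjoint of an [X] in the commutant. Here [J (X Omega)] plays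
    the role of [X^* Omega]: [keyX] says that [X^*] sends [S (eta b)] to [S (pi b (J (X Omega)))],
    and this is applied to [S = T] and to the identity. *)
Lemma M_adjoint T T' : M T -> adjoint T T' -> M T'.
Proof.
have [Rm [bR RE aR cR]] := right_mul_exists; have [J [Je Jd Jn Jl]] := conjugation_exists.
move=> MT TT; have bT := M_bounded MT; have bT' := adjoint_bounded bT TT.
split=> // X cX; have bX := cX.1.
(* For [xi = eta x] the vector [pi a xi] is [Rm x (eta a)], and the adjoint of [Rm x] commutes with
   [S]; both sides are Lipschitz in [xi]. *)
have key S : M S -> forall xi a b, '[pi a xi, S (eta b)] = '[eta a, S (pi b (J xi))].
  move=> MS xi a b; have /bounded_opP[lS [cS cS0 Sc]] := M_bounded MS.
  have /bounded_opP[la [ca ca0 ac]] := pi_bounded a.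
  have /bounded_opP[lb [cb cb0 bc]] := pi_bounded b.
  apply/eqP; rewrite -subr_eq0; apply/eqP.
  apply: (@dense_zero _ _ _ eta (fun xi => '[pi a xi, S (eta b)] - '[eta a, S (pi b (J xi))])
    (ca * `|S (eta b)| + `|eta a| * (cS * cb))) => //; rewrite ?addr_ge0 ?mulr_ge0 //.
    move=> u w; rewrite opprD addrACA -opprD -hdotBl -hdotBr.
    rewrite -(linear_opB _ _ la) -(linear_opB _ _ lS) -(linear_opB _ _ lb).
    apply: le_trans (ler_normB _ _) _; rewrite mulrDl; apply: lerD.
      apply: le_trans (hdot_le _ _) _; rewrite mulrAC ler_wpM2r //; exact: ac.
    apply: le_trans (hdot_le _ _) _; rewrite -!mulrA ler_wpM2l //.
    apply: le_trans (Sc _) _; rewrite ler_wpM2l //; apply: le_trans (bc _) _.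
    by rewrite ler_wpM2l.
  move=> x; rewrite pi_eta Je pi_eta -RE -!RE aR.
  rewrite -(M_commutes _ MS) ?RE ?subrr //; exact: cR.
have keyX S : M S -> forall v b, '[X v, S (eta b)] = '[v, S (pi b (J (X Omega)))].
  move=> MS v b; apply: (dense_form eta_dense bX) => a.
  by rewrite -pi_Omega commutant_pi // key // pi_Omega.
apply/funext => v; apply: (dense_hdot eta_dense) => b /=.
rewrite (adjoint_sym TT) (keyX _ MT) -(adjoint_sym TT).
by rewrite (keyX _ M_idfun).
Qed.

Lemma M_von_neumann : von_neumann_algebra M.
Proof.
split; [by move=> T []|exact: M_adjoint|].
have E3 : commutant M = commutant (range pi).
  apply/seteqP; split; first exact: commutant_sub (sub_bicommutant range_pi_bounded).
  by apply: sub_bicommutant => T [].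
by rewrite E3.
Qed.

Lemma center_scalar z : M z -> commutant M z -> exists c : C, z = (fun v => c *: v).
Proof.
have [Rm [bR RE aR cR]] := right_mul_exists; move=> Mz cz.
have /bounded_opP[lz [c c0 zc]] := M_bounded Mz.
pose tau x := '[z (eta x), Omega].
have zpi a v : z (pi a v) = pi a (z v) by exact: (commutant_M v cz (M_pi a)).
have tau_lin : scalar tau.
  by move=> k x y; rewrite /tau eta_linear lz hdotDl hdotZl.
(* [z] commutes with [pi x] since it lies in the commutant of [M], and with right multiplications
   since it lies in [M]. *)
have tau_tr x y : tau (x ** y) = tau (y ** x).
  rewrite /tau -pi_eta zpi pi_adjoint pi_Omega -RE (M_commutes _ Mz) // aR RE.
  by congr (hdot H _ _); apply/esym/eta_eq => w; apply: (form_1mul laws).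
have tau_bd : exists k, forall x, `|tau x| ^+ 2 <= k * gns_form phi x x.
  exists (c ^+ 2) => x; rewrite -norm_eta -exprMn.
  apply: lerXn2r; rewrite ?nnegrE ?mulr_ge0 //.
  by apply: le_trans (hdot_le _ _) _; rewrite norm_Omega mulr1; apply: zc.
have uniq := form_unique laws tau_lin tau_tr tau_bd.
exists (tau one); apply: M_eta_eq => //.
  split; first exact: bounded_op_scale.
  move=> X [/bounded_opP[lX _] _]; apply/funext => v /=.
  by rewrite (linear_opZ _ _ lX).
apply: (dense_hdot eta_dense) => y; rewrite -(pi_Omega y).
rewrite -(adjoint_sym (pi_adjoint y)) -zpi hdotZl -(adjoint_sym (pi_adjoint y)) pi_Omega.
by rewrite eta_form; apply: uniq.
Qed.

Lemma scalar_op_M (c : C) : M (fun v : H => c *: v).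
Proof.
split; first exact: bounded_op_scale.
move=> X [/bounded_opP[lX _] _]; apply/funext => v /=.
by rewrite (linear_opZ _ _ lX).
Qed.

Lemma M_factor : vn_factor M.
Proof.
split; [|exact: M_von_neumann|].
  exists Omega => O0; have := norm_Omega; rewrite O0 normr0 => /eqP.
  by rewrite eq_sym oner_eq0.
apply/seteqP; split=> [z [Mz cz]|_ [c _ <-]].
  by have [c ->] := center_scalar Mz cz; exists c.
split; first exact: scalar_op_M.
split; first exact: bounded_op_scale.
move=> X /M_bounded/bounded_opP[lX _]; apply/funext => v /=.
by rewrite (linear_opZ _ _ lX).
Qed.

(* [J] is the extension of [a Omega |-> a^* Omega]. *)
Lemma conjugation_M (J : H -> H) T T' : (forall v b, '[J v, eta b] = '[eta (star b), v]) ->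
  M T -> adjoint T T' -> J (T Omega) = T' Omega.
Proof.
have [Rm [bR RE aR cR]] := right_mul_exists; move=> Jd MT TT.
have R1 b : Rm b Omega = eta b by rewrite RE; apply: eta_eq => z; apply: (form_1mul laws).
apply: (dense_hdot eta_dense) => b.
rewrite Jd (adjoint_sym TT) -[in RHS](R1 b) (M_commutes _ MT) //.
by rewrite -(adjoint_sym (aR b)) R1.
Qed.

Lemma norm_adjoint_Omega T T' : M T -> adjoint T T' -> `|T' Omega| = `|T Omega|.
Proof.
have [J [_ Jd Jn _]] := conjugation_exists.
by move=> MT TT; rewrite -(conjugation_M Jd MT TT).
Qed.

(** [J] exchanges [T Omega] with [T' Omega] and fixes [S Omega]. By the symmetry
    [<J v, w> = <J w, v>], both sides equal [<T Omega, S Omega>]. *)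
Lemma trace_comm S T T' : M S -> adjoint S S -> M T -> adjoint T T' ->
  '[S (T Omega), Omega] = '[T (S Omega), Omega].
Proof.
have [J [Je Jd Jn Jl]] := conjugation_exists; move=> MS SS MT TT.
have MT' := M_adjoint MT TT; have TT' := adjoint_sym TT.
have Jsym v w : '[J v, w] = '[J w, v].
  apply/eqP; rewrite -subr_eq0; apply/eqP.
  apply: (@dense_zero _ _ _ eta (fun w => '[J v, w] - '[J w, v]) (`|J v| + `|v|)) => //; rewrite ?addr_ge0 //.
    move=> a b; rewrite opprD addrACA -opprD -hdotBl -hdotBr.
    apply: le_trans (ler_normB _ _) _; rewrite mulrDl; apply: lerD; first exact: hdot_le.
    by apply: le_trans (hdot_le _ _) _; rewrite mulrC ler_wpM2l.
  by move=> x; rewrite Jd Je subrr.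
by rewrite SS (TT (S Omega)) -[in RHS](conjugation_M Jd MS SS) Jsym (conjugation_M Jd MT' TT').
Qed.

(** Since [J] is isometric, [|W Omega| = |V Omega| = 1]. Then [V (W Omega)] and [Omega] are unit
    vectors with inner product 1, hence equal, and [Omega] is separating. *)
Lemma M_finite : finite_algebra M.
Proof.
move=> V W MV VW WV; have MW := M_adjoint MV VW.
have WVv v : W (V v) = v by have := congr1 (fun f => f v) WV.
have nV : `|V Omega| = 1.
  by apply: eq_sqr_ge0 => //; rewrite -hdot_norm VW WVv hdot_norm norm_Omega expr1n.
have nW : `|W Omega| = 1 by rewrite (norm_adjoint_Omega MV VW).
apply: M_eta_eq; [exact: M_comp|exact: M_idfun|].
apply/eqP; rewrite -subr_eq0 -normr_eq0 -sqrf_eq0 -hdot_norm /= hdotBl !hdotBr.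
have e1 : '[V (W Omega), Omega] = 1 by rewrite VW hdot_norm nW expr1n.
have e2 : '[V (W Omega), V (W Omega)] = 1 by rewrite VW WVv hdot_norm nW expr1n.
by rewrite e1 e2 [hdot H Omega _]hdotC e1 conjC1 hdot_norm norm_Omega expr1n !subrr.
Qed.

Lemma M_iter_corner n e p : M e -> M p -> M (iter n (corner e p)).
Proof.
move=> Me Mp; elim: n => [|n IH]; first exact: M_idfun.
by apply: (M_comp _ IH); apply: M_sub => //; apply: M_comp => //; apply: M_comp.
Qed.

(** [e p e] and [p e p] have the same moments under the trace, so the powers of [e - e p e] and of
    [p - p e p] fall short of [e] and [p] by the same amount. The first term on the right is
    nonnegative; this bounds the powers of the corner of [e] from below. *)
Lemma trace_corner n e p : M e -> projection e -> M p -> projection p ->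
  '[iter n (corner e p) (e Omega), Omega] - '[e Omega, Omega] =
  '[iter n (corner p e) (p Omega), Omega] - '[p Omega, Omega].
Proof.
move=> Me eP Mp pP; have [be ee ae] := eP; have [bp pp ap] := pP.
have eeE v : e (e v) = e v by have := congr1 (fun f => f v) ee.
have ppE v : p (p v) = p v by have := congr1 (fun f => f v) pp.
have /bounded_opP[le _] := be; have /bounded_opP[lp _] := bp.
have absorb k v : e (iter k (corner e p) (e v)) = iter k (corner e p) (e v).
  by case: k => [|k]; rewrite ?eeE // iterS e_corner.
have absorb' k v : p (iter k (corner p e) (p v)) = iter k (corner p e) (p v).
  by case: k => [|k]; rewrite ?ppE // iterS e_corner.
have inter k v : p (iter k (corner e p) (e v)) = iter k (corner p e) (p (e v)).
  elim: k => [|k IH] //=; rewrite -IH; set w := iter k _ _.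
  by rewrite /corner (linear_opB _ _ lp) /w absorb !ppE.
elim: n => [|n IH]; first by rewrite /= !subrr.
(* Passing from [n] to [n.+1] subtracts [e T e] on the left and [T e p] on the right; both have the
   trace of [T e]. *)
pose T := iter n (corner p e) \o p.
have MT : M (T \o e) by apply: M_comp => //; apply: M_comp => //; apply: M_iter_corner.
have aT : adjoint (T \o e) (e \o (p \o iter n (corner p e))).
  by apply: adjoint_comp ae; apply: adjoint_comp ap; apply: iter_corner_adjoint.
have c1 := trace_comm Me ae MT aT; have c2 := trace_comm Mp ap MT aT.
rewrite /= eeE in c1; rewrite /= absorb' in c2.
have [li _] := (bounded_opP _).1 (iter_corner_bounded pP eP n).
have -> : iter n.+1 (corner e p) (e Omega) =
    iter n (corner e p) (e Omega) - e (iter n (corner p e) (p (e Omega))).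
  by rewrite iterS; set w := iter _ _ _; rewrite /corner /w absorb inter.
have -> : iter n.+1 (corner p e) (p Omega) =
    iter n (corner p e) (p Omega) - iter n (corner p e) (p (e (p Omega))).
  rewrite iterSr -(linear_opB _ _ li); congr (iter n _ _).
  by rewrite /corner ppE.
by rewrite !hdotBl c1 -c2 addrAC IH addrAC.
Qed.

Lemma trace_e_pos e : M e -> projection e -> e <> (fun=> 0) -> 0 < '[e Omega, Omega].
Proof.
move=> Me eP e0; rewrite (projection_norm _ eP) exprn_gt0 // normr_gt0.
apply/eqP => eO; apply: e0; apply: M_eta_eq => //.
have -> : (fun=> 0) = (fun v : H => 0 *: v) by apply/funext => v; rewrite scale0r.
exact: scalar_op_M.
Qed.

(** By Bernoulli's inequality, [m * (D - 1) <= D ^+ m]. *)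
Lemma small_power (t : C) : 0 < t -> exists m, D%:C ^- m < t.
Proof.
move=> t0; pose d : C := D%:C - 1.
have d0 : 0 < d by rewrite subr_gt0 -(rmorph1 (real_complex R)) ltcR.
have d0' := ltW d0; have t0' := ltW t0.
have bern m : m%:R * d <= D%:C ^+ m.
  elim: m => [|m IH]; first by rewrite mul0r expr0.
  have D1 : D%:C = 1 + d :> C by rewrite /d addrC subrK.
  rewrite exprS {1}D1 mulrDl mul1r mulrSr mulrDl mul1r; apply: lerD => //.
  rewrite -[leLHS]mulr1 ler_wpM2l // exprn_ege1 //.
  by rewrite -(rmorph1 (real_complex R)) lecR ltW.
have DX m : 0 < D%:C ^+ m :> C by rewrite exprn_gt0 // ltcR (lt_trans _ D_gt1).
apply: contrapT => /forallNP nlt; have td : t * d = 0.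
  apply: (@nat_mul_bounded _ _ 1) => [|m]; first by rewrite mulr_ge0.
  have : t <= D%:C ^- m.
    have h : 0 <= D%:C ^- m by rewrite invr_ge0 ltW.
    by rewrite real_leNgt ?ger0_real ?(ltW t0) //; apply/negP; apply: nlt.
  rewrite -(ler_pM2r (DX m)) mulVf ?gt_eqF //; apply: le_trans.
  by rewrite mulrCA ler_wpM2l.
by move: (mulr_gt0 t0 d0); rewrite td ltxx.
Qed.

(* [p] is [p_j ... p_(j+m-1)] for a large j, which is asymptotically independent of [e]. *)
Lemma dot_projection m e : M e -> projection e -> 0 < '[e Omega, Omega] ->
  exists p, [/\ M p, projection p, '[p Omega, Omega] = D%:C ^- m & '[e Omega, p Omega] != 0].
Proof.
move=> Me eP t0; have [pj [p_adj p_idem p_lim]] := form_dots laws m.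
set s : C := D%:C ^- m; set t := '[e Omega, Omega] in t0.
have s0 : 0 < s by rewrite invr_gt0 exprn_gt0 // ltcR (lt_trans _ D_gt1).
have s1 : s <= 1.
  rewrite invf_le1 ?exprn_gt0 ?ltcR ?(lt_trans _ D_gt1) // exprn_ege1 //.
  by rewrite -(rmorph1 (real_complex R)) lecR ltW.
have pP j : projection (pi (pj j)).
  split=> //.
    apply: (dense_op eta_dense) => // [|x /=]; first exact: bounded_op_comp.
    by rewrite !pi_eta; apply: eta_eq => z; apply: p_idem.
  by apply: (adjoint_dense eta_dense) => // x y; rewrite !pi_eta !eta_form p_adj.
(* If [<e Omega, p Omega>] were 0, replacing [e Omega] by [eta a] would cost at most [de] in each of
   two terms, so that [s * t <= 2 * de = s * t / 2]. *)
pose de := s * t / 4; have de0 : 0 < de by rewrite divr_gt0 ?mulr_gt0.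
have [a ea] := dense_near eta_dense (e Omega) de0.
have [n0 Hn0] := p_lim one; have [n1 Hn1] := p_lim a; pose j := maxn n0 n1.
have pO : pi (pj j) Omega = eta (pj j) by exact: pi_Omega.
have pOO : '[pi (pj j) Omega, Omega] = s.
  rewrite pO hdotC eta_form Hn0 ?leq_maxl // (form_one laws) mulr1 /s.
  by rewrite fmorphV rmorphXn /= -[(_^*)%R]/(conjc D%:C) conjc_real.
exists (pi (pj j)); split=> //; first exact: M_pi.
apply/eqP => E; have E2 : '[eta a, pi (pj j) Omega] = s * '[eta a, Omega].
  by rewrite pO !eta_form Hn1 ?leq_maxr.
have : s * t <= de + de.
  have st0 : 0 <= s * t by rewrite ltW // mulr_gt0.
  rewrite -[s * t]ger0_norm //.
  have -> : s * t = '[eta a - e Omega, pi (pj j) Omega] - s * '[eta a - e Omega, Omega].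
    by rewrite !hdotBl E E2 /t; ring.
  apply: le_trans (ler_normB _ _) _; apply: lerD.
    apply: le_trans (hdot_le _ _) _; rewrite distrC -[leRHS]mulr1; apply: ler_pM => //.
      exact: ltW.
    by rewrite -norm_Omega; apply: projection_le.
  rewrite normrM (gtr0_norm s0) -[leRHS]mul1r; apply: ler_pM => //; first exact: ltW.
  by apply: le_trans (hdot_le _ _) _; rewrite norm_Omega mulr1 distrC ltW.
have -> : de + de = s * t / 2 by rewrite /de; field.
rewrite ler_pdivlMr // ger_pMr ?mulr_gt0 //.
by rewrite -[1]/(1%:R) ler_nat.
Qed.

Lemma M_no_minimal : ~ (exists e, minimal_projection M e).
Proof.
move=> [e [Me eP e0 emin]]; have t0 := trace_e_pos Me eP e0.
have [m sm] := small_power t0; have [p [Mp pP ps ep]] := dot_projection m Me eP t0.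
have [q [qE qP eq cq]] := corner_limit eP pP.
have Mq : M q.
  split=> [|X cX]; first by case: qP.
  apply/funext => v /=; apply: (converges_unique (qE _)).
  have := converges_op cX.1 (qE v); move=> h eps /h[N HN]; exists N => n /HN /=.
  by rewrite (M_commutes _ (M_iter_corner n Me Mp)).
have /bounded_opP[le _] := M_bounded Me.
have [q0|qe] := emin q Mq qP (funext eq).
  pose d := '[e Omega, Omega] - D%:C ^- m; have d0 : 0 < d by rewrite subr_gt0.
  have d20 : 0 < d / 2 by rewrite divr_gt0.
  have [N HN] := converges_hdot (qE (e Omega)) (fun n => erefl '[iter n (corner e p) (e Omega), Omega]) d20.
  have := HN N (leqnn N); rewrite q0 hdot0l sub0r normrN.
  have tc := trace_corner N Me eP Mp pP.
  have : d <= '[iter N (corner e p) (e Omega), Omega].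
    have -> : '[iter N (corner e p) (e Omega), Omega] =
        d + '[iter N (corner p e) (p Omega), Omega].
      by rewrite -(subrK '[e Omega, Omega] '[iter N (corner e p) _, _]) tc /d ps; ring.
    rewrite lerDl; case: N {HN tc} => [|N]; first by rewrite /= (projection_norm _ pP) exprn_ge0.
    have [_ pp ap] := pP; have ppE v : p (p v) = p v by have := congr1 (fun f => f v) pp.
    have -> : iter N.+1 (corner p e) (p Omega) = p (iter N.+1 (corner p e) (p Omega)).
      by rewrite iterS e_corner.
    by rewrite ap; apply: iter_corner_ge0.
  move=> dle; rewrite ger0_norm; last by apply: le_trans dle; apply: ltW.
  move=> le2; have := le_trans dle le2; rewrite ler_pdivlMr // ger_pMr //.
  by rewrite -[1]/(1%:R) ler_nat.
(* In the case [q = e] the corner fixes [e Omega], which means [e p e Omega = 0]; this contradicts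
   the choice of [p]. *)
have := cq Omega; rewrite qe /corner => /eqP.
have [_ ee ae] := eP; have eeE v : e (e v) = e v by have := congr1 (fun f => f v) ee.
rewrite !eeE -subr_eq0 addrAC subrr sub0r oppr_eq0 => /eqP epe0.
have pe0 : p (e Omega) = 0.
  apply/eqP; rewrite -normr_eq0 -sqrf_eq0 -(projection_norm _ pP).
  by rewrite -ae epe0 hdot0l.
by have [_ _ ap] := pP; move: ep; rewrite -ap pe0 hdot0l eqxx.
Qed.

Lemma M_II1_factor : II1_factor M.
Proof. by split; [exact: M_factor|exact: M_finite|exact: M_no_minimal]. Qed.

End Factor.

(** * Existence of the GNS representation *)

(* The completion of a semi-inner product space: the functionals [f] that are norm limits of
   functionals [b x]. *)
Section Completion.
Variables (R : realType) (V : lmodType R[i]) (b : V -> V -> R[i]) (bP : semi_inner b).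
Local Notation C := R[i].
Local Notation N := (ipn b).

(** The dual norm of [f - b x] with respect to the seminorm [N] is at most [e]. *)
Definition approx (f : V -> C^o) (x : V) (e : C) : Prop := forall y, `|f y - b x y| <= e * N y.

Definition limits (_ : semi_inner b) : {pred V -> C^o} :=
  fun f => `[< forall e : C, 0 < e -> exists x, approx f x e >].

Let N0 y : 0 <= N y. Proof. exact: (ipn_ge0 bP). Qed.

Lemma norm_comb_sub_le (k a a' c c' : C) :
  `|(k * a + c) - (k * a' + c')| <= `|k| * `|a - a'| + `|c - c'|.
Proof. by rewrite opprD addrACA -mulrBr -normrM; apply: ler_normD. Qed.

Lemma approx_lin k f g x y e e' : approx f x e -> approx g y e' ->
  approx (fun z => k * f z + g z) (k *: x + y) (`|k| * e + e').
Proof.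
move=> fx gy z; rewrite (ip_lin bP) mulrDl -mulrA.
apply: le_trans (norm_comb_sub_le _ _ _ _ _) _.
by apply: lerD => //; rewrite ler_wpM2l.
Qed.

Lemma limits_submod : submod_closed (limits bP).
Proof.
split.
  apply/asboolP => e e0; exists 0 => y; rewrite (ip0l bP) subr0 normr0 mulr_ge0 ?N0 //.
  exact: ltW.
move=> k f g /asboolP fP /asboolP gP; apply/asboolP => e e0.
have k1 : 0 < `|k| + 1 by rewrite ltr_wpDl.
have [x fx] := fP _ (divr_gt0 e0 k1); have [y gy] := gP _ (divr_gt0 e0 k1).
exists (k *: x + y); have := approx_lin k fx gy.
by have -> : `|k| * (e / (`|k| + 1)) + e / (`|k| + 1) = e by field; rewrite gt_eqF.
Qed.

HB.instance Definition _ := GRing.isSubmodClosed.Build C (V -> C^o) (limits bP) limits_submod.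

Record completion := Completion { fn :> V -> C^o ; fnP : fn \in limits bP }.

HB.instance Definition _ := [isSub for fn].
HB.instance Definition _ := [Choice of completion by <:].
HB.instance Definition _ := [SubChoice_isSubLmodule of completion by <:].

Implicit Types f g : completion.

Lemma fn_lin k f g y : (k *: f + g) y = k * f y + g y. Proof. by []. Qed.

Lemma completion_eq f g : (forall y, f y = g y) -> f = g.
Proof. by move=> fg; apply: val_inj; apply/funext. Qed.

Lemma fn_approx f (e : C) : 0 < e -> exists x, approx f x e.
Proof. by have /asboolP := fnP f; apply. Qed.

Lemma fnB f x y : f (x - y) = f x - f y.
Proof.
apply/eqP; rewrite -subr_eq0 -normr_eq0.
apply/eqP/(@squeeze0 _ (N (x - y) + N x + N y)) => // e e0 _; have [z fz] := fn_approx f e0.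
have -> : f (x - y) - (f x - f y) =
    (f (x - y) - b z (x - y)) - (f x - b z x) + (f y - b z y) by rewrite (ipBr bP); ring.
apply: le_trans (ler_normD _ _) _.
have -> : (N (x - y) + N x + N y) * e = (e * N (x - y) + e * N x) + e * N y by ring.
apply: lerD => //; apply: le_trans (ler_normB _ _) _; exact: lerD.
Qed.

Definition bound (f : V -> C) (c : C) : Prop := 0 <= c /\ forall y, `|f y| <= c * N y.

Lemma approx_bound (f : V -> C^o) x e : 0 <= e -> approx f x e -> bound f (e + N x).
Proof.
move=> e0 fx; split=> [|y]; first by rewrite addr_ge0.
rewrite -[f y](subrK (b x y)); apply: le_trans (ler_normD _ _) _.
by rewrite mulrDl; apply: lerD => //; apply: (ip_le bP).
Qed.

Lemma fn_bound f : exists c, bound f c.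
Proof.
by have [x fx] := fn_approx f ltr01; exists (1 + N x); apply: approx_bound.
Qed.

Lemma approx_dist (g : V -> C^o) v v' e e' : 0 <= e -> 0 <= e' -> approx g v e -> approx g v' e' ->
  N (v - v') <= e + e'.
Proof.
move=> e0 e'0 gv gv'; have [->|nz] := eqVneq (N (v - v')) 0; first exact: addr_ge0.
have n0 : 0 < N (v - v') by rewrite lt_def nz N0.
rewrite -(ler_pM2r n0) -expr2 (ipn_sqr b) -(ger0_norm (ip_ge0 bP (v - v'))).
set w := v - v' in n0 *; rewrite {1}/w (ipBl bP).
have -> : b v w - b v' w = (g w - b v' w) - (g w - b v w) by ring.
apply: le_trans (ler_normB _ _) _; rewrite addrC mulrDl.
by apply: lerD.
Qed.

Lemma bound_norm_le (g : V -> C^o) c y e : bound g c -> 0 <= e -> approx g y e -> N y <= c + e.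
Proof.
move=> [c0 gc] e0 gy; have [->|nz] := eqVneq (N y) 0; first by rewrite addr_ge0.
have n0 : 0 < N y by rewrite lt_def nz N0.
rewrite -(ler_pM2r n0) -expr2 (ipn_sqr b) -(ger0_norm (ip_ge0 bP y)).
have -> : b y y = g y - (g y - b y y) by ring.
by apply: le_trans (ler_normB _ _) _; rewrite mulrDl; apply: lerD.
Qed.

(** The inner product is the limit of [f v] as [b v] tends to [g]. An error estimate for every
    approximation [v] of [g] determines the value without reference to a chosen sequence. *)
Lemma dot_exists f g : exists z : C, forall c v e, bound f c -> 0 <= e -> approx g v e ->
  `|z - f v| <= c * e.
Proof.
have [c0 [c00 fc0]] := fn_bound f.
have /choice[u Hu] n : exists x, approx g x (n.+1%:R^-1).
  by apply: fn_approx; rewrite invr_gt0 ltr0n.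
have inv0 n : 0 <= n.+1%:R^-1 :> C by rewrite invr_ge0.
have [|z Hz] := @complex_converges R (fun n => f (u n)).
  apply: (@cauchy_seq_rate _ _ _ c0 c00) => n m; rewrite -fnB.
  apply: le_trans (fc0 _) _; rewrite ler_wpM2l //.
  exact: (approx_dist (inv0 n) (inv0 m) (Hu n) (Hu m)).
exists z => c v e [c1 fc] e0 gv; apply: (@le_eps _ _ _ (1 + c)); rewrite ?mulr_ge0 // => d d0 _.
have [K HK] := Hz d d0; have [L HL] := inv_nat_small d0.
pose n := maxn K L; have h1 := HK n (leq_maxl _ _); have h2 := HL n (leq_maxr _ _).
apply: le_trans (ler_distD (f (u n)) _ _) _.
have -> : c * e + (1 + c) * d = d + c * (d + e) by ring.
apply: lerD => //; rewrite -fnB; apply: le_trans (fc _) _; rewrite ler_wpM2l //.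
apply: le_trans (approx_dist (inv0 n) e0 (Hu n) gv) _.
by rewrite lerD2r.
Qed.

Definition cdot f g : C := projT1 (cid (dot_exists f g)).

Lemma cdotP f g c v e : bound f c -> 0 <= e -> approx g v e -> `|cdot f g - f v| <= c * e.
Proof. exact: (projT2 (cid (dot_exists f g))). Qed.

(** Approximates both arguments at once, so that conjugate symmetry and positivity pass from [b] to
    [cdot]. *)
Lemma cdot_form f g : exists c, forall e x y, 0 < e -> e <= 1 ->
  approx f x e -> approx g y e -> `|cdot f g - b x y| <= c * e.
Proof.
have [cf [cf0 fc]] := fn_bound f; have [cg [cg0 gc]] := fn_bound g.
exists (cf + (cg + 1)) => e x y e0 e1 fx gy; apply: le_trans (ler_distD (f y) _ _) _; rewrite mulrDl.
apply: lerD; first exact: (cdotP (conj cf0 fc) (ltW e0) gy).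
apply: le_trans (fx y) _; rewrite mulrC ler_wpM2r ?(ltW e0) //.
apply: le_trans (bound_norm_le (conj cg0 gc) (ltW e0) gy) _.
by rewrite lerD2l.
Qed.

Lemma cdot_lin k f g h : cdot (k *: f + g) h = k * cdot f h + cdot g h.
Proof.
have [cf bf] := fn_bound f; have [cg bg] := fn_bound g; have [cs bs] := fn_bound (k *: f + g).
apply/eqP; rewrite -subr_eq0 -normr_eq0.
apply/eqP/(@squeeze0 _ (cs + (`|k| * cf + cg))) => // e e0 _; have [v hv] := fn_approx h e0.
have e0' := ltW e0.
apply: le_trans (ler_distD ((k *: f + g) v) _ _) _; rewrite mulrDl.
apply: lerD; first exact: (cdotP bs e0' hv).
rewrite distrC fn_lin; apply: le_trans (norm_comb_sub_le _ _ _ _ _) _.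
rewrite mulrDl -mulrA; apply: lerD; last exact: (cdotP bg e0' hv).
by rewrite ler_wpM2l //; apply: (cdotP bf e0' hv).
Qed.

Lemma cdot_conj f g : cdot g f = ((cdot f g)^*)%R.
Proof.
have [c cP] := cdot_form f g; have [c' cP'] := cdot_form g f.
apply/eqP; rewrite -subr_eq0 -normr_eq0.
apply/eqP/(@squeeze0 _ (c' + c)) => // e e0 e1.
have [x fx] := fn_approx f e0; have [y gy] := fn_approx g e0.
apply: le_trans (ler_distD (b y x) _ _) _; rewrite mulrDl; apply: lerD; first exact: cP'.
by rewrite (ip_conj bP) -rmorphB norm_conjC distrC; apply: cP.
Qed.

Lemma cdot_ge0 f : 0 <= cdot f f.
Proof.
have [c cP] := cdot_form f f; have sf : ((cdot f f)^*)%R = cdot f f by rewrite -cdot_conj.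
have r : cdot f f \is Num.real by apply/CrealP.
suff z : `|cdot f f| - cdot f f = 0 by rewrite -[cdot f f](subKr `|cdot f f|) z subr0.
apply: (@squeeze0 _ (2 * c)) => [|e e0 e1]; first by rewrite subr_ge0 real_ler_norm.
have [x fx] := fn_approx f e0; have := cP e x x e0 e1 fx fx => h.
have h1 : `|cdot f f| <= c * e + b x x.
  rewrite -[cdot f f](subrK (b x x)); apply: le_trans (ler_normD _ _) _.
  by rewrite (ger0_norm (ip_ge0 bP x)) lerD2r.
have h2 : b x x - cdot f f <= c * e.
  apply: le_trans h; rewrite distrC; apply: real_ler_norm.
  by rewrite rpredB // ger0_real // (ip_ge0 bP).
have -> : 2 * c * e = c * e + c * e by ring.
have -> : `|cdot f f| - cdot f f = (`|cdot f f| - b x x) + (b x x - cdot f f) by ring.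
by apply: lerD => //; rewrite lerBlDr.
Qed.

Lemma cdot_semi : semi_inner cdot.
Proof. by split; [exact: cdot_lin|exact: cdot_conj|exact: cdot_ge0]. Qed.

Lemma limits_form x : ((b x : V -> C^o) : V -> C^o) \in limits bP.
Proof.
apply/asboolP => e e0; exists x => y; rewrite subrr normr0 mulr_ge0 ?N0 //.
exact: ltW.
Qed.

Definition embed x : completion := Completion (limits_form x).

Lemma cdot_embed f x : cdot f (embed x) = f x.
Proof.
have [c bc] := fn_bound f; apply/eqP; rewrite -subr_eq0 -normr_eq0 eq_le normr_ge0 andbT.
have : approx (embed x) x 0 by move=> y; rewrite subrr normr0 mul0r.
by move/(cdotP bc (lexx 0)); rewrite mulr0.
Qed.

Lemma embed_linear : linear embed.
Proof. by move=> k x y; apply: completion_eq => z; apply: (ip_lin bP). Qed.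

Local Notation cnorm := (ipn cdot).

Lemma cdot_eq0 f : cdot f f = 0 -> f = 0.
Proof.
move=> f0; apply: completion_eq => y; apply/eqP; rewrite -[f y]cdot_embed -normr_eq0 -sqrf_eq0.
by rewrite eq_le exprn_ge0 // andbT; apply: le_trans (ip_CS cdot_semi _ _) _; rewrite f0 mul0r.
Qed.

Lemma cnorm_eq0 f : cnorm f = 0 -> f = 0.
Proof. by move=> f0; apply: cdot_eq0; rewrite -(ipn_sqr cdot) f0 expr0n. Qed.

HB.instance Definition _ := Lmodule_isNormed.Build C completion
  (ipn_triangle cdot_semi) (ipnZ cdot_semi) cnorm_eq0.

Lemma completion_normE f : `|f| = cnorm f. Proof. by []. Qed.

(** For [g := f - embed x] and [v] close to [g], the number [<g, g>] is close to [g v]. The dual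
    norm bounds the latter by [e * N v], and [N v] exceeds [e] by an arbitrarily small amount at
    most. *)
Lemma approx_norm f x e : 0 <= e -> approx f x e -> `|f - embed x| <= e.
Proof.
move=> e0 fx; set g := f - embed x.
have bg : bound g e by split.
rewrite -(ler_pXn2r (ltn0Sn 1)) ?nnegrE // completion_normE (ipn_sqr cdot).
apply: (@le_eps _ _ _ (2 * e)); rewrite ?exprn_ge0 ?cdot_ge0 // => d d0 _.
have [v gv] := fn_approx g d0; have d0' := ltW d0.
rewrite -(ger0_norm (cdot_ge0 g)) -[cdot g g](subrK (g v)).
apply: le_trans (ler_normD _ _) _.
have -> : e ^+ 2 + 2 * e * d = e * d + e * (e + d) by ring.
apply: lerD; first exact: (cdotP bg d0' gv).
by apply: le_trans (bg.2 v) _; rewrite ler_wpM2l //; apply: (bound_norm_le bg d0' gv).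
Qed.

Lemma embed_dense f (e : C) : 0 < e -> exists x, `|f - embed x| <= e.
Proof. by move=> e0; have [x fx] := fn_approx f e0; exists x; apply: approx_norm (ltW e0) fx. Qed.

Lemma norm_embedB x y : `|embed x - embed y| = N (x - y).
Proof.
have -> : embed x - embed y = embed (x - y).
  by apply: completion_eq => z; rewrite /= (ipBl bP).
by rewrite completion_normE /ipn cdot_embed.
Qed.

(** Choose [u n] whose ball of radius [1 / (n + 1)] belongs to the filter, and [x n] equally close
    to [u n]. The functionals [b (x n)] converge pointwise with a rate in the dual norm, so the
    limit belongs to the completion. *)
Lemma completion_complete (F : set_system completion) : ProperFilter F -> cauchy F -> cvg F.
Proof.
move=> FF /cauchyP cF; have inv0 n : 0 < n.+1%:R^-1 :> C by rewrite invr_gt0 ltr0n.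
have /choice[u Hu] n : exists f : completion, F (ball f (n.+1%:R^-1)) by apply: cF.
have /choice[x Hx] n : exists x, `|u n - embed x| <= n.+1%:R^-1 by apply: embed_dense.
have uu n m : `|u n - u m| <= n.+1%:R^-1 + m.+1%:R^-1.
  have [f []] := @filter_ex _ F FF _ (@filterI _ F _ _ _ (Hu n) (Hu m)).
  rewrite -!ball_normE /= => nf mf.
  apply: le_trans (ler_distD f _ _) _; apply: lerD; first exact: ltW.
  by rewrite distrC ltW.
have xx n m : N (x n - x m) <= 2 * (n.+1%:R^-1 + m.+1%:R^-1).
  rewrite -norm_embedB; apply: le_trans (ler_distD (u n) _ _) _.
  have -> : 2 * (n.+1%:R^-1 + m.+1%:R^-1) =
    n.+1%:R^-1 + ((n.+1%:R^-1 + m.+1%:R^-1) + m.+1%:R^-1) :> C by ring.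
  apply: lerD; first by rewrite distrC.
  by apply: le_trans (ler_distD (u m) _ _) _; apply: lerD.
have /choice[l Hl] y : exists z : C, converges (fun n => b (x n) y) z.
  apply: complex_converges; apply: (@cauchy_seq_rate _ _ _ (2 * N y)); first by rewrite mulr_ge0.
  move=> n m; rewrite -(ipBl bP); apply: le_trans (ip_le bP _ _) _.
  by rewrite [leRHS]mulrAC; apply: ler_wpM2r; [exact: N0|exact: xx].
have la n : approx l (x n) (2 * n.+1%:R^-1).
  move=> y; have h : 0 <= 2 * n.+1%:R^-1 :> C by rewrite mulr_ge0 // ltW.
  apply: (@le_eps _ _ _ (1 + 2 * N y)); rewrite ?mulr_ge0 // => e e0 _.
  have [K HK] := Hl y e e0; have [L HL] := inv_nat_small e0.
  pose m := maxn K L; have h1 := HK m (leq_maxl _ _); have h2 := HL m (leq_maxr _ _).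
  apply: le_trans (ler_distD (b (x m) y) _ _) _.
  have -> : 2 * n.+1%:R^-1 * N y + (1 + 2 * N y) * e = e + 2 * (e + n.+1%:R^-1) * N y by ring.
  apply: lerD => //; rewrite -(ipBl bP); apply: le_trans (ip_le bP _ _) _.
  rewrite ler_wpM2r //; apply: le_trans (xx _ _) _; rewrite ler_wpM2l //.
  by rewrite lerD2r.
have lP : (l : V -> C^o) \in limits bP.
  apply/asboolP => e e0; have e20 : 0 < e / 2 by rewrite divr_gt0.
  have [K /(_ K (leqnn K)) HK] := inv_nat_small e20; exists (x K) => y.
  apply: le_trans (la K y) _; rewrite ler_wpM2r //.
  by rewrite mulrC -ler_pdivlMr.
apply/cvg_ex; exists (Completion lP); apply/cvgrPdist_le => e e0.
(* The errors are [2], [1] and [1] times [1 / (K + 1)]: from the limit to [x K], from there to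
   [u K], and from [u K] to [f]. *)
have e40 : 0 < e / 4 by rewrite divr_gt0.
have [K /(_ K (leqnn K)) HK] := inv_nat_small e40.
apply: filterS (Hu K) => f; rewrite -ball_normE /= => uf.
apply: le_trans (ler_distD (u K) _ _) _; apply: le_trans (lerD (ler_distD (embed (x K)) _ _) (ltW uf)) _.
have h2 : 0 <= 2 * K.+1%:R^-1 :> C by rewrite mulr_ge0 // ltW.
have h3 : `|Completion lP - embed (x K)| <= 2 * K.+1%:R^-1 by exact: (@approx_norm (Completion lP) _ _ h2 (la K)).
have h4 : `|embed (x K) - u K| <= K.+1%:R^-1 by rewrite distrC.
apply: (@le_trans _ _ ((2 * K.+1%:R^-1 + K.+1%:R^-1) + K.+1%:R^-1)); first by rewrite lerD2r lerD.
have -> : 2 * K.+1%:R^-1 + K.+1%:R^-1 + K.+1%:R^-1 = 4 * K.+1%:R^-1 :> C by ring.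
by rewrite mulrC -ler_pdivlMr.
Qed.

HB.instance Definition _ := Uniform_isComplete.Build completion completion_complete.

Let cdot_addl y : zmod_morphism (cdot^~ y). Proof. by move=> f g; apply: (ipBl cdot_semi). Qed.
Let cdot_addr f : zmod_morphism (cdot f). Proof. by move=> g h; apply: (ipBr cdot_semi). Qed.
Let cdot_scalel y : scalable_for *%R (cdot^~ y). Proof. by move=> k f; apply: (ipZl cdot_semi). Qed.
Let cdot_scaler f : scalable_for (Num.conj \; *%R) (cdot f).
Proof. by move=> k g; apply: (ipZr cdot_semi). Qed.

HB.instance Definition _ := isBilinear.Build C completion completion C *%R (Num.conj \; *%R) cdot
  cdot_addl cdot_addr cdot_scalel cdot_scaler.

Let cdot_herm f g : cdot f g = (-1) ^+ false * ((cdot g f)^*)%R.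
Proof. by rewrite expr0 mul1r; apply: cdot_conj. Qed.

HB.instance Definition _ := isHermitianSesquilinear.Build C completion false Num.conj cdot cdot_herm.

Let cdot_pos f : f != 0 -> 0 < cdot f f.
Proof. by move=> f0; rewrite lt_def cdot_ge0 andbT; apply: contra f0 => /eqP/cdot_eq0 ->. Qed.

HB.instance Definition _ := isDotProduct.Build C completion cdot cdot_pos.

Lemma cdot_normE f : cdot f f = `|f| ^+ 2.
Proof. by rewrite completion_normE (ipn_sqr cdot). Qed.

Definition completion_hilbert : hilbert R :=
  @Hilbert R completion (cdot : {dot completion for Num.conj}) cdot_normE.

End Completion.

Lemma GNS_exists (R : realType) (D : R) (A : star_algebra R[i]) (phi : A -> R[i]) :
  trace_laws D phi -> exists (H : hilbert R) (eta : A -> H) (pi : A -> H -> H), is_GNS phi eta pi.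
Proof.
move=> laws; have fP : semi_inner (gns_form phi).
  by split; [exact: (form_lin laws)|exact: (form_conj laws)|exact: (form_ge0 laws)].
pose H := completion_hilbert fP; pose eta : A -> H := embed fP.
have lin : linear eta by apply: embed_linear.
have eta_form x y : hdot H (eta x) (eta y) = gns_form phi x y by apply: (cdot_embed (embed fP x) y).
have dense : closure (range eta) = setT.
  apply/seteqP; split=> // f _ B /nbhs_ballP[e e0 Be].
  have e20 : 0 < e / 2 by rewrite divr_gt0.
  have [x fx] := @embed_dense _ _ _ fP f _ e20.
  exists (eta x); split; first by exists x.
  apply: Be; rewrite -ball_normE /=; apply: le_lt_trans fx _.
  by rewrite ltr_pdivrMr // ltr_pMr // ltr1n.
have /choice[pi Hpi] a : exists T : H -> H, bounded_operators T /\ forall x, T (eta x) = eta (sa_mul a x).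
  have [c c0 bd] := form_bounded laws a.
  have lina : linear (fun x => eta (sa_mul a x)).
    move=> k x y; apply: (dense_hdot dense) => z.
    by rewrite hdotDl hdotZl !eta_form (form_mul_lin laws).
  have c0' : 0 <= sqrtC c by rewrite sqrtC_ge0.
  have bda x : `|eta (sa_mul a x)| <= sqrtC c * `|eta x|.
    have h : 0 <= sqrtC c * `|eta x| by rewrite mulr_ge0.
    have sqr y : `|eta y| ^+ 2 = gns_form phi y y by rewrite -hdot_norm eta_form.
    rewrite -(ler_pXn2r (ltn0Sn 1)) ?nnegrE // exprMn !sqr (sqrtCK c).
    exact: bd.
  by have [T bT TE] := dense_extend_op dense lin lina c0' bda; exists T.
exists H, eta, pi; split=> // a; first by case: (Hpi a).
by case: (Hpi a).
Qed.

Theorem theorem4p1 (R : realType) (D : R)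
    (hD : (exists n : nat, (3 <= n)%N /\ D = 2 * cos (pi / n%:R) + 1) \/ 3 <= D) :
  factor_trace (@tr_M R D) /\
  GNS_algebra (@tr_A R D) (fun H M => II1_factor M).
Proof.
have [D_gt1 [sq [sq1 sq_ge0 sq_eigen]]] := perron_frobenius hD.
have zero_mrad n (x : motz R n) : x \in @mzero R n -> x \in @mrad R D n.
  by move/eqP->; apply: rpred0.
have lawsM := union_trace_laws D_gt1 sq1 sq_ge0 sq_eigen
  (K := fun n => @mzero R n : submodClosed (motz R n)) zero_mrad.
have lawsA := union_trace_laws D_gt1 sq1 sq_ge0 sq_eigen
  (K := fun n => @mrad R D n : submodClosed (motz R n)) (fun n x rx => rx).
split; [split|]; last first.
- split; first exact: GNS_exists lawsA.
  by move=> H eta pi gns; apply: (M_II1_factor D_gt1 lawsA gns).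
- split; first exact: GNS_exists lawsM.
  by move=> H eta pi gns; apply: (M_factor lawsM gns).
exact: (phi_tracial_state D_gt1 sq1 sq_ge0 sq_eigen zero_mrad).
Qed.
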